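(* Let $Q$ be a non-empty poset. (a) If $r\ge 2$ and $n\in\mathbb{N}$, then there exists an $i=i(r,n)$ such that $$La(n,P_{l(Q)+2},Q\oplus r)\le\max_{0\le j\le n}\left\{\binom{n}{i}\,\beta^r_0\left(\binom{[n-i]}{j-i}\right)La(j,P_{l(Q)+1},Q)\right\}.$$ Furthermore, if the level conjecture almost holds for the pair $P_{l(Q)+1},Q$, then so it does for the pair $P_{l(Q)+2},\,Q\oplus r$. (b) If $r=1$, then $$La(n,P_{l(Q)+2},Q\oplus 1)\le\max_{0\le j\le n}\left\{\binom{n}{j}La(j,P_{l(Q)+1},Q)\right\}.$$ Furthermore, if the level conjecture strongly holds for the pair $P_{l(Q)+1},Q$, then it strongly holds for the pair $P_{l(Q)+2},\,Q\oplus 1$; and the same is true with ''strongly holds'' replaced by ''almost holds'' throughout.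
   Context: $[n]=\{1,\dots,n\}$ (with $[0]=\emptyset$), $2^{[n]}$ is the family of all subsets of $[n]$, and, for a set $X$, $\binom{X}{k}$ denotes the family of all $k$-element subsets of $X$; the families $\binom{[n]}{k}$ are the full levels of $2^{[n]}$. For a finite poset $P$ and a family $\mathcal{F}$ of sets, a subfamily $\mathcal{G}\subseteq\mathcal{F}$ is a copy of $P$ in $\mathcal{F}$ if there is a bijection $\phi:P\to\mathcal{G}$ such that $x\le_Px'$ implies $\phi(x)\subseteq\phi(x')$ (the converse is not required). $c(P,\mathcal{F})$ is the number of copies of $P$ in $\mathcal{F}$; $\mathcal{F}$ is $P$-free if $c(P,\mathcal{F})=0$. $La(n,P,Q)=\max\{c(Q,\mathcal{F}):\mathcal{F}\subseteq 2^{[n]},\ c(P,\mathcal{F})=0\}$. $P_k$ is the chain on $k$ elements, and $l(P)$ is the height of $P$ (number of elements in a longest chain of $P$). $Q\oplus r$ is the poset obtained from $Q$ by adding $r$ new elements that form an antichain and are all larger than every element of $Q$. For a family $\mathcal{F}$ of sets, $\beta^r_0(\mathcal{F})$ is the number of unordered $r$-tuples $\{F_1,\dots,F_r\}$ of $r$ different members of $\mathcal{F}$ with $F_1\cap\dots\cap F_r=\emptyset$. The level conjecture says that for any pair $P,Q$ of posets with $l(P)>l(Q)$ there is a sequence of $P$-free families $\mathcal{F}_n\subseteq 2^{[n]}$, all of them unions of full levels, with $La(n,P,Q)=(1+o(1))c(Q,\mathcal{F}_n)$. For a pair $P,Q$ of posets (with no assumption on $l(P)$ and $l(Q)$) we say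 that it strongly holds if for all large enough $n$ there is a $P$-free family $\mathcal{F}_n\subseteq 2^{[n]}$ that is a union of full levels with $La(n,P,Q)=c(Q,\mathcal{F}_n)$; it almost holds if there are $P$-free families $\mathcal{F}_n\subseteq 2^{[n]}$, each a union of full levels, with $La(n,P,Q)=O(n^kc(Q,\mathcal{F}_n))$ for some $k$ that depends only on $P$ and $Q$. *)

(* Defs.v *)
(* Generalised forbidden subposet problems.  The ground set [n] is
   'I_n = {0, ..., n-1}; finite posets are finPOrderType's, and the chain P_k is
   'I_k with its library order. *)
From HB Require Import structures.
From mathcomp Require Import all_boot all_order.
Set Implicit Arguments.
Unset Strict Implicit.
Unset Printing Implicit Defensive.
Import Order.Theory.

Definition height (d : Order.disp_t) (P : finPOrderType d) : nat :=
  \max_(C : {set P} | [forall x in C, forall y in C, (x >=< y)%O]) #|C|.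

(* Q (+) r : inl embeds Q, inr gives the new top elements. *)
Definition oplus (Q : Type) (r : nat) : Type := (Q + 'I_r)%type.

HB.instance Definition _ (Q : finType) r := Finite.on (oplus Q r).

Section OplusOrder.
Variables (d : Order.disp_t) (Q : finPOrderType d) (r : nat).

Definition oplus_le (u v : oplus Q r) : bool :=
  match u, v with
  | inl x, inl y => (x <= y)%O
  | inl _, inr _ => true
  | inr _, inl _ => false
  | inr i, inr j => i == j
  end.

Fact oplus_le_refl : reflexive oplus_le.
Proof. by case=> [x|i] /=. Qed.

Fact oplus_le_anti : antisymmetric oplus_le.
Proof.
case=> [x|i] [y|j] //=; first by move/le_anti->.
by case/andP=> /eqP->.
Qed.

Fact oplus_le_trans : transitive oplus_le.
Proof.
case=> [y|j] [x|i] [z|k] //=; first exact: le_trans.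
by move=> /eqP-> /eqP->.
Qed.

HB.instance Definition _ := Order.Le_isPOrder.Build d (oplus Q r)
  oplus_le_refl oplus_le_anti oplus_le_trans.
End OplusOrder.

(* Weak (not necessarily induced) copies: comparabilities of P are preserved
   but need not be reflected. *)
Definition is_copy (d : Order.disp_t) (P : finPOrderType d) (T : finType)
    (G : {set {set T}}) : bool :=
  [exists phi : {ffun P -> {set T}},
    [&& injectiveb phi, phi @: [set: P] == G
      & [forall x, forall y, (x <= y)%O ==> (phi x \subset phi y)]]].

(* The copies are counted as subfamilies, not as embeddings. *)
Definition ncopies (d : Order.disp_t) (P : finPOrderType d) (T : finType)
    (F : {set {set T}}) : nat :=
  #|[set G : {set {set T}} | (G \subset F) && is_copy P G]|.

Definition poset_free (d : Order.disp_t) (P : finPOrderType d) (T : finType)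
    (F : {set {set T}}) : bool :=
  ncopies P F == 0.

Definition La (n : nat) (d : Order.disp_t) (P : finPOrderType d)
    (d' : Order.disp_t) (Q : finPOrderType d') : nat :=
  \max_(F : {set {set 'I_n}} | poset_free P F) ncopies Q F.

Definition level (n k : nat) : {set {set 'I_n}} :=
  [set A : {set 'I_n} | #|A| == k].

Definition full_levels (n : nat) (F : {set {set 'I_n}}) : Prop :=
  exists K : {set 'I_n.+1}, F = \bigcup_(k in K) level n k.

(* For j < i the truncated level m (j - i) is level m 0 = [set set0] instead of
   the empty family; beta0 r is 0 on both as soon as 2 <= r. *)
Definition beta0 (r : nat) (T : finType) (F : {set {set T}}) : nat :=
  #|[set S : {set {set T}} |
      [&& S \subset F, #|S| == r & \bigcap_(A in S) A == set0]]|.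

Definition level_conj_strongly (d : Order.disp_t) (P : finPOrderType d)
    (d' : Order.disp_t) (Q : finPOrderType d') : Prop :=
  exists n0 : nat, forall n : nat, n0 <= n ->
    exists F : {set {set 'I_n}},
      [/\ full_levels F, poset_free P F & La n P Q = ncopies Q F].

(* The bound La(n, P, Q) = O(n^k c(Q, F_n)) is between natural numbers, so a
   natural constant C is no restriction. *)
Definition level_conj_almost (d : Order.disp_t) (P : finPOrderType d)
    (d' : Order.disp_t) (Q : finPOrderType d') : Prop :=
  exists (k : nat) (F : forall n : nat, {set {set 'I_n}}),
    (forall n : nat, full_levels (F n) /\ poset_free P (F n)) /\
    exists C n0 : nat, forall n : nat, n0 <= n ->
      La n P Q <= C * (n ^ k * ncopies Q (F n)).

(* Main.v *)
(* Split a copy of Q (+) r in F into its r top members, which are maximal in F,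
   and a copy B of Q in the family K of non-maximal members.  The maximal members
   above B satisfy the LYM inequality above cover B; by convexity of C(-, r) the
   number of r-subsets of these is at most a sum over the members A themselves,
   and LYM for all maximal members reduces the bound to a single A.  With
   t(i, k) = C(n, i) beta(r, n - i, k - i) and w = La(-, P_(l+1), Q), where k = #|A|,
   there remains sum_i t(i, k) y(i) <= max_(i, j) t(i, j) w(j), where y(i) <= w(i)
   is the average number of copies of Q in K below an i-subset of A.
   As w(k) >= C(m, m/2) w(k - m), it suffices that
   sum_i t(i, k) / C(k - i, (k - i)/2) <= max_i t(i, k).  A switching argument
   bounds the growth of t(-, k), which proves this outside a finite range; the
   latter is checked by computation, except for r = 2 and n <= 14, where the
   averages satisfy a further inequality unless Q is a chain on at most two
   elements.  The index i need not depend on j since one maximal pair serves.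
   For r = 1 only LYM is used.  The optimal levels for Q on [j], extended by the
   level j of [n], are optimal for Q (+) 1 unless they contain the level j of [j]
   already.  That is impossible for large j: it would give w(j + 1) >= (j + 1) w(j),
   whereas w(j + 1) = O(w(j)), by a compression along a gap between the levels. *)
Require Import Defs.
From Stdlib Require Import NArith.
From mathcomp Require Import all_boot all_order all_algebra.
From mathcomp Require Import zify ring lra.
Set Implicit Arguments.
Unset Strict Implicit.
Unset Printing Implicit Defensive.
Import Order.Theory GRing.Theory Num.Theory.

(** * Copies and ranked families *)

(** The inequality of (a) has no constant factor to spare, and this shapes the proof. With y(i) <=
    w(i) alone there remains a sum over all intersection sizes i, which loses a factor n + 1. The
    weights 1 / C(k - i, (k - i)/2) decay geometrically in k - i, so that only the sizes i close to
    k can do harm; there switching shows t(i, k) to be small against t(i - 1, k) as soon as k and (r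
    - 1)(n - k) leave room.

    The almost statement for r >= 2 comes from the cruder sum instead, where a factor n + 1 is
    harmless. Its terms t(i, k) w(i) are attained, up to the factors allowed, by families of levels:
    good levels on [i] together with the level k of [n]. The terms t(i, j) w(j) of (a) are not tied
    to a family in this way.

    The estimate w(j + 1) = O(w(j)), for families of levels, has to work for every Q. A bounded
    number of levels leaves a gap of length linear in n, hence a positive proportion of all tuples
    of points separates the large members of a copy from its small ones. *)

Section Copies.
Variables (d : Order.disp_t) (P : finPOrderType d) (T : finType).
Implicit Types (F G : {set {set T}}).

Definition copies F : {set {set {set T}}} :=
  [set G : {set {set T}} | (G \subset F) && is_copy P G].

Lemma ncopiesE F : ncopies P F = #|copies F|.
Proof. by []. Qed.

Lemma is_copyP G :
  reflect (exists phi : P -> {set T},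
    [/\ injective phi, phi @: [set: P] = G &
        forall x y, (x <= y)%O -> phi x \subset phi y])
    (is_copy P G).
Proof.
apply: (iffP existsP) => [[phi /and3P[/injectiveP phiI /eqP phiG /forallP phiM]]|].
  by exists phi; split=> // x y; apply: implyP; apply: (forallP (phiM x)).
move=> [phi [phiI phiG phiM]]; exists [ffun x => phi x]; apply/and3P; split.
- by apply/injectiveP => x y; rewrite !ffunE => /phiI.
- by rewrite -phiG; apply/eqP/eq_imset => x; rewrite ffunE.
- apply/forallP => x; apply/forallP => y; apply/implyP => /phiM.
  by rewrite !ffunE.
Qed.

Lemma card_copy G : is_copy P G -> #|G| = #|P|.
Proof. by case/is_copyP => phi [phiI <- _]; rewrite card_imset // cardsT. Qed.

End Copies.

Lemma copy_imset d (P : finPOrderType d) (T T' : finType)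
    (g : {set T} -> {set T'}) (G : {set {set T}}) :
  {in G &, injective g} ->
  {in G &, forall A B : {set T}, A \subset B -> g A \subset g B} ->
  is_copy P G -> is_copy P (g @: G).
Proof.
move=> gI gM /is_copyP[phi [phiI phiG phiM]].
have phiGx x : phi x \in G by rewrite -phiG imset_f.
apply/is_copyP; exists (g \o phi); split.
- by move=> x y /= /gI eqxy; apply: phiI; apply: eqxy.
- by rewrite -phiG -imset_comp.
- by move=> x y lexy /=; apply: gM => //; apply: phiM.
Qed.

Lemma leq_ncopies_imset d (P : finPOrderType d) (T T' : finType)
    (g : {set T} -> {set T'}) (F : {set {set T}}) (F' : {set {set T'}}) :
  {in F &, injective g} ->
  {in F &, forall A B : {set T}, A \subset B -> g A \subset g B} ->
  (forall A, A \in F -> g A \in F') ->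
  ncopies P F <= ncopies P F'.
Proof.
move=> gI gM gF; rewrite !ncopiesE.
rewrite -(card_in_imset (f := fun G : {set {set T}} => g @: G) (D := copies P F)).
  apply: subset_leq_card; apply/subsetP => _ /imsetP[G + ->]; rewrite !inE.
  case/andP=> sG cG; apply/andP; split.
    by apply/subsetP => _ /imsetP[A AG ->]; apply/gF/(subsetP sG).
  apply: copy_imset => //.
    by move=> A B /(subsetP sG) AF /(subsetP sG) BF; apply: gI.
  by move=> A B /(subsetP sG) AF /(subsetP sG) BF; apply: gM.
move=> G1 G2; rewrite !inE => /andP[sG1 _] /andP[sG2 _] eqG.
have aux (H1 H2 : {set {set T}}) : H1 \subset F -> H2 \subset F -> g @: H1 = g @: H2 -> H1 \subset H2.
  move=> sH1 sH2 eqH; apply/subsetP => A AH1.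
  have: g A \in g @: H2 by rewrite -eqH imset_f.
  case/imsetP => B BH2 eqAB.
  suff -> : A = B by [].
  by apply: gI eqAB; [apply: (subsetP sH1) | apply: (subsetP sH2)].
by apply/eqP; rewrite eqEsubset; apply/andP; split; apply: aux.
Qed.

(** The rank-function form of containing no chain of k + 1 members ([ranked_free], [free_ranked]). A
    rank restricts to subfamilies and can be pulled back along maps without handling embedded
    chains. *)
Definition ranked (k : nat) (T : finType) (F : {set {set T}}) : Prop :=
  exists rho : {set T} -> nat,
    (forall A, A \in F -> rho A < k) /\
    {in F &, forall A B : {set T}, A \proper B -> rho A < rho B}.

Section Ranked.
Variables (T : finType).
Implicit Types (F G : {set {set T}}) (A B : {set T}).

Lemma ranked_sub k F1 F2 : F1 \subset F2 -> ranked k F2 -> ranked k F1.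
Proof.
move=> /subsetP sF [rho [rho_lt rhoM]]; exists rho; split=> [A /sF /rho_lt//|].
by move=> A B /sF AF /sF BF; apply: rhoM.
Qed.

Lemma ranked_free k F : ranked k F -> poset_free 'I_k.+1 F.
Proof.
case=> rho [rho_lt rhoM]; rewrite /poset_free ncopiesE cards_eq0.
apply/eqP/setP => G; rewrite !inE; apply/negP => /andP[sGF].
case/is_copyP => phi [phiI phiG phiM].
have phiF i : phi i \in F by apply: (subsetP sGF); rewrite -phiG imset_f.
have inc (i : 'I_k.+1) : (i : nat) <= rho (phi i).
  case: i => m; elim: m => [//|m IHm] lt_m /=.
  have lt_m' : m < k.+1 by apply: ltnW.
  apply: leq_ltn_trans (IHm lt_m') _; apply: rhoM => //.
  rewrite properEneq phiM ?andbT; first by rewrite (inj_eq phiI) -val_eqE /= ltn_eqF.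
  by rewrite leEord /=.
have := inc ord_max; rewrite /= leqNgt => /negP; apply.
exact: rho_lt.
Qed.

(* Peeling off minimal members: A survives t rounds iff it is the top of a
   chain of t.+1 members. *)
Fixpoint peel F t :=
  if t is t'.+1 then [set A in peel F t' | [exists B in peel F t', B \proper A]]
  else F.

Lemma peel_sub F t : peel F t.+1 \subset peel F t.
Proof. by apply/subsetP => A; rewrite inE => /andP[]. Qed.

Lemma peel_subF F s t : s <= t -> peel F t \subset peel F s.
Proof.
elim: t => [|t IHt]; first by rewrite leqn0 => /eqP->.
rewrite leq_eqVlt => /predU1P[->//|lt_st].
exact: subset_trans (peel_sub _ _) (IHt lt_st).
Qed.

Lemma peel_proper F t A B :
  A \in peel F t -> B \in F -> A \proper B -> B \in peel F t.+1.
Proof.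
elim: t A B => [|t IHt] A B /= At BF sAB.
  by rewrite inE BF; apply/existsP; exists A; rewrite At.
rewrite inE; apply/andP; split; last by apply/existsP; exists A; rewrite At.
move: At; rewrite inE => /andP[At _]; exact: IHt At BF sAB.
Qed.

Lemma peel_chain F t A : A \in peel F t -> exists phi : nat -> {set T},
  [/\ phi t = A, forall s, s <= t -> phi s \in F &
      forall s, s < t -> phi s \proper phi s.+1].
Proof.
elim: t A => [|t IHt] A; first by move=> AF; exists (fun=> A).
rewrite inE => /andP[At /existsP[B /andP[Bt sBA]]].
have [phi [phit phiF phiM]] := IHt B Bt.
exists (fun s => if s <= t then phi s else A); split.
- by rewrite ltnn.
- move=> s _; case: ifP => [/phiF//|_].
  exact: (subsetP (peel_subF F (leq0n t))).
- move=> s; rewrite ltnS => le_st; rewrite le_st; case: ifP => [/phiM//|/negbT].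
  rewrite -leqNgt => le_ts; have -> : s = t by apply/eqP; rewrite eqn_leq le_st.
  by rewrite phit.
Qed.

Lemma free_ranked k F : poset_free 'I_k.+1 F -> ranked k F.
Proof.
rewrite /poset_free ncopiesE cards_eq0 => /eqP noC.
have peel0 : peel F k = set0.
  apply/setP => A; rewrite in_set0; apply/negP => /peel_chain[phi [_ phiF phiM]].
  have phiS s t : s <= t -> t <= k -> phi s \subset phi t.
    elim: t => [|t IHt]; first by rewrite leqn0 => /eqP->.
    rewrite leq_eqVlt => /predU1P[->//|lt_st] lt_tk.
    by apply: subset_trans (IHt _ (ltnW lt_tk)) (proper_sub (phiM _ _)).
  have phiI s t : s < t -> t <= k -> phi s != phi t.
    move=> lt_st le_tk; apply/negP => /eqP eq_st.
    have := phiM s (leq_trans lt_st le_tk); rewrite properE eq_st => /andP[_ /negP].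
    by apply; apply: phiS.
  have : (fun i : 'I_k.+1 => phi i) @: [set: 'I_k.+1] \in copies 'I_k.+1 F.
    rewrite inE; apply/andP; split.
      by apply/subsetP => _ /imsetP[i _ ->]; apply: phiF; rewrite -ltnS.
    apply/is_copyP; exists (fun i : 'I_k.+1 => phi i); split=> // [i j eq_ij|i j].
      apply/val_inj => /=; case: (ltngtP i j) => // lt.
        by have := phiI _ _ lt (ltn_ord j); rewrite eq_ij eqxx.
      by have := phiI _ _ lt (ltn_ord i); rewrite eq_ij eqxx.
    by rewrite leEord => le_ij; apply: phiS le_ij (ltn_ord j).
  by rewrite noC in_set0.
(* The rank counts the rounds survived after round 0. If A is a proper subset of B, survival of A in
   round t gives survival of B in round t + 1; so the sum for B dominates the shifted sum for A, and
   round 1 makes the inequality strict. *)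
exists (fun A => \sum_(t < k.-1) (A \in peel F t.+1)).
have bound A : \sum_(t < k.-1) (A \in peel F t.+1) <= k.-1.
  by rewrite -[leqRHS]card_ord -sum1_card leq_sum // => i _; case: (_ \in _).
split=> [A AF|A B AF BF sAB].
  case: k {noC} peel0 bound => [/= F0|k _ bound]; last by rewrite ltnS.
  by rewrite F0 in_set0 in AF.
have Bin t : A \in peel F t -> B \in peel F t.+1 by move=> At; apply: peel_proper At BF sAB.
have AM s t : s <= t -> A \in peel F t -> A \in peel F s.
  by move=> le_st; apply: (subsetP (peel_subF F le_st)).
have Ak : A \notin peel F k by rewrite peel0 in_set0.
have Bk : B \notin peel F k by rewrite peel0 in_set0.
case: k peel0 Ak Bk {bound noC} => [F0|k _ Ak Bk]; first by rewrite /= AF.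
have {}Ak : A \notin peel F k by apply: contra Bk => /Bin.
rewrite /=; case: k Ak Bk => [|k] Ak Bk; first by rewrite /= AF in Ak.
have A0 : (A \in peel F k.+1 : nat) = 0 by rewrite (negbTE Ak).
have B1 : (B \in peel F 1 : nat) = 1 by rewrite (Bin 0).
have le t : (A \in peel F t : nat) <= (B \in peel F t.+1).
  by case At : (A \in _) => //; rewrite (Bin t).
move: A0 B1 le; set a := fun t => nat_of_bool (A \in peel F t).
set b := fun t => nat_of_bool (B \in peel F t).
rewrite -/(a k.+1) -/(b 1) => a0 b1 le_ab; rewrite -/(\sum_(t < k.+1) a t.+1).
rewrite -/(\sum_(t < k.+1) b t.+1) big_ord_recr big_ord_recl /= a0 b1 addn0 add1n.
by rewrite ltnS leq_sum // => i _; apply: le_ab.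
Qed.

End Ranked.

(** * Extremal numbers and the LYM inequality *)

Section La.
Variables (d d' : Order.disp_t) (P : finPOrderType d) (Q : finPOrderType d').

Lemma leq_La n (F : {set {set 'I_n}}) : poset_free P F -> ncopies Q F <= La n P Q.
Proof. by move=> freeF; apply: (leq_bigmax_cond (F := fun F => ncopies Q F)). Qed.

Lemma La_leP n m :
  reflect (forall F : {set {set 'I_n}}, poset_free P F -> ncopies Q F <= m)
          (La n P Q <= m).
Proof. exact: (iffP (bigmax_leqP _ _ _)). Qed.

Lemma La_witness n : 0 < #|P| ->
  exists2 F : {set {set 'I_n}}, poset_free P F & La n P Q = ncopies Q F.
Proof.
move=> P_gt0; have free0 : poset_free P (set0 : {set {set 'I_n}}).
  rewrite /poset_free ncopiesE cards_eq0; apply/eqP/setP => G; rewrite !inE subset0.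
  apply/negP => /andP[/eqP-> /card_copy]; rewrite cards0 => P0.
  by rewrite -P0 in P_gt0.
have n0 : 0 < #|[pred F : {set {set 'I_n}} | poset_free P F]|.
  by apply/card_gt0P; exists set0.
by have [F freeF eqF] := eq_bigmax_cond (fun F => ncopies Q F) n0; exists F.
Qed.

End La.

Section Transport.
Variables (d : Order.disp_t) (Q : finPOrderType d) (h : nat).

Lemma ncopies_le_La (T : finType) (D : {set T}) (F : {set {set T}}) :
  (forall A, A \in F -> A \subset D) -> ranked h F ->
  ncopies Q F <= La #|D| 'I_h.+1 Q.
Proof.
move=> sFD [rho [rho_lt rhoM]].
pose f (i : 'I_#|D|) := enum_val i; pose g (A : {set T}) := f @^-1: A.
have fI : injective f by apply: enum_val_inj.
have gK A : A \in F -> f @: g A = A.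
  move=> AF; apply/setP => x; apply/imsetP/idP => [[i + ->]|xA]; first by rewrite inE.
  have xD : x \in D by apply: (subsetP (sFD A AF)).
  by exists (enum_rank_in xD x); rewrite ?inE /f enum_rankK_in.
apply: leq_trans (leq_La _ (F := g @: F) _).
- apply: (@leq_ncopies_imset _ _ _ _ g).
  + by move=> A B AF BF eqg; rewrite -(gK A) // -(gK B) // eqg.
  + by move=> A B _ _ sAB; apply: preimsetS.
  + by move=> A AF; apply: imset_f.
apply: ranked_free; exists (fun C : {set 'I_#|D|} => rho (f @: C)); split.
  by move=> _ /imsetP[A AF ->]; rewrite gK // rho_lt.
move=> _ _ /imsetP[A AF ->] /imsetP[B BF ->] pAB; rewrite !gK //.
apply: rhoM => //; rewrite -(gK A) // -(gK B) // properEcard.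
by rewrite imsetS ?proper_sub //= !card_imset // proper_card.
Qed.

Lemma leq_ncopies_inj (T T' : finType) (f : T -> T') (F : {set {set T}})
    (F' : {set {set T'}}) :
  injective f -> (forall A, A \in F -> f @: A \in F') ->
  ncopies Q F <= ncopies Q F'.
Proof.
move=> fI sFF'; apply: (@leq_ncopies_imset _ _ _ _ (fun A => f @: A)) => //.
  by move=> A B _ _; apply: imset_inj.
by move=> A B _ _; apply: imsetS.
Qed.

End Transport.

Definition antichain (T : finType) (M : {set {set T}}) : Prop :=
  {in M &, forall A B : {set T}, A \subset B -> A = B}.

Section LYM.
Local Open Scope ring_scope.

(** Stated relative to U because the maximal members above [cover B] get weighted. Unless M = {D}, a
    member of relative size a leaves out n - a points x of D, and n / C(n, a) = (n - a) / C(n - 1,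
    a): its weight is shared equally among the subproblems with x deleted from D. *)
Lemma LYM (T : finType) (U D : {set T}) (M : {set {set T}}) : antichain M ->
  (forall A, A \in M -> (U \subset A) && (A \subset D)) ->
  \sum_(A in M) ('C(#|D| - #|U|, #|A| - #|U|)%:R)^-1 <= 1 :> rat.
Proof.
move: {2}#|D| (leqnn #|D|) => m; elim: m D M => [|m IHm] D M.
  rewrite leqn0 cards_eq0 => /eqP-> antiM sM.
  apply: le_trans (_ : \sum_(A in [set (set0 : {set T})]) 1 <= _).
    rewrite [leRHS](bigID (mem M)) /= [X in _ <= X + _](eq_bigl (mem M)).
      rewrite -[leLHS]addr0 lerD ?sumr_ge0 // ler_sum // => A AM.
      have /andP[] := sM A AM; rewrite subset0 => + /eqP eA.
      by rewrite eA subset0 => /eqP->; rewrite cards0 bin0 invr1.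
    by move=> A; rewrite !inE andb_idl // => /sM/andP[_]; rewrite subset0.
  by rewrite big_set1.
move=> leDm antiM sM; have [DM|DM] := boolP (D \in M).
  have -> : M = [set D].
    apply/setP => A; rewrite inE; apply/idP/eqP => [AM|->//].
    by apply: antiM => //; case/andP: (sM A AM).
  by rewrite big_set1 binn invr1.
have [->|[A0 A0M]] := set_0Vmem M; first by rewrite big_set0.
have sUD : U \subset D by have /andP[sU sD] := sM A0 A0M; apply: subset_trans sU sD.
have pUD : (#|U| < #|D|)%N.
  rewrite proper_card // properEneq sUD andbT; apply: contra DM => /eqP eqUD.
  suff <- : A0 = D by [].
  by apply/eqP; rewrite eqEsubset -{2}eqUD andbC; apply: sM.
pose n := (#|D| - #|U|)%N; have n_gt0 : (0 < n)%N by rewrite subn_gt0.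
have cardDU : #|D :\: U| = n by rewrite cardsD (setIidPr sUD).
suff: n%:R * (\sum_(A in M) ('C(n, #|A| - #|U|)%:R)^-1) <= n%:R * (1 : rat).
  by rewrite ler_pM2l ?ltr0n.
have ->: n%:R * (\sum_(A in M) ('C(n, #|A| - #|U|)%:R)^-1) =
         \sum_(A in M) \sum_(x in D :\: A) ('C(n.-1, #|A| - #|U|)%:R)^-1 :> rat.
  rewrite big_distrr /=; apply: eq_bigr => A AM.
  have /andP[sUA sAD] := sM A AM.
  have pAD : A \proper D.
    by rewrite properEneq sAD andbT; apply: contra DM => /eqP <-.
  rewrite sumr_const cardsD (setIidPr sAD).
  have ltAD := proper_card pAD; have leUA := subset_leq_card sUA.
  have ltan : (#|A| - #|U| < n)%N by rewrite ltn_sub2r.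
  have -> : (#|D| - #|A| = n - (#|A| - #|U|))%N by rewrite /n; lia.
  have C0 : ('C(n, #|A| - #|U|)%:R : rat) != 0 by rewrite pnatr_eq0 -lt0n bin_gt0 ltnW.
  have C1 : ('C(n.-1, #|A| - #|U|)%:R : rat) != 0.
    by rewrite pnatr_eq0 -lt0n bin_gt0; lia.
  apply: (mulIf C0); apply: (mulIf C1).
  rewrite [RHS]mulrAC !mulfVK // -[X in X * _ * _]mulr_natl mulfVK //.
  by rewrite -!natrM mul_bin_down.
rewrite (exchange_big_dep (mem (D :\: U))) /=; last first.
  move=> A x /sM/andP[sUA _]; rewrite !inE => /andP[xA ->]; rewrite andbT.
  by apply: contra xA; apply: (subsetP sUA).
have -> : n%:R = \sum_(x in D :\: U) 1 :> rat by rewrite -cardDU -sum1_card natr_sum.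
rewrite mulr1 ler_sum // => x xDU.
have [xU xD] : x \notin U /\ x \in D by move: xDU; rewrite inE => /andP[].
have cD : #|D :\ x| = #|D|.-1 by rewrite (cardsD1 x D) xD.
have := IHm (D :\ x) [set A in M | x \notin A]; rewrite cD.
have -> : (#|D|.-1 - #|U| = n.-1)%N by rewrite /n; lia.
rewrite (eq_bigl (fun A => (A \in M) && (x \in D :\: A))).
  apply; first by lia.
    by move=> A B; rewrite !inE => /andP[AM _] /andP[BM _]; apply: antiM.
  move=> A; rewrite inE => /andP[AM xA]; have /andP[-> sAD] := sM A AM.
  by rewrite subsetD1 sAD.
by move=> A; rewrite !inE xD andbT.
Qed.

End LYM.

(** * Copies of [oplus Q r] in a ranked family *)

Lemma height_chain d (Q : finPOrderType d) :
  exists2 C : {set Q}, {in C &, forall x y, (x >=< y)%O} & #|C| = height Q.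
Proof.
pose p := [pred C : {set Q} | [forall x in C, forall y in C, (x >=< y)%O]].
have n0 : 0 < #|p|.
  by apply/card_gt0P; exists set0; rewrite inE; apply/forall_inP => x; rewrite inE.
have [C pC eqC] := eq_bigmax_cond (fun C : {set Q} => #|C|) n0.
exists C; last by rewrite -eqC.
by move=> x y xC yC; move: pC => /forall_inP/(_ x xC)/forall_inP/(_ y yC).
Qed.

Lemma leq_height d (Q : finPOrderType d) (C : {set Q}) :
  {in C &, forall x y, (x >=< y)%O} -> #|C| <= height Q.
Proof.
move=> chC; apply: (leq_bigmax_cond (F := fun C : {set Q} => #|C|)).
by apply/forall_inP => x xC; apply/forall_inP => y yC; apply: chC.
Qed.

Lemma card_dep (I J : finType) (X : {set I}) (Y : I -> {set J}) :
  #|[set p : I * J | (p.1 \in X) && (p.2 \in Y p.1)]| = \sum_(x in X) #|Y x|.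
Proof.
rewrite -sum1_card (eq_bigl (fun p => (p.1 \in X) && (p.2 \in Y p.1))); last first.
  by move=> p; rewrite inE.
rewrite -(pair_big_dep (fun x => x \in X) (fun x y => y \in Y x) (fun _ _ => 1)) /=.
by apply: eq_bigr => x _; rewrite sum1_card.
Qed.

Section Maximal.
Variables (T : finType).
Implicit Types F : {set {set T}}.

Definition maxl F := [set A : {set T} in F | [forall B in F, ~~ (A \proper B)]].

Lemma maxl_sub F : maxl F \subset F.
Proof. by apply/subsetP => A; rewrite inE => /andP[]. Qed.

Lemma antichain_maxl F : antichain (maxl F).
Proof.
move=> A B; rewrite !inE => /andP[AF /forall_inP maxA] /andP[BF _] sAB.
apply/eqP; apply: contraR (maxA B BF) => neq_AB.
by rewrite properEneq neq_AB.
Qed.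

Lemma notin_maxl F A B : A \in F -> B \in F -> A \proper B -> A \notin maxl F.
Proof.
move=> AF BF pAB; rewrite inE AF /=.
by apply/forall_inPn; exists B => //; rewrite negbK.
Qed.

Lemma ranked_nonmaxl k F : ranked k.+1 F -> ranked k (F :\: maxl F).
Proof.
case=> rho [rho_lt rhoM]; exists rho; split.
  move=> A; rewrite !inE negb_and => /andP[+ AF]; rewrite AF /=.
  case/forall_inPn => B BF; rewrite negbK => /(rhoM _ _ AF BF) lt_AB.
  exact: leq_trans lt_AB (rho_lt B BF).
by move=> A B /setDP[AF _] /setDP[BF _]; apply: rhoM.
Qed.

End Maximal.

Section Oplus.
Variables (d : Order.disp_t) (Q : finPOrderType d) (r : nat) (T : finType).
Implicit Types (F B S : {set {set T}}).

Let R := oplus Q r.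

Definition tops (L B : {set {set T}}) := [set A : {set T} in L | cover B \subset A].

Definition draws L B := [set S : {set {set T}} | (S \subset tops L B) && (#|S| == r)].

Lemma cover_subP B (A : {set T}) :
  reflect (forall C : {set T}, C \in B -> C \subset A) (cover B \subset A).
Proof. exact: bigcupsP. Qed.

Lemma sum_draws L (K : {set {set {set T}}}) :
  #|[set p : {set {set T}} * {set {set T}} | (p.1 \in K) && (p.2 \in draws L p.1)]|
  = \sum_(B in K) 'C(#|tops L B|, r).
Proof. by rewrite card_dep; apply: eq_bigr => B _; rewrite /draws cards_draws. Qed.

(** A top member lies above a chain of [height Q] members, so its rank is the largest possible and
    it is maximal in [F]; the other members lie below a top one and are not maximal. Hence [maxl F]
    alone determines the splitting of a copy, which makes [s] injective. *)
Lemma copies_oplus_le F : 0 < r -> ranked (height Q).+1 F ->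
  ncopies R F <= \sum_(B in copies Q (F :\: maxl F)) 'C(#|tops (maxl F) B|, r).
Proof.
move=> r_gt0 rkF; rewrite ncopiesE -sum_draws.
pose s (G : {set {set T}}) := (G :&: (F :\: maxl F), G :&: maxl F).
have split_copy G : G \in copies R F -> exists phi : R -> {set T},
   [/\ injective phi, forall x y, (x <= y)%O -> phi x \subset phi y,
     G :&: (F :\: maxl F) = [set phi (inl q) | q : Q] &
     G :&: maxl F = [set phi (inr i) | i : 'I_r]].
  rewrite inE => /andP[sGF /is_copyP[phi [phiI phiG phiM]]]; exists phi.
  have phiF x : phi x \in F by apply: (subsetP sGF); rewrite -phiG imset_f.
  have phiP x y : (x <= y)%O -> x != y -> phi x \proper phi y.
    by move=> le_xy neq_xy; rewrite properEneq phiM // (inj_eq phiI) neq_xy.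
  have inlN q : phi (inl q) \notin maxl F.
    by apply: (@notin_maxl _ _ _ (phi (inr (Ordinal r_gt0)))) => //; apply: phiP.
  have inrM i : phi (inr i) \in maxl F.
    rewrite inE phiF; apply/forall_inP => B BF; apply/negP => pB.
    have [rho [rho_lt rhoM]] := rkF; have [C chC cardC] := height_chain Q.
    have ltC q : rho (phi (inl q)) < rho (phi (inr i)) by apply: rhoM => //; apply: phiP.
    have := rho_lt B BF; rewrite ltnS leqNgt => /negP; apply.
    apply: leq_ltn_trans (rhoM _ _ (phiF _) BF pB).
    rewrite -cardC -[leqRHS]card_ord.
    have fI : {in C &, injective (fun q => Ordinal (ltC q))}.
      move=> x y xC yC /(congr1 val) /= eqxy; apply/eqP/contraT => neq_xy.
      have neq' : (inl x : R) != inl y by [].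
      have neq'' : (inl y : R) != inl x by rewrite eq_sym.
      case/orP: (chC x y xC yC) => le_xy.
        have := rhoM _ _ (phiF (inl x)) (phiF (inl y)) (phiP (inl x) (inl y) le_xy neq').
        by rewrite eqxy ltnn.
      have := rhoM _ _ (phiF (inl y)) (phiF (inl x)) (phiP (inl y) (inl x) le_xy neq'').
      by rewrite eqxy ltnn.
    by rewrite -(card_in_imset fI) max_card.
  split=> //; apply/setP => A; rewrite !inE -phiG.
    apply/andP/imsetP => [[/imsetP[[q|i] _ ->]]|[q _ ->]].
    - by move=> _; exists q.
    - by have := inrM i; rewrite inE => ->.
    by split; [apply: imset_f | have := inlN q; rewrite inE phiF => ->].
  apply/andP/imsetP => [[/imsetP[[q|i] _ ->]]|[i _ ->]].
  - by have := inlN q; rewrite inE => /negbTE->.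
  - by move=> _; exists i.
  by split; [apply: imset_f | have := inrM i; rewrite inE].
have sI : {in copies R F &, injective s}.
  move=> G1 G2; rewrite !inE => /andP[sG1 _] /andP[sG2 _] [eq1 eq2].
  rewrite -(setIidPl sG1) -(setIidPl sG2) -(setID F (maxl F)) !setIUr.
  by rewrite (setIidPr (maxl_sub F)) eq1 eq2.
rewrite -(card_in_imset sI); apply/subset_leq_card/subsetP => _ /imsetP[G GF ->].
have [phi [phiI phiM eB eS]] := split_copy G GF.
rewrite !inE /= subsetIr; apply/andP; split; last apply/andP; [|split].
- rewrite eB; apply/is_copyP; exists (phi \o inl); split=> [x y /= /phiI[]//||x y le_xy].
    by apply/setP => A; apply/imsetP/imsetP => -[q _ ->]; exists q.
  exact: phiM.
- rewrite eS eB; apply/subsetP => _ /imsetP[i _ ->].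
  rewrite inE; apply/andP; split.
    suff: phi (inr i) \in G :&: maxl F by rewrite inE => /andP[].
    by rewrite eS; apply: imset_f.
  by apply/cover_subP => _ /imsetP[q _ ->]; apply: phiM.
- by rewrite eS card_imset ?card_ord // => i j /phiI[].
Qed.

Lemma copies_oplus_ge F (L : {set {set T}}) : [disjoint F & L] ->
  \sum_(B in copies Q F) 'C(#|tops L B|, r) <= ncopies R (F :|: L).
Proof.
move=> dFL; rewrite -sum_draws ncopiesE.
pose u (p : {set {set T}} * {set {set T}}) := p.1 :|: p.2.
have uI : {in [set p : {set {set T}} * {set {set T}} |
            (p.1 \in copies Q F) && (p.2 \in draws L p.1)] &, injective u}.
  have uE B S : B \subset F -> S \subset L -> (B :|: S) :&: F = B /\ (B :|: S) :&: L = S.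
    move=> sB sS; rewrite !setIUl (setIidPl sB) (setIidPl sS).
    have /eqP -> : S :&: F == set0.
      by rewrite setI_eq0 disjoint_sym (disjointWr sS).
    have /eqP -> : B :&: L == set0 by rewrite setI_eq0 (disjointWl sB).
    by rewrite setU0 set0U.
  have tL B S : S \subset tops L B -> S \subset L.
    by move=> /subset_trans; apply; apply/subsetP => A; rewrite inE => /andP[].
  move=> [B1 S1] [B2 S2]; rewrite !inE /= /u /=.
  move=> /andP[/andP[sB1 _] /andP[/tL sS1 _]] /andP[/andP[sB2 _] /andP[/tL sS2 _]] eqU.
  have [E1 E2] := uE _ _ sB1 sS1; have [E3 E4] := uE _ _ sB2 sS2.
  by rewrite -E1 -{2}E2 eqU E3 E4.
rewrite -(card_in_imset uI); apply/subset_leq_card/subsetP => _ /imsetP[[B S] + ->].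
rewrite !inE /= => /andP[/andP[sB /is_copyP[phi [phiI phiB phiM]]] /andP[sS /eqP cS]].
have tL A : A \in S -> A \in L /\ cover B \subset A.
  by move=> /(subsetP sS); rewrite inE => /andP.
have phiBx q : phi q \in B by rewrite -phiB imset_f.
rewrite /u /=; apply/andP; split.
  rewrite setUSS //; first by apply/subsetP => A /tL[].
have rS : r = #|S| by [].
pose psi (x : R) : {set T} := match x with inl q => phi q | inr i => enum_val (cast_ord rS i) end.
have psiS i : psi (inr i) \in S by apply: enum_valP.
apply/is_copyP; exists psi; split.
- move=> [q|i] [q'|j] /=; first by move/phiI->.
  + move=> eqA; have [AL _] := tL _ (psiS j); move: dFL; rewrite disjoint_subset.
    move/subsetP/(_ (phi q) (subsetP sB _ (phiBx q))).
    by rewrite inE /= eqA AL.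
  + move=> eqA; have [AL _] := tL _ (psiS i); move: dFL; rewrite disjoint_subset.
    move/subsetP/(_ (phi q') (subsetP sB _ (phiBx q'))).
    by rewrite inE /= -eqA AL.
  + by move/enum_val_inj/cast_ord_inj->.
- apply/setP => A; rewrite inE -phiB; apply/imsetP/orP => [[[q|i] _ ->]|].
  + by left; apply: imset_f.
  + by right.
  case=> [/imsetP[q _ ->]|AS]; first by exists (inl q).
  exists (inr (cast_ord (esym rS) (enum_rank_in AS A))); rewrite ?inE //=.
  by rewrite cast_ordKV enum_rankK_in.
- move=> [q|i] [q'|j] //=; first exact: phiM.
    by move=> _; have [_ /cover_subP] := tL _ (psiS j); apply.
  by rewrite /Order.le /= => /eqP->.
Qed.

End Oplus.

(** * Intersections of r-sets in a level *)

Lemma card_level n k : #|level n k| = 'C(n, k).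
Proof. by rewrite /level card_draws card_ord. Qed.

Lemma card_level_sup n k (U : {set 'I_n}) : #|U| <= k ->
  #|[set A in level n k | U \subset A]| = 'C(n - #|U|, k - #|U|).
Proof.
move=> leUk; have cU : #|~: U| = n - #|U| by rewrite cardsCs setCK card_ord.
rewrite -cU -cards_draws.
have fI : {in [set B : {set 'I_n} | B \subset ~: U & #|B| == k - #|U|] &,
            injective (fun B => U :|: B)}.
  move=> B1 B2; rewrite !inE => /andP[s1 _] /andP[s2 _] eqB.
  have aux (B : {set 'I_n}) : B \subset ~: U -> (U :|: B) :\: U = B.
    move=> sB; rewrite setDUl setDv set0U; apply/setDidPl.
    by rewrite disjoints_subset.
  by rewrite -(aux B1) // -(aux B2) // eqB.
rewrite -(card_in_imset fI); apply: eq_card => A; rewrite !inE.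
apply/andP/imsetP => [[/eqP cA sUA]|[B]].
  exists (A :\: U); last by rewrite setDE setUIr setUCr setIT (setUidPr sUA).
  by rewrite inE setDE subsetIr -setDE cardsD (setIidPr sUA) cA eqxx.
rewrite inE => /andP[sB /eqP cB] ->; rewrite subsetUl; split=> //.
have dUB : [disjoint U & B] by rewrite disjoint_sym disjoints_subset.
by rewrite cardsU disjoint_setI0 // cards0 subn0 cB subnKC.
Qed.

Section Inter.
Variables (n k r : nat).
Hypothesis r_gt0 : 0 < r.
Implicit Types (S : {set {set 'I_n}}) (X : {set 'I_n}).

Definition inter S := \bigcap_(A in S) A.

Definition tdraws := [set S : {set {set 'I_n}} | (S \subset level n k) && (#|S| == r)].

Lemma card_inter X : #|X| <= k ->
  #|[set S in tdraws | inter S == X]| = beta0 r (level (n - #|X|) (k - #|X|)).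
Proof.
move=> leXk; have cX : n - #|X| = #|~: X| by rewrite [RHS]cardsCs setCK card_ord.
pose f (j : 'I_(n - #|X|)) : 'I_n := enum_val (cast_ord cX j).
have fI : injective f by move=> i j /enum_val_inj/cast_ord_inj.
have fX j : f j \notin X by have := enum_valP (cast_ord cX j); rewrite inE.
have fS x : x \notin X -> exists j, x = f j.
  move=> xX; have xX' : x \in ~: X by rewrite inE.
  exists (cast_ord (esym cX) (enum_rank_in xX' x)).
  by rewrite /f cast_ordKV enum_rankK_in.
pose h (C : {set 'I_(n - #|X|)}) := X :|: f @: C.
pose g (A : {set 'I_n}) := f @^-1: A.
have hK C : g (h C) = C.
  by apply/setP => j; rewrite !inE (negbTE (fX j)) /= mem_imset.
have hI : injective h by apply: can_inj hK.
have gK (A : {set 'I_n}) : X \subset A -> h (g A) = A.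
  move=> sXA; apply/setP => x; rewrite inE; apply/orP/idP => [[]|xA].
  - exact: (subsetP sXA).
  - by case/imsetP => j; rewrite inE => + ->.
  have [xX|/fS[j xj]] := boolP (x \in X); [by left | right].
  by rewrite xj imset_f // inE -xj.
have ch C : #|h C| = #|X| + #|C|.
  rewrite cardsU card_imset // disjoint_setI0 ?cards0 ?subn0 // disjoint_subset.
  apply/subsetP => x xX; rewrite inE; apply: contraL xX => /imsetP[j _ ->].
  exact: fX.
have hcap (S0 : {set {set 'I_(n - #|X|)}}) :
    0 < #|S0| -> inter (h @: S0) = h (\bigcap_(C in S0) C).
  move=> /card_gt0P[C0 C0S]; apply/setP => x.
  have [xX|xX] := boolP (x \in X).
    rewrite [RHS]inE xX; apply/bigcapP => _ /imsetP[C _ ->].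
    by rewrite inE xX.
  have [j ->] := fS x xX; rewrite [RHS]inE (negbTE (fX j)) mem_imset //=.
  apply/bigcapP/bigcapP => [H C CS|H _ /imsetP[C CS ->]].
    by have := H _ (imset_f h CS); rewrite inE (negbTE (fX j)) mem_imset.
  by rewrite inE mem_imset // H ?orbT.
rewrite /beta0 -(card_imset _ (imset_inj hI)); apply: eq_card => S.
rewrite !inE; apply/andP/imsetP => [[/andP[sS /eqP cS] /eqP iS]|[S0]].
  have sXA (A : {set 'I_n}) : A \in S -> X \subset A by move=> AS; rewrite -iS; apply: bigcap_inf.
  have eS : S = h @: (g @: S).
    rewrite -imset_comp; apply/setP => A; apply/idP/imsetP => [AS|[B BS ->]].
      by exists A => //=; rewrite gK ?sXA.
    by rewrite /= gK ?sXA.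
  exists (g @: S) => //; rewrite inE.
  have cg : #|g @: S| = r by rewrite -(card_imset _ hI) -eS.
  rewrite cg eqxx /=; apply/andP; split.
    apply/subsetP => _ /imsetP[A AS ->]; rewrite inE.
    have := subsetP sS A AS; rewrite inE => /eqP <-.
    by rewrite -{2}(gK A) ?sXA // ch addKn.
  have := hcap (g @: S); rewrite cg -eS iS => /(_ r_gt0) eX.
  by rewrite -(hK (\bigcap_(C in g @: S) C)) -eX; apply/eqP/setP => j; rewrite !inE (negbTE (fX j)).
rewrite inE => /and3P[sS /eqP cS /eqP iS] ->; split; last first.
  by rewrite hcap ?cS // iS /h imset0 setU0.
rewrite card_imset // cS eqxx andbT.
apply/subsetP => _ /imsetP[C CS ->]; rewrite inE ch.
by have := subsetP sS C CS; rewrite inE => /eqP ->; rewrite subnKC.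
Qed.

Lemma card_interE i : i <= k ->
  #|[set S in tdraws | #|inter S| == i]| = 'C(n, i) * beta0 r (level (n - i) (k - i)).
Proof.
move=> le_ik; rewrite -card_level -sum_nat_const.
rewrite -sum1_card (partition_big inter (mem (level n i))) /=; last first.
  by move=> S; rewrite !inE => /andP[].
apply: eq_bigr => X; rewrite inE => /eqP cX.
rewrite -cX -card_inter ?cX // -sum1_card; apply: eq_bigl => S.
rewrite !inE -!andbA; congr (_ && (_ && _)).
by have [->|_] := eqVneq (inter S) X; rewrite ?andbF ?andbT // -cX eqxx.
Qed.

Lemma card_inter_leq S : S \in tdraws -> #|inter S| <= k.
Proof.
rewrite inE => /andP[sS /eqP cS].
have /card_gt0P[A AS] : 0 < #|S| by rewrite cS.
have := subsetP sS A AS; rewrite inE => /eqP <-.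
by apply/subset_leq_card/bigcap_inf.
Qed.

(** Both sides count the pairs of an r-set of k-sets and a u-set contained in all its members. This
    translates the C(N, r) from the convexity bound into intersection sizes, and, being triangular
    in u, it also determines the numbers on the left. *)
Lemma sum_inter_bin u : u <= k ->
  \sum_(i < k.+1) 'C(n, i) * beta0 r (level (n - i) (k - i)) * 'C(i, u) =
  'C(n, u) * 'C('C(n - u, k - u), r).
Proof.
move=> le_uk; rewrite -card_level -sum_nat_const.
transitivity (\sum_(S in tdraws) 'C(#|inter S|, u)).
  have lt_k S : S \in tdraws -> #|inter S| < k.+1 by rewrite ltnS => /card_inter_leq.
  rewrite (partition_big (fun S => inord #|inter S| : 'I_k.+1) predT) //=.
  apply: eq_bigr => i _; rewrite -card_interE; last by rewrite -ltnS.
  rewrite -sum_nat_const.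
  have eqS S : (S \in tdraws) && (inord #|inter S| == i) =
               (S \in [set S in tdraws | #|inter S| == i]).
    rewrite [RHS]inE; apply: andb_id2l => SD.
    apply/eqP/eqP => [<-|eqi]; first by rewrite inordK ?lt_k.
    by apply/val_inj; rewrite /= inordK ?lt_k.
  apply: eq_big => [S|S]; first by rewrite eqS.
  by move=> /setIdP[_ /eqP ->].
transitivity (\sum_(S in tdraws) \sum_(U in level n u | U \subset inter S) 1).
  apply: eq_bigr => S _; rewrite -cards_draws -sum1_card; apply: eq_bigl => U.
  by rewrite !inE andbC.
rewrite (exchange_big_dep (mem (level n u))) /=; last by move=> S U _ /andP[].
apply: eq_bigr => U; rewrite inE => /eqP cU.
rewrite -cU -card_level_sup ?cU // -cards_draws sum1_card.
apply: eq_card => S; rewrite unfold_in !inE eqxx /=.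
rewrite andbAC; congr (_ && _); apply/andP/subsetP => [[/subsetP sS sU] A AS|sS].
  by rewrite inE sS //=; apply: subset_trans sU (bigcap_inf _ AS).
split; first by apply/subsetP => A /sS; rewrite inE => /andP[].
by apply/bigcapsP => A /sS; rewrite inE => /andP[].
Qed.

End Inter.

(** * Convexity and averages *)

Lemma mul_bin_bin n k u : u <= k -> k <= n ->
  'C(n, k) * 'C(k, u) = 'C(n, u) * 'C(n - u, k - u).
Proof.
move=> le_uk le_kn; have le_un := leq_trans le_uk le_kn.
have f_gt0 : 0 < u`! * (k - u)`! * (n - k)`! by rewrite !muln_gt0 !fact_gt0.
apply/eqP; rewrite -(eqn_pmul2r f_gt0); apply/eqP.
have E1 := bin_fact le_uk; have E2 := bin_fact le_kn; have E3 := bin_fact le_un.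
have le4 : k - u <= n - u by apply: leq_sub2r.
have := bin_fact le4; have -> : n - u - (k - u) = n - k by lia.
move=> E4; transitivity (n`!).
  by rewrite -E2 -E1; ring.
by rewrite -E3 -E4; ring.
Qed.

(** Discrete convexity: C(-, r + 1) lies above the line through its value at D + 1 whose slope is
    its last difference C(D, r). *)
Lemma bin_tangent D N r :
  'C(D.+1, r.+1) + 'C(D, r) * N <= 'C(N, r.+1) + 'C(D, r) * D.+1.
Proof.
have le_bin x y : x <= y -> 'C(x, r) <= 'C(y, r) by apply: leq_bin2l.
have [le_DN|lt_ND] := leqP D.+1 N.
  elim: N le_DN => [//|N IHN]; rewrite leq_eqVlt => /predU1P[->//|lt_DN].
  have := IHN lt_DN; have := le_bin D N (ltnW lt_DN); rewrite (binS N); lia.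
have [m eD] : exists m, D = N + m by exists (D - N); lia.
elim: m D eD {lt_ND} => [|m IHm] D ->; first by rewrite addn0 binS mulnS addnA leqnn.
have := IHm (N + m) erefl; rewrite addnS (binS (N + m).+1).
have := le_bin (N + m) (N + m).+1 (leqnSn _).
have := leq_mul (le_bin _ _ (leqnSn (N + m))) (leqnn m.+1).
lia.
Qed.

Section Jensen.
Local Open Scope ring_scope.

(* Jensen for the convex function C(-, r), with the weights 1 / N i. *)
Lemma bin_jensen (I : finType) (A : {set I}) (N : I -> nat) r :
  (0 < r)%N -> (forall i, i \in A -> 0 < N i)%N ->
  \sum_(i in A) ((N i)%:R)^-1 <= 1 :> rat ->
  'C(#|A|, r)%:R <= \sum_(i in A) 'C(N i, r)%:R / (N i)%:R :> rat.
Proof.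
case: r => // r _ N_gt0 sumN.
case cA: #|A| => [|D]; first by rewrite bin0n /= sumr_ge0 // => i _; rewrite divr_ge0.
pose a : rat := 'C(D, r)%:R; pose b : rat := 'C(D.+1, r.+1)%:R.
have leb : b <= a * D.+1%:R.
  rewrite /a /b -natrM ler_nat.
  by rewrite mulnC (mul_bin_diag D.+1 r) leq_pmull.
apply: (@le_trans _ _ (\sum_(i in A) ((b - a * D.+1%:R) / (N i)%:R + a))).
  rewrite big_split /= sumr_const cA -mulr_natr -big_distrr /=.
  set s := \sum_(i in A) _; rewrite -/s in sumN.
  have : (a * D.+1%:R - b) * s <= (a * D.+1%:R - b) * 1.
    by apply: ler_wpM2l => //; rewrite subr_ge0.
  rewrite -/b; lra.
apply: ler_sum => i iA; have Ni : 0 < (N i)%:R :> rat by rewrite ltr0n N_gt0.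
rewrite ler_pdivlMr // mulrDl divfK ?gt_eqF //.
have : b + a * (N i)%:R <= 'C(N i, r.+1)%:R + a * D.+1%:R.
  by rewrite /a /b -!natrM -!natrD ler_nat bin_tangent.
lra.
Qed.

End Jensen.

Section Averages.
Local Open Scope ring_scope.
Variables (d : Order.disp_t) (Q : finPOrderType d) (n h r : nat).
Variable K : {set {set 'I_n}}.
Hypothesis rankedK : ranked h K.

Let w j := La j 'I_h.+1 Q.
Implicit Types (A X : {set 'I_n}) (B : {set {set 'I_n}}).

Definition below A := [set B in copies Q K | cover B \subset A].

(* [avg A i] is the average, over the i-subsets X of A, of the number of copies
   of Q in K that lie below X. *)
Definition avg A (i : nat) : rat :=
  \sum_(B in below A) 'C(i, #|cover B|)%:R / 'C(#|A|, #|cover B|)%:R.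

Lemma card_below A : (#|below A| <= w #|A|)%N.
Proof.
pose KA := [set C in K | C \subset A].
have -> : #|below A| = ncopies Q KA.
  rewrite ncopiesE; apply: eq_card => B; rewrite !inE andbAC; congr (_ && _).
  apply/andP/subsetP => [[/subsetP sB /cover_subP sA] C CB|sB].
    by rewrite inE sB // sA.
  split; first by apply/subsetP => C /sB; rewrite inE => /andP[].
  by apply/cover_subP => C /sB; rewrite inE => /andP[].
apply: ncopies_le_La; first by move=> C; rewrite inE => /andP[].
by apply: ranked_sub rankedK; apply/subsetP => C; rewrite inE => /andP[].
Qed.

Lemma cover_below A B : B \in below A -> (#|cover B| <= #|A|)%N.
Proof. by rewrite inE => /andP[_]; apply: subset_leq_card. Qed.

Lemma avgE A i : (i <= #|A|)%N ->
  avg A i = (\sum_(X : {set 'I_n} | (X \subset A) && (#|X| == i)) #|below X|)%:R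
            / 'C(#|A|, i)%:R.
Proof.
move=> le_iA.
have Cn x : (x <= #|A|)%N -> ('C(#|A|, x)%:R : rat) != 0.
  by move=> le_x; rewrite pnatr_eq0 -lt0n bin_gt0.
rewrite natr_sum (eq_bigr (fun X => \sum_(B in below X) (1 : rat))); last first.
  by move=> X _; rewrite -sum1_card natr_sum.
rewrite (exchange_big_dep (mem (below A))) /=; last first.
  move=> X B /andP[sXA _]; rewrite !inE => /andP[-> sB].
  exact: subset_trans sB sXA.
rewrite big_distrl /=; apply: eq_bigr => B BA.
have leBA := cover_below BA; move: BA; rewrite inE => /andP[BK sBA].
rewrite sumr_const.
have [le_Bi|lt_iB] := leqP #|cover B| i; last first.
  rewrite bin_small // mul0r eq_card0 ?mul0r // => X.
  rewrite unfold_in /= -!andbA !inE; apply/negP => /and3P[_ /eqP cX /andP[_ sX]].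
  by have := subset_leq_card sX; rewrite cX leqNgt lt_iB.
have -> : #|[pred X : {set _} | (X \subset A) && (#|X| == i) & B \in below X]| =
          'C(#|A| - #|cover B|, i - #|cover B|).
  have cAB : #|A :\: cover B| = (#|A| - #|cover B|)%N by rewrite cardsD (setIidPr sBA).
  rewrite -cAB -cards_draws.
  have fI : {in [set Z : {set 'I_n} | Z \subset A :\: cover B & #|Z| == (i - #|cover B|)%N] &,
            injective (fun Z => cover B :|: Z)}.
    move=> Z1 Z2; rewrite !inE => /andP[s1 _] /andP[s2 _] eqZ.
    have aux (Z : {set 'I_n}) : Z \subset A :\: cover B -> (cover B :|: Z) :\: cover B = Z.
      move=> sZ; rewrite setDUl setDv set0U; apply/setDidPl.
      by rewrite disjoints_subset; apply: subset_trans sZ _; rewrite setDE subsetIr.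
    by rewrite -(aux Z1) // -(aux Z2) // eqZ.
  rewrite -(card_in_imset fI); apply: eq_card => X; rewrite unfold_in /= inE BK /=.
  apply/andP/imsetP => [[/andP[sXA /eqP cX] sBX]|[Z]].
    exists (X :\: cover B); last first.
      by rewrite setDE setUIr setUCr setIT (setUidPr sBX).
    by rewrite inE setSD //= cardsD (setIidPr sBX) cX eqxx.
  rewrite inE => /andP[sZ /eqP cZ] ->; rewrite subsetUl; split=> //.
  have dBZ : [disjoint cover B & Z].
    rewrite disjoint_sym disjoints_subset.
    by apply: subset_trans sZ _; rewrite setDE subsetIr.
  rewrite cardsU disjoint_setI0 // cards0 subn0 cZ subnKC // eqxx andbT subUset sBA.
  by apply: subset_trans sZ (subsetDl _ _).
apply/eqP; rewrite eqr_div ?Cn // -!natrM; apply/eqP; congr (_%:R).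
by rewrite mulnC mul_bin_bin // mulnC.
Qed.

Lemma avg_le A i : (i <= #|A|)%N -> avg A i <= (w i)%:R.
Proof.
move=> le_iA; rewrite avgE // ler_pdivrMr ?ltr0n ?bin_gt0 // -natrM ler_nat.
rewrite -cards_draws mulnC -sum_nat_const.
rewrite [leqRHS](eq_bigl (fun X => (X \subset A) && (#|X| == i))); last first.
  by move=> X; rewrite inE.
by apply: leq_sum => X /andP[_ /eqP <-]; apply: card_below.
Qed.

(** C(i, u) / C(#|A|, u) decreases in u, so the smallest possible cover gives the worst factor. With
    u0 = 2 this is the further inequality used for small n. *)
Lemma avg_bin A i u0 : (i <= #|A|)%N ->
  (forall B, B \in below A -> u0 <= #|cover B|)%N ->
  'C(#|A|, u0)%:R * avg A i <= 'C(i, u0)%:R * avg A #|A|.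
Proof.
move=> le_iA ge_u0; rewrite !big_distrr /=; apply: ler_sum => B BA.
have leBA := cover_below BA; have leB := ge_u0 B BA.
have Cn : ('C(#|A|, #|cover B|)%:R : rat) != 0 by rewrite pnatr_eq0 -lt0n bin_gt0.
rewrite divff // mulr1 mulrA ler_pdivrMr ?ltr0n ?bin_gt0 // -!natrM ler_nat.
have [le_Bi|lt_iB] := leqP #|cover B| i; last by rewrite (bin_small lt_iB) muln0.
have le_ui := leq_trans leB le_Bi.
rewrite -(leq_pmul2r (_ : 0 < 'C(#|cover B|, u0))%N) ?bin_gt0 //.
rewrite -mulnA (mul_bin_bin leB le_Bi) -[leqRHS]mulnA (mul_bin_bin leB leBA).
rewrite [leqRHS]mulnCA leq_mul2l leq_mul2l leq_bin2l ?orbT //.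
by apply: leq_sub2r.
Qed.

End Averages.

(* The number of r-sets of k-subsets of [n] whose intersection has i elements
   (for i <= k). *)
Definition interbeta n r i k := 'C(n, i) * beta0 r (level (n - i) (k - i)).

(** * Reduction to a single maximal member *)

Section Reduction.
Variables (d : Order.disp_t) (Q : finPOrderType d) (n : nat).
Implicit Types (F : {set {set 'I_n}}) (A : {set 'I_n}).

Let w j := La j 'I_(height Q).+1 Q.

Definition lower F := F :\: maxl F.

Lemma LYM_maxl (F : {set {set 'I_n}}) (V : rat) (c : {set 'I_n} -> rat) : (0 <= V)%R ->
  (forall A, A \in maxl F -> c A <= V)%R ->
  (\sum_(A in maxl F) c A / 'C(n, #|A|)%:R <= V)%R.
Proof.
move=> V_ge0 cV.
have := @LYM 'I_n set0 setT (maxl F) (@antichain_maxl _ F).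
rewrite cards0 cardsT card_ord subn0 => lym.
apply: (@le_trans _ _ (V * \sum_(A in maxl F) ('C(n, #|A| - 0)%:R)^-1)%R).
  rewrite big_distrr; apply: ler_sum => A AM.
  by rewrite subn0 ler_wpM2r ?invr_ge0 ?cV.
rewrite -[leRHS]mulr1; apply: ler_wpM2l => //.
by apply: lym => A _; rewrite sub0set subsetT.
Qed.

Lemma sum_tops F : \sum_(B in copies Q (lower F)) #|tops (maxl F) B| =
  \sum_(A in maxl F) #|below Q (lower F) A|.
Proof.
transitivity (\sum_(B in copies Q (lower F)) \sum_(A in maxl F | cover B \subset A) 1).
  by apply: eq_bigr => B _; rewrite -sum1_card; apply: eq_bigl => A; rewrite inE.
rewrite (exchange_big_dep (mem (maxl F))) /=; last by move=> B A _ /andP[].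
apply: eq_bigr => A AM; rewrite -sum1_card; apply: eq_bigl => B.
by rewrite [RHS]inE AM.
Qed.

Lemma La_oplus1 m :
  (forall k, k <= n -> 'C(n, k) * w k <= m) ->
  La n 'I_(height Q).+2 (oplus Q 1) <= m.
Proof.
move=> le_m; apply/La_leP => F /free_ranked rkF.
apply: leq_trans (copies_oplus_le _ rkF) _ => //.
rewrite (eq_bigr (fun B => #|tops (maxl F) B|)); last by move=> B _; rewrite bin1.
rewrite sum_tops -(ler_nat rat) natr_sum.
have C0 A : ('C(n, #|A|)%:R != 0 :> rat)%R.
  by rewrite pnatr_eq0 -lt0n bin_gt0 -[leqRHS]card_ord max_card.
rewrite (eq_bigr (fun A => (('C(n, #|A|) * #|below Q (lower F) A|)%:R / 'C(n, #|A|)%:R)%R)).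
  apply: LYM_maxl => // A _; rewrite ler_nat.
  apply: leq_trans (le_m #|A| _); last by rewrite -[leqRHS]card_ord max_card.
  rewrite leq_mul2l card_below ?orbT //; exact: ranked_nonmaxl.
by move=> A _; rewrite natrM mulrAC divff ?mul1r.
Qed.

Lemma ncopies_oplus_le r F : 0 < r -> ranked (height Q).+1 F ->
  ((ncopies (oplus Q r) F)%:R <=
   \sum_(A in maxl F) (\sum_(i < #|A|.+1)
      (interbeta n r i #|A|)%:R * avg Q (lower F) A i) / 'C(n, #|A|)%:R :> rat)%R.
Proof.
move=> r_gt0 rkF; have := copies_oplus_le r_gt0 rkF.
rewrite -(ler_nat rat) natr_sum => /le_trans; apply.
pose N (B : {set {set 'I_n}}) A := 'C(n - #|cover B|, #|A| - #|cover B|).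
have leA A : (#|A| <= n)%N by rewrite -[leqRHS]card_ord max_card.
have N_gt0 B A : A \in tops (maxl F) B -> 0 < N B A.
  by rewrite inE => /andP[_ /subset_leq_card sBA]; rewrite bin_gt0 leq_sub2r.
apply: (@le_trans _ _ (\sum_(B in copies Q (lower F))
   \sum_(A in tops (maxl F) B) 'C(N B A, r)%:R / (N B A)%:R)%R).
  apply: ler_sum => B BK; apply: bin_jensen => //; first exact: N_gt0.
  have := @LYM 'I_n (cover B) setT (tops (maxl F) B).
  rewrite cardsT card_ord; apply.
    move=> A1 A2 /setIdP[A1M _] /setIdP[A2M _].
    exact: (@antichain_maxl _ F).
  by move=> A; rewrite inE subsetT andbT => /andP[].
rewrite (eq_bigr (fun B => \sum_(A in maxl F | cover B \subset A)
   'C(N B A, r)%:R / (N B A)%:R)%R); last first.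
  by move=> B _; apply: eq_bigl => A; rewrite inE.
rewrite (exchange_big_dep (mem (maxl F))) /=; last by move=> B A _ /andP[].
apply: ler_sum => A AM.
(* From here on there is equality, even for each B separately: [sum_inter_bin] with u = #|cover B|
   evaluates the sum over i, and C(n, k) C(k, u) = C(n, u) N produces the denominator. *)
rewrite le_eqVlt; apply/orP; left; apply/eqP.
rewrite big_distrl /=.
under [RHS]eq_bigr => i _ do rewrite /avg mulrAC big_distrr /=.
rewrite exchange_big /= (eq_bigl (fun B => B \in below Q (lower F) A)); last first.
  by move=> B; rewrite [RHS]inE AM.
apply: eq_bigr => B; rewrite inE => /andP[BK sBA].
have leBA := subset_leq_card sBA.
have NA0 : ((N B A)%:R != 0 :> rat)%R by rewrite pnatr_eq0 -lt0n N_gt0 // inE AM.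
have CA0 : ('C(n, #|A|)%:R != 0 :> rat)%R by rewrite pnatr_eq0 -lt0n bin_gt0.
have CB0 : ('C(#|A|, #|cover B|)%:R != 0 :> rat)%R by rewrite pnatr_eq0 -lt0n bin_gt0.
have E := sum_inter_bin n r_gt0 leBA.
rewrite (eq_bigr (fun i : 'I__ => (interbeta n r i #|A| * 'C(i, #|cover B|))%:R *
  ('C(n, #|A|)%:R^-1 / 'C(#|A|, #|cover B|)%:R))%R); last first.
  by move=> i _; rewrite natrM; ring.
rewrite -big_distrl -natr_sum E /=.
have CU0 : ('C(n, #|cover B|)%:R != 0 :> rat)%R.
  by rewrite pnatr_eq0 -lt0n bin_gt0 (leq_trans leBA).
rewrite -invfM -natrM mul_bin_bin // !natrM -/(N B A).
by field; rewrite NA0 CU0.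
Qed.

End Reduction.

(** * Growth of the extremal numbers *)

Definition midbin m := 'C(m, m./2).

Section Growth.
Variables (d : Order.disp_t) (Q : finPOrderType d) (h : nat).
Hypothesis Q_gt0 : 0 < #|Q|.

(* Taking the product with an antichain on new ground elements does not increase
   the height. *)
Lemma La_growth i k : i <= k ->
  midbin (k - i) * La i 'I_h.+1 Q <= La k 'I_h.+1 Q.
Proof.
move=> le_ik.
have [F0 free0 ->] : exists2 F : {set {set 'I_i}}, poset_free 'I_h.+1 F &
    La i 'I_h.+1 Q = ncopies Q F by apply: La_witness; rewrite card_ord.
have [rho [rho_lt rhoM]] := free_ranked free0.
pose f := widen_ord le_ik; have fI : injective f by move=> x y /(congr1 val) /= /val_inj.
pose X := f @: [set: 'I_i].
have cX : #|X| = i by rewrite card_imset // cardsT card_ord.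
have cCX : #|~: X| = k - i by rewrite cardsCs setCK card_ord cX.
pose DD := [set D : {set 'I_k} | D \subset ~: X & #|D| == (k - i)./2].
pose mix (A : {set 'I_i}) (D : {set 'I_k}) := f @: A :|: D.
have fX (A : {set 'I_i}) : f @: A \subset X by apply: imsetS; apply: subsetT.
have mixA A D : D \in DD -> f @^-1: mix A D = A.
  rewrite inE => /andP[sD _]; apply/setP => x; rewrite !inE mem_imset //.
  have fxX : f x \in X by rewrite imset_f.
  have [|] := boolP (f x \in D); last by rewrite orbF.
  by move/(subsetP sD); rewrite inE fxX.
have mixD A D : D \in DD -> mix A D :\: X = D.
  rewrite inE => /andP[sD _].
  have eD : D :\: X = D by apply/setDidPl; rewrite disjoints_subset.
  by rewrite /mix setDUl eD; move: (fX A); rewrite -setD_eq0 => /eqP->; rewrite set0U.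
pose F := [set mix p.1 p.2 | p in setX F0 DD].
have mixF A D : A \in F0 -> D \in DD -> mix A D \in F.
  by move=> AF DD'; apply/imsetP; exists (A, D) => //; rewrite inE AF.
have rkF : ranked h F.
  exists (fun C : {set 'I_k} => rho (f @^-1: C)); split.
    by move=> _ /imsetP[[A D] /setXP[/= AF DD']->]; rewrite mixA // rho_lt.
  move=> _ _ /imsetP[[A D] /setXP[/= AF dD]->] /imsetP[[A' D'] /setXP[/= AF' dD']->].
  move=> pAA'; rewrite !mixA //; apply: rhoM => //.
  have eD : D = D'.
    apply/eqP; rewrite eqEcard -(mixD A D) // -{1}(mixD A' D') //.
    rewrite setSD ?proper_sub //= mixD //.
    by move: dD dD'; rewrite !inE => /andP[_ /eqP->] /andP[_ /eqP->].
  rewrite properEneq; apply/andP; split.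
    by apply: contraTneq pAA' => ->; rewrite eD properxx.
  by rewrite -(mixA A D) // -(mixA A' D') // preimsetS // proper_sub.
apply: leq_trans (leq_La _ (ranked_free rkF)).
rewrite !ncopiesE mulnC; have -> : midbin (k - i) = #|DD|.
  by rewrite /DD cards_draws cCX.
rewrite -cardsX.
pose g (p : {set {set 'I_i}} * {set 'I_k}) := (fun A => mix A p.2) @: p.1.
have mixI D : D \in DD -> injective (fun A => mix A D).
  by move=> dD A1 A2 eqA; rewrite -(mixA A1 D) // eqA mixA.
have gI : {in setX (copies Q F0) DD &, injective g}.
  move=> [B1 D1] [B2 D2] /setXP[/= cB1 dD1] /setXP[/= cB2 dD2]; rewrite /g /= => eqg.
  have eD : D1 = D2.
    have /card_gt0P[A AB1] : 0 < #|B1|.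
      by move: cB1; rewrite inE => /andP[_ /card_copy ->].
    have := imset_f (fun A => mix A D1) AB1; rewrite eqg => /imsetP[A' _ eqA].
    by rewrite -(mixD A D1) // eqA mixD.
  by move: eqg; rewrite eD => /(imset_inj (mixI _ dD2)) ->.
rewrite -(card_in_imset gI); apply: subset_leq_card.
apply/subsetP => _ /imsetP[[B D] /setXP[/= + dD]->]; rewrite !inE /g /=.
case/andP=> sB cB; apply/andP; split.
  by apply/subsetP => _ /imsetP[A AB ->]; apply: mixF => //; apply: (subsetP sB).
apply: copy_imset cB; first by move=> A1 A2 _ _ /(mixI _ dD).
by move=> A1 A2 _ _ sA; rewrite setSU ?imsetS.
Qed.

Lemma La_mono i k : i <= k -> La i 'I_h.+1 Q <= La k 'I_h.+1 Q.
Proof.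
move=> le_ik; apply: leq_trans (La_growth le_ik).
by rewrite leq_pmull // bin_gt0; lia.
Qed.

End Growth.

(** * Switching inequality *)

Section Switching.
Variables (n k r : nat).
Hypothesis r_gt1 : 1 < r.
Implicit Types (S : {set {set 'I_n}}) (A : {set 'I_n}).

Let r_gt0 : 0 < r. Proof. exact: ltnW. Qed.

Local Notation D := (tdraws n k r).

Lemma draw_card S A : S \in D -> A \in S -> #|A| = k.
Proof. by rewrite inE => /andP[/subsetP sS _] /sS; rewrite inE => /eqP. Qed.

Lemma draw_size S : S \in D -> #|S| = r.
Proof. by rewrite inE => /andP[_ /eqP]. Qed.

Lemma interD1 S A : A \in S -> inter S = A :&: inter (S :\ A).
Proof. by move=> AS; rewrite /inter (big_setD1 A). Qed.

Lemma inter_sub S A : A \in S -> inter S \subset A.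
Proof. by move=> AS; apply: bigcap_inf. Qed.

Definition missed S A := inter (S :\ A) :\: A.

(** For fixed A, the sets [missed S A'] with A' different from A are pairwise disjoint parts of A
    outside the intersection, so together they have at most k - #|inter S| points. Summing over A
    counts each A' exactly r - 1 times. *)
Lemma sum_missed S : S \in D ->
  r.-1 * \sum_(A in S) #|missed S A| <= r * (k - #|inter S|).
Proof.
move=> SD.
have -> : r * (k - #|inter S|) = \sum_(A in S) #|A :\: inter S|.
  rewrite -(draw_size SD) -sum_nat_const; apply: eq_bigr => A AS.
  by rewrite cardsD (setIidPr (inter_sub AS)) (draw_card SD AS).
apply: (@leq_trans (\sum_(A in S) \sum_(A' in S :\ A) #|missed S A'|)).
  rewrite (exchange_big_dep (mem S)) /=; last by move=> A A' _ /setD1P[].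
  rewrite big_distrr /=; apply: leq_sum => A' A'S.
  rewrite sum_nat_const leq_mul2r; apply/orP; right.
  rewrite -(draw_size SD) (cardsD1 A' S) A'S /= subset_leq_card //.
  apply/subsetP => A /setD1P[neqA AS].
  by rewrite unfold_in /= AS !inE eq_sym neqA A'S.
apply: leq_sum => A AS; rewrite -card_dep.
have sI : {in [set p | (p.1 \in S :\ A) && (p.2 \in missed S p.1)] &, injective snd}.
  move=> [A1 x1] [A2 x2] /setIdP[/= /setD1P[_ A1S] /setDP[x1I x1A]].
  move=> /setIdP[/= /setD1P[_ A2S] /setDP[x2I _]] eqx; rewrite eqx; congr (_, _).
  apply/eqP; apply: contraR x1A => neq; rewrite eqx.
  by move/bigcapP: x2I; apply; rewrite !inE neq.
rewrite -(card_in_imset sI); apply: subset_leq_card.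
apply/subsetP => _ /imsetP[[A' x] /setIdP[/= /setD1P[neqA A'S] /setDP[xI xA']] ->] /=.
rewrite inE; apply/andP; split.
  by apply: contra xA'; apply: (subsetP (inter_sub A'S)).
by move/bigcapP: xI; apply; rewrite !inE eq_sym neqA.
Qed.

Lemma interbetaE i : i <= k ->
  interbeta n r i k = #|[set S in D | #|inter S| == i]|.
Proof. by move=> le_ik; rewrite card_interE. Qed.

Definition shift A x z := z |: (A :\ x).

(* Exchange x in the intersection for z in one member A of S: the intersection
   loses exactly x as soon as some other member avoids z. *)
Lemma switching i : 0 < i -> i <= k ->
  interbeta n r i k * (i * (r.-1 * (n - k) - (k - i))) <=
  interbeta n r i.-1 k * (k - i).+1 ^ 2.
Proof.
move=> i_gt0 le_ik; rewrite !interbetaE //; last by apply: leq_trans le_ik; apply: leq_pred.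
(* [Y1] lists the exchanges possible in S. After an exchange, x is missed by the new member alone
   and z lies in that member outside the intersection, so [Y2] bounds the number of exchanges
   leading to a given r-set. *)
pose Y1 S := [set q : {set 'I_n} * ('I_n * 'I_n) |
   (q.1 \in S) && (q.2 \in setX (inter S) (~: q.1 :\: missed S q.1))].
pose Y2 S := [set q : {set 'I_n} * ('I_n * 'I_n) |
   (q.1 \in S) && (q.2 \in setX (missed S q.1) (q.1 :\: inter S))].
pose P1 := [set p | (p.1 \in [set S in D | #|inter S| == i]) && (p.2 \in Y1 p.1)].
pose P2 := [set p | (p.1 \in [set S in D | #|inter S| == i.-1]) && (p.2 \in Y2 p.1)].
have le12 : #|P1| <= #|P2|.
  pose g (p : {set {set 'I_n}} * ({set 'I_n} * ('I_n * 'I_n))) :=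
    let: (S0, (A, (x, z))) := p in
    (shift A x z |: (S0 :\ A), (shift A x z, (x, z))).
  pose g' (p : {set {set 'I_n}} * ({set 'I_n} * ('I_n * 'I_n))) :=
    let: (S0, (A, (x, z))) := p in (shift A z x |: (S0 :\ A), (shift A z x, (x, z))).
  have main S A x z : S \in D -> A \in S -> x \in inter S -> z \notin A ->
      z \notin missed S A ->
    [/\ shift A x z \notin S :\ A, shift (shift A x z) z x = A,
        (shift A x z |: (S :\ A)) :\ shift A x z = S :\ A &
        inter (shift A x z |: (S :\ A)) = inter S :\ x].
    move=> SD AS xS zA zmis; have xA : x \in A by apply: (subsetP (inter_sub AS)).
    have neqxz : x != z by apply: contraNneq zA => <-.
    have xI : x \in inter (S :\ A).
      by move: xS; rewrite (interD1 AS) inE => /andP[].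
    have zI : z \notin inter (S :\ A).
      by move: zmis; rewrite inE zA.
    have N : shift A x z \notin S :\ A.
      apply: contraL xI => sS; apply/bigcapP => /(_ _ sS).
      by rewrite !inE (negbTE neqxz) eqxx.
    split=> //.
    - apply/setP => y; rewrite !inE.
      have [->|_] := eqVneq y x; first by rewrite xA.
      by have [->|] := eqVneq y z; rewrite ?(negbTE zA).
    - by rewrite setU1K.
    - rewrite {1}/inter bigcap_setU big_set1 -/(inter (S :\ A)) (interD1 AS).
      apply/setP => y; rewrite !inE.
      have [->|_] := eqVneq y x; first by rewrite (negbTE neqxz).
      by have [->|] := eqVneq y z; rewrite ?(negbTE zI) ?andbF.
  have gI : {in P1 &, injective g}.
    apply: (@can_in_inj _ _ _ _ g') => -[S [A [x z]]].
    case/setIdP=> /= /setIdP[SD _] /setIdP[/= AS /setXP[xS /setDP[]]].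
    rewrite inE => zA zmis; have [_ E1 E2 _] := main S A x z SD AS xS zA zmis.
    by rewrite /g /= E1 E2 setD1K.
  rewrite -(card_in_imset gI); apply: subset_leq_card.
  apply/subsetP => _ /imsetP[[S [A [x z]]] + ->].
  case/setIdP=> /= /setIdP[SD /eqP cS] /setIdP[/= AS /setXP[xS /setDP[]]].
  rewrite inE => zA zmis; have [N E1 E2 E3] := main S A x z SD AS xS zA zmis.
  have xA : x \in A by apply: (subsetP (inter_sub AS)).
  have neqxz : x != z by apply: contraNneq zA => <-.
  rewrite inE /=; apply/andP; split.
    have cE : #|inter S :\ x| = i.-1 by rewrite -cS (cardsD1 x (inter S)) xS.
    have cE' : #|S| = r by apply: draw_size.
    rewrite inE E3 cE eqxx andbT inE cardsU1 N -cE' (cardsD1 A S) AS eqxx andbT.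
    apply/subsetP => C; rewrite !inE => /orP[/eqP->|/andP[_ CS]].
      rewrite cardsU1 !inE (negbTE zA) andbF /= -(draw_card SD AS).
      by rewrite (cardsD1 x A) xA.
    by rewrite (draw_card SD CS).
  rewrite inE /= setU11 /= inE /= E3 /missed E2.
  have xI : x \in inter (S :\ A) by move: xS; rewrite (interD1 AS) inE => /andP[].
  have zS : z \notin inter S by apply: contra zA; apply: (subsetP (inter_sub AS)).
  by rewrite !inE xI (negbTE neqxz) !eqxx (negbTE zS) andbF.
(* Each A admits the n - k points outside it except those in [missed S A]; the factor r - 1 is what
   [sum_missed] needs. *)
have c1 : #|[set S in D | #|inter S| == i]| * (i * (r * (r.-1 * (n - k) - (k - i))))
          <= r.-1 * #|P1|.
  rewrite /P1 card_dep -sum_nat_const big_distrr /=.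
  apply: leq_sum => S /setIdP[SD /eqP cS].
  rewrite (card_dep S (fun A => setX (inter S) (~: A :\: missed S A))) (eq_bigr (fun A => i * #|~: A :\: missed S A|)); last first.
    by move=> A _; rewrite cardsX cS.
  rewrite -big_distrr /= [leqRHS]mulnCA leq_mul2l; apply/orP; right.
  have eqc : \sum_(A in S) #|~: A :\: missed S A| + \sum_(A in S) #|missed S A|
             = r * (n - k).
    rewrite -big_split /= -(draw_size SD) -sum_nat_const; apply: eq_bigr => A AS.
    have sm : missed S A \subset ~: A by rewrite /missed setDE subsetIr.
    rewrite cardsD (setIidPr sm) subnK ?subset_leq_card //.
    by rewrite cardsCs setCK card_ord (draw_card SD AS).
  have := sum_missed SD; rewrite cS; move: eqc.
  set s1 := \sum_(A in S) _; set s2 := \sum_(A in S) _ => eqc le2.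
  rewrite mulnBr leq_subLR mulnCA -eqc mulnDr addnC leq_add2r; exact: le2.
have c2 : r.-1 * #|P2| <= #|[set S in D | #|inter S| == i.-1]| * (r * (k - i).+1 ^ 2).
  rewrite /P2 card_dep -sum_nat_const big_distrr /=.
  apply: leq_sum => S /setIdP[SD /eqP cS].
  have ey : k - #|inter S| = (k - i).+1 by rewrite cS; lia.
  rewrite (card_dep S (fun A => setX (missed S A) (A :\: inter S))) (eq_bigr (fun A => #|missed S A| * (k - i).+1)); last first.
    move=> A AS; rewrite cardsX; congr (_ * _).
    by rewrite cardsD (setIidPr (inter_sub AS)) (draw_card SD AS).
  rewrite -big_distrl /= mulnA expnS expn1 mulnA leq_mul2r /=.
  by have := sum_missed SD; rewrite ey.
rewrite -(leq_pmul2l r_gt0).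
have := leq_mul (leqnn r.-1) le12; move: c1 c2; lia.
Qed.

(** Every point of a member outside the intersection is avoided by one of the r - 1 other members,
    and each of these avoids only n - k points. *)
Lemma interbeta0 i : i <= k -> r.-1 * (n - k) < k - i -> interbeta n r i k = 0.
Proof.
move=> le_ik lt_y; rewrite interbetaE //; apply/eqP; rewrite cards_eq0.
apply/eqP/setP => S; rewrite in_set0; apply/negP => /setIdP[SD /eqP cS].
have /card_gt0P[A AS] : 0 < #|S| by rewrite (draw_size SD).
have sub : A :\: inter S \subset \bigcup_(B in S :\ A) ~: B.
  apply/subsetP => x /setDP[xA]; rewrite (interD1 AS) inE xA /= => xI.
  by rewrite -setC_bigcap inE.
have le_sum : #|\bigcup_(B in S :\ A) ~: B| <= \sum_(B in S :\ A) #|~: B|.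
  elim/big_rec2: _ => [|B x U _ le_Ux]; first by rewrite cards0.
  by apply: leq_trans (leq_card_setU _ _).1 _; rewrite leq_add2l.
have := leq_trans (subset_leq_card sub) le_sum.
rewrite (eq_bigr (fun=> n - k)); last first.
  by move=> B /setD1P[_ BS]; rewrite cardsCs setCK card_ord (draw_card SD BS).
rewrite sum_nat_const cardsD (setIidPr (inter_sub AS)) (draw_card SD AS) cS.
have -> : #|S :\ A| = r.-1 by rewrite -(draw_size SD) (cardsD1 A S) AS.
by rewrite leqNgt lt_y.
Qed.

End Switching.

Lemma midbin_gt0 m : 0 < midbin m.
Proof. by rewrite bin_gt0; lia. Qed.

(** The ratio of consecutive values is 2 from an odd m and (2p + 1) / (p + 1) from m = 2p, thus at
    least 3/2 once p > 0. *)
Lemma midbinS m : 1 < m -> 3 * midbin m <= 2 * midbin m.+1.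
Proof.
rewrite /midbin => m_gt1; have := odd_double_half m.
set p := m./2; case: (odd m) => /= em.
  have -> : uphalf m = p.+1 by rewrite /p; lia.
  have -> : 'C(m.+1, p.+1) = 2 * 'C(m, p).
    by rewrite binS -[X in 'C(_, X) + _](_ : m - p = _) ?bin_sub; lia.
  lia.
have -> : uphalf m = p by rewrite /p; lia.
have := mul_bin_down m.+1 p; rewrite /=; have p_gt0 : 0 < p by lia.
have -> : m.+1 - p = p.+1 by lia.
move=> E; rewrite -(leq_pmul2l (ltn0Sn p)) [leqRHS]mulnCA -E !mulnA leq_mul2r.
by apply/orP; right; lia.
Qed.

Section MidbinSum.
Local Open Scope ring_scope.

Lemma sum_midbin N : \sum_(4 <= y < N) ((midbin y)%:R)^-1 <= 1 / 2%:R :> rat.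
Proof.
have gt0 m : 0 < (midbin m)%:R :> rat by rewrite ltr0n midbin_gt0.
have [le_N4|lt_4N] := leqP N 4; first by rewrite big_geq.
(* The remainder 3 / midbin N pays for the next term, since 1 / midbin N + 3 / midbin (N + 1) <= 3 /
   midbin N by [midbinS]; at N = 4 it equals 3/6. *)
suff: \sum_(4 <= y < N) ((midbin y)%:R)^-1 <= 1 / 2%:R - 3%:R / (midbin N)%:R :> rat.
  by move/le_trans; apply; rewrite gerBl divr_ge0.
have [m ->] : exists m, N = (4 + m)%N by exists (N - 4)%N; lia.
elim: m {N lt_4N} => [|m IHm].
  have -> : midbin (4 + 0) = 6%N by [].
  by rewrite big_geq ?leqnn; [lra|].
set N := (4 + m)%N in IHm *; rewrite addnS -/N big_nat_recr /=; last by rewrite /N.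
have : 3%:R / (midbin N.+1)%:R <= 2%:R / (midbin N)%:R :> rat.
  by rewrite ler_pdivrMr // mulrAC ler_pdivlMr // -!natrM ler_nat midbinS.
move: IHm; lra.
Qed.

(* Only the growth of q forced by the switching inequality is used: either q
   stops before 4, or q 1, q 2 are negligible and the tail is geometric. *)
Lemma sum_midbin_le (q : nat -> nat) (M k b : nat) :
  (22 <= k + b)%N ->
  (forall y, q y <= M)%N ->
  (forall y, minn k b < y -> q y = 0)%N ->
  (forall y, q y * ((k - y) * (b - y)) <= q y.+1 * y.+1 ^ 2)%N ->
  \sum_(1 <= y < k.+1) (q y)%:R / (midbin y)%:R <= M%:R :> rat.
Proof.
move=> le22 qM q0 qS.
(* The range is enlarged so that the terms 1, 2 and 3 can be split off whatever k is. *)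
apply: (@le_trans _ _ (\sum_(1 <= y < k.+4) (q y)%:R / (midbin y)%:R)).
  rewrite [leRHS](big_cat_nat (n := k.+1)) /=; [|by []|by lia].
  by rewrite lerDl sumr_ge0 // => y _; rewrite divr_ge0.
rewrite big_ltn // big_ltn // big_ltn //.
have -> : midbin 1 = 1%N by [].
have -> : midbin 2 = 2%N by [].
have -> : midbin 3 = 3%N by [].
have tail : \sum_(4 <= y < k.+4) (q y)%:R / (midbin y)%:R <= M%:R * (1 / 2%:R) :> rat.
  apply: le_trans (_ : _ <= M%:R * \sum_(4 <= y < k.+4) ((midbin y)%:R)^-1) _.
    rewrite big_distrr; apply: ler_sum => y _.
    by rewrite ler_wpM2r ?invr_ge0 // ler_nat.
  by apply: ler_wpM2l => //; apply: sum_midbin.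
have tail0 : (minn k b <= 3)%N -> \sum_(4 <= y < k.+4) (q y)%:R / (midbin y)%:R = 0 :> rat.
  move=> le3; rewrite big_nat big1 // => y /andP[lt3y _].
  by rewrite q0 ?mul0r //; apply: leq_ltn_trans le3 lt3y.
move: tail tail0; set s := \sum_(4 <= y < _) _ => tail tail0.
have M1 : (q 1%N)%:R <= M%:R :> rat by rewrite ler_nat.
have M2 : (q 2%N)%:R <= M%:R :> rat by rewrite ler_nat.
have M3 : (q 3%N)%:R <= M%:R :> rat by rewrite ler_nat.
have M0 : 0 <= M%:R :> rat by [].
have H1 := qS 1%N; have H2 := qS 2%N.
have ratio c x y z : (x * z <= y * c)%N -> forall e, (e <= z)%N ->
    x%:R * e%:R <= y%:R * c%:R :> rat.
  by move=> le e le_ez; rewrite -!natrM ler_nat (leq_trans _ le) // leq_mul2l le_ez orbT.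
(* The constants below are the least values of (k - 1)(b - 1) and (k - 2)(b - 2) under k + b >= 22:
   19 = 1 * 19 if the minimum of k and b is 2; 36 = 2 * 18 and 17 = 1 * 17 if it is 3; 51 = 3 * 17
   and 32 = 2 * 16 from 4 on. The last case ends just below M; with 21 in place of 22 its estimate
   would exceed M. *)
have [le_m|lt_m] := leqP (minn k b) 1.
  have q2 : q 2%N = 0%N by apply: q0; lia.
  have q3 : q 3%N = 0%N by apply: q0; lia.
  rewrite q2 q3 !mul0r tail0 ?(leq_trans le_m) //; lra.
have [le_m2|lt_m2] := leqP (minn k b) 2.
  have q3 : q 3%N = 0%N by apply: q0; lia.
  have R1 := ratio _ _ _ _ H1 19%N _.
  rewrite q3 !mul0r tail0 ?(leq_trans le_m2) //; have := R1 ltac:(nia).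
  lra.
have [le_m3|lt_m3] := leqP (minn k b) 3.
  have R1 := ratio _ _ _ _ H1 36%N ltac:(nia); have R2 := ratio _ _ _ _ H2 17%N ltac:(nia).
  rewrite tail0 //; lra.
have R1 := ratio _ _ _ _ H1 51%N ltac:(nia); have R2 := ratio _ _ _ _ H2 32%N ltac:(nia).
lra.
Qed.

End MidbinSum.

(** * Finite verification *)

(** For C(x, r) where x is itself a binomial coefficient, far outside the table below. Every
    division is exact. *)
Fixpoint binN (x : N) (r : nat) : N :=
  if r is r'.+1 then
    N.div (N.mul (binN x r') (N.sub x (N.of_nat r'))) (N.of_nat r'.+1)
  else 1%num.

Lemma binNE n r : binN (N.of_nat n) r = N.of_nat 'C(n, r).
Proof.
elim: r => [|r IHr]; first by rewrite bin0.
rewrite [LHS]/= -/(binN _ _) IHr -Nat2N.inj_sub -Nat2N.inj_mul.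
have -> : Nat.mul 'C(n, r) (Nat.sub n r) = ('C(n, r.+1) * r.+1)%N.
  by rewrite multE minusE mulnC -mul_bin_left mulnC.
by rewrite -multE Nat2N.inj_mul N.div_mul //; lia.
Qed.

Fixpoint addshiftN (l : seq N) : seq N :=
  if l is a :: ((b :: _) as l') then N.add a b :: addshiftN l' else [::].

(* Rows of Pascal's triangle, padded to length [s]. *)
Fixpoint pascalN (s m : nat) : seq N :=
  if m is m'.+1 then 1%num :: addshiftN (pascalN s m') else 1%num :: nseq s.-1 0%num.

Lemma pascalNE s m :
  0 < s -> pascalN s m = [seq N.of_nat 'C(m, i) | i <- iota 0 s].
Proof.
case: s => // s _; elim: m => [|m IHm].
  suff H j : nseq s 0%num = [seq N.of_nat 'C(0, i) | i <- iota j.+1 s] by rewrite [LHS]/= (H 0).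
  by elim: s j => // s IHs j; rewrite [LHS]/= (IHs j.+1).
rewrite [LHS]/= -/(pascalN s.+1 m) IHm.
suff H j q : addshiftN [seq N.of_nat 'C(m, i) | i <- iota j q.+1] =
    [seq N.of_nat 'C(m.+1, i) | i <- iota j.+1 q] by rewrite H map_cons bin0.
elim: q j => // q IHq j; rewrite [RHS]map_cons -IHq [LHS]/=; congr (_ :: _).
by rewrite binS addnC Nat2N.inj_add.
Qed.

Definition tableN (s : nat) : seq (seq N) := [seq pascalN s m | m <- iota 0 s].

Definition lookN (tab : seq (seq N)) (m i : nat) : N := nth 0%num (nth [::] tab m) i.

Lemma lookNE s m i : m < s -> i < s -> lookN (tableN s) m i = N.of_nat 'C(m, i).
Proof.
move=> lt_ms lt_is; rewrite /lookN (nth_map 0) ?size_iota // nth_iota // add0n.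
rewrite pascalNE; last by apply: leq_ltn_trans lt_ms.
by rewrite (nth_map 0) ?size_iota // nth_iota.
Qed.

Section InterN.
Variables (C : nat -> nat -> N) (s : nat).
Hypothesis CE : forall m i, m < s -> i < s -> C m i = N.of_nat 'C(m, i).

Fixpoint dotN (i j : nat) (l : seq N) : N :=
  if l is t :: l' then N.add (N.mul (C j i) t) (dotN i j.+1 l') else 0%num.

(** Solves the triangular system [sum_inter_bin] from i = k downwards: the unknown with index i has
    coefficient C(i, i) = 1, and those with larger index are already in [l]. *)
Fixpoint interN (n k r m : nat) : seq N :=
  if m is m'.+1 then
    let l := interN n k r m' in
    let i := k - m' in
    N.sub (N.mul (C n i) (binN (C (n - i) (k - i)) r)) (dotN i i.+1 l) :: l
  else [::].

Lemma dotNE (t : nat -> nat) i j m : i < s -> j + m <= s ->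
  dotN i j [seq N.of_nat (t x) | x <- iota j m] =
  N.of_nat (\sum_(j <= x < j + m) 'C(x, i) * t x).
Proof.
move=> lt_is; elim: m j => [|m IHm] j le_s; first by rewrite addn0 big_geq.
rewrite [LHS]/= IHm ?addSnnS // CE //; last by lia.
rewrite -Nat2N.inj_mul -Nat2N.inj_add.
by rewrite multE plusE [in RHS]big_ltn // addnS ltnS leq_addr.
Qed.

Lemma interNE n k r m : 0 < r -> n < s -> k < s -> m <= k.+1 ->
  interN n k r m = [seq N.of_nat (interbeta n r i k) | i <- iota (k.+1 - m) m].
Proof.
move=> r_gt0 lt_ns lt_ks; elim: m => [//|m IHm] lt_mk.
rewrite [LHS]/= IHm; last exact: ltnW.
have le_mk : m <= k by [].
have -> : k.+1 - m = (k - m).+1 by rewrite subSn.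
have -> : k.+1 - m.+1 = k - m by rewrite subSS.
set i := k - m; have le_ik : i <= k by apply: leq_subr.
have lt_is : i < s by apply: leq_ltn_trans lt_ks.
rewrite [RHS]/=; congr (_ :: _).
rewrite dotNE //; last by rewrite /i; lia.
rewrite !CE //; [|by lia|by lia].
rewrite binNE -Nat2N.inj_mul -Nat2N.inj_sub; congr N.of_nat.
rewrite multE minusE -(sum_inter_bin n r_gt0 le_ik).
rewrite -(big_mkord predT (fun j => 'C(n, j) * beta0 r (level (n - j) (k - j)) * 'C(j, i))).
rewrite (big_cat_nat (n := i)) //=; last by apply: leqW.
rewrite [X in X + _]big_nat [X in X + _]big1 ?add0n; last first.
  by move=> j /andP[_ lt_ji]; rewrite (bin_small lt_ji) muln0.
rewrite big_ltn // binn muln1.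
have -> : i.+1 + m = k.+1 by rewrite addSn subnK.
rewrite [X in _ + X - _](eq_bigr (fun j => 'C(j, i) * interbeta n r j k)).
  by rewrite addnK.
by move=> j _; rewrite mulnC.
Qed.

End InterN.

Definition maxN (l : seq N) : N := foldr N.max 0%num l.
Definition wsumN (c : nat -> N) (j : nat) (l : seq N) : N :=
  (fix ws j l := if l is t :: l' then N.add (N.mul t (c j)) (ws j.+1 l') else 0%num) j l.

Lemma maxNE (t : nat -> nat) j m : 
  maxN [seq N.of_nat (t x) | x <- iota j m] = N.of_nat (\max_(j <= x < j + m) t x).
Proof.
elim: m j => [|m IHm] j; first by rewrite addn0 big_geq.
rewrite [LHS]/= -/(maxN _) IHm -Nat2N.inj_max addnS -addSn.
rewrite [in RHS]big_ltn ?ltnS ?leq_addr //; lia.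
Qed.

Lemma wsumNE (t : nat -> nat) (c : nat -> N) j m :
  wsumN c j [seq N.of_nat (t x) | x <- iota j m] =
  N.of_nat (\sum_(j <= x < j + m) t x * N.to_nat (c x)).
Proof.
elim: m j => [|m IHm] j; first by rewrite addn0 big_geq.
rewrite [LHS]/= -/(wsumN c j.+1 _) IHm -{1}(N2Nat.id (c j)).
rewrite -Nat2N.inj_mul -Nat2N.inj_add multE plusE addnS -addSn.
by rewrite [in RHS]big_ltn // ltnS leq_addr.
Qed.

(** Rounding up keeps the integer weights upper bounds for the fractions. *)
Definition cdivN (x y : N) : N := N.div (N.add x (N.sub y 1)) y.

Lemma leq_cdivN (x y : N) : y <> 0%num -> N.le x (N.mul (cdivN x y) y).
Proof.
move=> y0; rewrite /cdivN; set a := N.add x (N.sub y 1).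
by have := N.div_mod a y y0; have := N.mod_lt a y y0; rewrite /a; lia.
Qed.

Section Checks.
(* The weights are fractions over the common denominator [denN]. *)
Variables (C : nat -> nat -> N) (denN : N) (s : nat).
Hypothesis CE : forall m i, m < s -> i < s -> C m i = N.of_nat 'C(m, i).

Definition midbinN (m : nat) : N := C m m./2.

Lemma midbinNE m : m < s -> midbinN m = N.of_nat (midbin m).
Proof. by move=> lt_ms; apply: CE => //; lia. Qed.

Definition weight0 (k i : nat) : N := cdivN denN (midbinN (k - i)).

(** The second bound is [avg_bin] for covers of at least two points. For k <= 1, where C(k, 2) = 0,
    it becomes the trivial weight 1. *)
Definition weight2 (k i : nat) : N :=
  N.min (weight0 k i)
    (if k <= 1 then denN else cdivN (N.mul denN (C i 2)) (C k 2)).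

Definition checkN (c : nat -> nat -> N) (n k r : nat) : bool :=
  let l := interN C n k r k.+1 in
  N.leb (wsumN (c k) 0 l) (N.mul denN (maxN l)).

Lemma checkNP c n k r : 0 < r -> n < s -> k < s -> checkN c n k r ->
  \sum_(i < k.+1) interbeta n r i k * N.to_nat (c k i) <=
  N.to_nat denN * \max_(i < k.+1) interbeta n r i k.
Proof.
move=> r_gt0 lt_ns lt_ks; rewrite /checkN; cbv zeta; rewrite (interNE CE) // subnn.
rewrite (wsumNE (fun i => interbeta n r i k)) (maxNE (fun i => interbeta n r i k)) add0n.
rewrite !big_mkord => /N.leb_spec0; lia.
Qed.

(* The cases k + (r - 1)(n - k) < 22 not covered by [sum_midbin_le]; the
   inequality fails for some k when r = 2 and n <= 14. *)
Definition check0 (x : nat) : bool :=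
  all (fun r => all (fun b => all (fun k =>
     (r == 2) && (k + b <= 14) || checkN weight0 (k + b) k r)
    (iota 1 (x - r.-1 * b))) (iota 1 (x %/ r.-1))) (iota 2 x).

(* The exceptional range r = 2, n <= 14 of [check0]: [check2] when every copy of
   Q covers at least two points, [check1] otherwise. *)
Definition check2 (x : nat) : bool :=
  all (fun n => all (fun k => checkN weight2 n k 2) (iota 0 n)) (iota 0 x).

Definition check1 (x : nat) : bool :=
  all (fun n =>
    let V := maxN [seq N.mul (maxN (interN C n k 2 k.+1)) (midbinN k) | k <- iota 0 n] in
    all (fun k => N.leb (wsumN midbinN 0 (interN C n k 2 k.+1)) V) (iota 0 n)) (iota 0 x).

End Checks.

(* The table and the denominator are hidden behind an existential, lest later
   steps unfold the latter in unary. *)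
Lemma checks_true : exists (C : nat -> nat -> N) (den : N),
  [/\ forall m i, m < 22 -> i < 22 -> C m i = N.of_nat 'C(m, i), den <> 0%num &
      [&& check0 C den 21, check1 C 15 & check2 C den 15]].
Proof.
(* The table needs no row beyond 21, as n <= k + (r - 1)(n - k) <= 21 in [check0]. Rounding up to
   multiples of 1 / 10^9 leaves all inequalities intact. *)
exists (lookN (tableN 22)), 1000000000%num; split; [exact: lookNE | by [] | by vm_compute].
Qed.

(** * The weighted sum over intersection sizes *)

Lemma interbeta_diag n r k : 1 < r -> interbeta n r k k = 0.
Proof.
move=> r_gt1; rewrite /interbeta subnn; apply/eqP; rewrite muln_eq0; apply/orP; right.
rewrite cards_eq0; apply/eqP/setP => S; rewrite !inE; apply/negP => /and3P[sS /eqP cS _].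
by have := subset_leq_card sS; rewrite card_level bin0 cS leqNgt r_gt1.
Qed.

Lemma interbeta_full n r i : 1 < r -> i <= n -> interbeta n r i n = 0.
Proof.
move=> r_gt1; rewrite leq_eqVlt => /predU1P[->|lt_in]; first exact: interbeta_diag.
by apply: interbeta0 => //; [exact: ltnW | rewrite subnn muln0 subn_gt0].
Qed.

Definition maxinter n r k := \max_(i < k.+1) interbeta n r i k.

Lemma leq_maxinter n r i k : i <= k -> interbeta n r i k <= maxinter n r k.
Proof. by move=> le_ik; apply: (@leq_bigmax _ (fun i : 'I_k.+1 => interbeta n r i k) (Ordinal (le_ik : i < k.+1))). Qed.

Lemma maxinter_witness n r k : exists2 i, i <= k & maxinter n r k = interbeta n r i k.
Proof.
have k0 : 0 < #|'I_k.+1| by rewrite card_ord.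
have [i eqi] := bigop.eq_bigmax (fun i : 'I_k.+1 => interbeta n r i k) k0.
by exists i; first rewrite -ltnS.
Qed.

Section Weights.
Local Open Scope ring_scope.
Variables (n r k : nat) (y : nat -> rat) (W : rat).
Hypothesis r_gt1 : (1 < r)%N.
Hypothesis W_ge0 : 0 <= W.
Hypothesis y_mid : forall i, (i <= k)%N -> y i * (midbin (k - i))%:R <= W.

Local Notation t i := (interbeta n r i k).
Section Den.
Variables (C : nat -> nat -> N) (denN : N).
Hypothesis CE : forall m i, (m < 22)%N -> (i < 22)%N -> C m i = N.of_nat 'C(m, i).
Hypothesis denN0 : denN <> 0%num.

Lemma sum_weightN (c : nat -> nat -> N) : (n < 22)%N -> (k < 22)%N ->
  checkN C denN c n k r ->
  (forall i, (i <= k)%N -> (N.to_nat denN)%:R * y i <= (N.to_nat (c k i))%:R * W) ->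
  \sum_(i < k.+1) (t i)%:R * y i <= (maxinter n r k)%:R * W.
Proof.
move=> lt_n lt_k ck cy; have := checkNP CE (ltnW r_gt1) lt_n lt_k ck.
rewrite -/(maxinter n r k); set D := N.to_nat denN in cy * => le_sum.
have D_gt0 : 0 < D%:R :> rat by rewrite ltr0n /D; lia.
rewrite -(ler_pM2l D_gt0) mulrA -natrM.
apply: le_trans (_ : (\sum_(i < k.+1) t i * N.to_nat (c k i))%:R * W <= _); last first.
  by rewrite ler_wpM2r // ler_nat.
rewrite natr_sum big_distrl big_distrr /=; apply: ler_sum => i _.
rewrite natrM -mulrA mulrCA; apply: ler_wpM2l => //.
by apply: cy; rewrite -ltnS.
Qed.

Lemma weight0P i : (k < 22)%N -> (i <= k)%N ->
  (N.to_nat denN)%:R * y i <= (N.to_nat (weight0 C denN k i))%:R * W.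
Proof.
move=> lt_k le_ik; rewrite /weight0.
have lt_ki : (k - i < 22)%N by lia.
rewrite (midbinNE CE lt_ki); have m_gt0 := midbin_gt0 (k - i).
have le_c : (N.to_nat denN <= N.to_nat (cdivN denN (N.of_nat (midbin (k - i)))) * midbin (k - i))%N.
  by have := @leq_cdivN denN (N.of_nat (midbin (k - i))) ltac:(lia); lia.
have m_gt0' : 0 < (midbin (k - i))%:R :> rat by rewrite ltr0n.
rewrite -(ler_pM2r m_gt0') -mulrA.
apply: (@le_trans _ _ ((N.to_nat denN)%:R * W)); first by apply: ler_wpM2l; rewrite ?y_mid.
by rewrite mulrAC -natrM ler_wpM2r // ler_nat.
Qed.

Lemma weight2P i : (k < 22)%N -> (i <= k)%N ->
  'C(k, 2)%:R * y i <= 'C(i, 2)%:R * W ->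
  (N.to_nat denN)%:R * y i <= (N.to_nat (weight2 C denN k i))%:R * W.
Proof.
move=> lt_k le_ik y2; rewrite /weight2.
have min_nat a b : N.to_nat (N.min a b) = minn (N.to_nat a) (N.to_nat b) by lia.
rewrite min_nat /minn; case: ifP => _; first exact: weight0P.
case: ifP => [le_k1|/negbT]; last rewrite -ltnNge => lt_1k.
  apply: ler_wpM2l => //; apply: le_trans (y_mid le_ik); have := y_mid le_ik.
  have -> : midbin (k - i) = 1%N by move: le_k1 le_ik; case: (k) => [|[|]] //; case: (i) => [|[|]].
  by rewrite mulr1.
have lt_i : (i < 22)%N by lia.
rewrite !CE //.
have C2 : (0 < 'C(k, 2))%N by rewrite bin_gt0.
have le_c := @leq_cdivN (N.mul denN (N.of_nat 'C(i, 2))) (N.of_nat 'C(k, 2)) ltac:(lia).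
have {}le_c : (N.to_nat denN * 'C(i, 2) <=
    N.to_nat (cdivN (N.mul denN (N.of_nat 'C(i, 2))) (N.of_nat 'C(k, 2))) * 'C(k, 2))%N.
  by move: le_c; set c := cdivN _ _; nia.
have C2' : 0 < 'C(k, 2)%:R :> rat by rewrite ltr0n.
rewrite -(ler_pM2l C2') mulrCA.
apply: (@le_trans _ _ ((N.to_nat denN)%:R * ('C(i, 2)%:R * W))).
  by apply: ler_wpM2l; rewrite ?y2.
by rewrite !mulrA -!natrM mulnC ler_wpM2r // ler_nat [leqRHS]mulnC mulnC.
Qed.

End Den.

Lemma sum_weight2 : r = 2%N -> (n <= 14)%N -> (k < n)%N ->
  (forall i, (i <= k)%N -> 'C(k, 2)%:R * y i <= 'C(i, 2)%:R * W) ->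
  \sum_(i < k.+1) (t i)%:R * y i <= (maxinter n r k)%:R * W.
Proof.
move=> r2 le_n lt_kn y2.
have lt_k : (k < 22)%N by lia.
have [C [den [CE den0 /and3P[_ _ /allP ck2]]]] := checks_true.
apply: (@sum_weightN C den CE den0 (weight2 C den)); [lia | lia | | ].
  have /ck2/allP : n \in iota 0 15 by rewrite mem_iota; lia.
  by rewrite r2; apply; rewrite mem_iota.
by move=> i le_ik; apply: weight2P => //; apply: y2.
Qed.

Lemma sum_midbin_weight : ~~ ((r == 2%N) && (n <= 14)%N) -> (k <= n)%N ->
  \sum_(i < k.+1) (t i)%:R * y i <= (maxinter n r k)%:R * W.
Proof.
move=> r_or_n le_kn.
have [k0|k_gt0] := posnP k.
  rewrite big1 ?mulr_ge0 // => i _; have -> : (i : nat) = k by have := ltn_ord i; lia.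
  by rewrite interbeta_diag // mul0r.
move: le_kn; rewrite leq_eqVlt => /predU1P[eq_kn|lt_kn].
  rewrite big1 ?mulr_ge0 // => i _; have le_ik : (i <= k)%N by rewrite -ltnS.
  by rewrite -eq_kn interbeta_full // mul0r.
have [lt21|le21] := ltnP 21 (k + r.-1 * (n - k)); last first.
  have le_b : (n - k <= r.-1 * (n - k))%N by apply: leq_pmull; lia.
  have lt_k : (k < 22)%N by lia.
  have [C [den [CE den0 /and3P[/allP ck0 _ _]]]] := checks_true.
  apply: (@sum_weightN C den CE den0 (weight0 C den)) => //; [lia | | by move=> i; apply: weight0P].
  have r_in : r \in iota 2 21 by rewrite mem_iota; move: (leq_pmulr r.-1 (ltac:(lia) : 0 < n - k)%N); lia.
  have b_in : (n - k)%N \in iota 1 (21 %/ r.-1).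
    by rewrite mem_iota add1n ltnS leq_divRL; [rewrite mulnC|]; lia.
  have k_in : k \in iota 1 (21 - r.-1 * (n - k)) by rewrite mem_iota; lia.
  have /allP/(_ _ b_in)/allP/(_ _ k_in) := ck0 r r_in.
  by rewrite subnKC ?(ltnW lt_kn) // (negbTE r_or_n).
(* The numbers t(i, k) indexed by the deficiency x = k - i. With b = (r - 1)(n - k), [switching] is
   the growth hypothesis of [sum_midbin_le], and [interbeta0] its vanishing hypothesis. *)
pose q x := if (0 < x <= k)%N then t (k - x) else 0%N.
have main : \sum_(1 <= x < k.+1) (q x)%:R / (midbin x)%:R <= (maxinter n r k)%:R :> rat.
  apply: (@sum_midbin_le _ _ _ (r.-1 * (n - k))) => //.
  - by move=> x; rewrite /q; case: ifP => // _; apply: leq_maxinter; apply: leq_subr.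
  - move=> x; rewrite gtn_min /q; case: ifP => // /andP[x_gt0 le_xk]; rewrite ltnNge le_xk /=.
    by move=> lt_x; apply: interbeta0; rewrite ?leq_subr // subKn.
  - move=> x; rewrite {1}/q; case: ifP => // /andP[x_gt0 le_xk].
    have [->|ne_xk] := eqVneq x k; first by rewrite subnn mul0n muln0.
    have lt_xk : (x < k)%N by rewrite ltn_neqAle ne_xk.
    rewrite /q lt_xk /=.
    have := switching n r_gt1 (ltac:(lia) : 0 < k - x)%N (leq_subr x k).
    by rewrite subKn //; have -> : (k - x).-1 = (k - x.+1)%N by lia.
rewrite big_ord_recr /= interbeta_diag // mul0r addr0.
apply: le_trans (_ : (\sum_(1 <= x < k.+1) (q x)%:R / (midbin x)%:R) * W <= _); last first.
  exact: ler_wpM2r.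
rewrite big_add1 /= big_mkord big_distrl /= (reindex_inj rev_ord_inj) /=.
apply: ler_sum => i _; rewrite /q ltn_ord /= -mulrA ler_wpM2l //.
have le_i : (k - i.+1 <= k)%N by apply: leq_subr.
have := y_mid le_i; rewrite subKn // => le_W.
by rewrite ler_pdivlMl ?ltr0n ?midbin_gt0 // mulrC.
Qed.

End Weights.

(** * The case of a chain on at most two elements *)

Lemma maxN_leq (l : seq N) (V : nat) :
  (forall x, x \in l -> N.to_nat x <= V) -> N.to_nat (maxN l) <= V.
Proof.
elim: l => [//|x l IHl] leV; rewrite /= -/(maxN l) N2Nat.inj_max.
have := leV x (mem_head _ _).
have : N.to_nat (maxN l) <= V by apply: IHl => y yl; apply: leV; rewrite inE yl orbT.
lia.
Qed.

(** For such Q the averages are at most [midbin i] and w(j) is at least [midbin j], so only integers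
    are compared, and the maximum may be attained at a size j other than k. *)
Lemma sum_weight1 n k V : n <= 14 -> k < n ->
  (forall i j, i <= j -> j < n -> interbeta n 2 i j * midbin j <= V) ->
  \sum_(i < k.+1) interbeta n 2 i k * midbin i <= V.
Proof.
move=> le_n lt_kn leV; have [C [den [CE _ /and3P[_ /allP ck1 _]]]] := checks_true.
have n_in : n \in iota 0 15 by rewrite mem_iota; lia.
have := ck1 n n_in; cbv zeta => /allP/(_ k); rewrite mem_iota => /(_ lt_kn).
have lt_n : n < 22 by lia.
have E j : j < n -> interN C n j 2 j.+1 = [seq N.of_nat (interbeta n 2 i j) | i <- iota 0 j.+1].
  by move=> lt_jn; rewrite (interNE CE) ?subnn //; apply: ltn_trans lt_n.
rewrite E // (wsumNE (fun i => interbeta n 2 i k)) add0n big_mkord => /N.leb_spec0 le_max.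
apply: leq_trans (_ : N.to_nat (maxN [seq N.mul (maxN (interN C n j 2 j.+1))
  (midbinN C j) | j <- iota 0 n]) <= V).
  have {le_max}: \sum_(i < k.+1) interbeta n 2 i k * N.to_nat (midbinN C i) <=
      N.to_nat (maxN [seq N.mul (maxN (interN C n j 2 j.+1)) (midbinN C j) | j <- iota 0 n]).
    by move: le_max; set s := (\sum_(i < _) _)%N; set m := maxN _; lia.
  rewrite (eq_bigr (fun i : 'I_k.+1 => interbeta n 2 i k * midbin i)) //.
  by move=> i _; rewrite (midbinNE CE) ?Nat2N.id //; have := ltn_ord i; lia.
apply: maxN_leq.
move=> x /mapP[j + ->]; rewrite mem_iota add0n => /andP[_ lt_jn].
rewrite E // (maxNE (fun i => interbeta n 2 i j)) add0n big_mkord (midbinNE CE); last by lia.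
rewrite N2Nat.inj_mul !Nat2N.id.
have [i le_ij eqi] := maxinter_witness n 2 j.
by rewrite -/(maxinter n 2 j) eqi; apply: leV.
Qed.

Lemma leq_bin_mono n p q : p <= q -> q <= n./2 -> 'C(n, p) <= 'C(n, q).
Proof.
elim: q => [|q IHq]; first by rewrite leqn0 => /eqP->.
rewrite leq_eqVlt => /predU1P[->//|lt_pq] le_q.
apply: leq_trans (IHq lt_pq (ltnW le_q)) _.
rewrite -(leq_pmul2l (ltn0Sn q)) mul_bin_left leq_mul2r; apply/orP; right; lia.
Qed.

Lemma leq_bin_half n m : 'C(n, m) <= midbin n.
Proof.
have [le_m|lt_m] := leqP m n./2; first exact: leq_bin_mono.
have [le_mn|lt_nm] := leqP m n; last by rewrite bin_small.
by rewrite -bin_sub //; apply: leq_bin_mono => //; lia.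
Qed.

Lemma sperner (T : finType) (M : {set {set T}}) (X : {set T}) : antichain M ->
  (forall A, A \in M -> A \subset X) -> #|M| <= midbin #|X|.
Proof.
move=> antiM sMX; have := @LYM T set0 X M antiM; rewrite cards0 subn0.
have B0 : (0 < (midbin #|X|)%:R :> rat)%R by rewrite ltr0n midbin_gt0.
move=> /(_ _)/(le_trans _) H.
have : (\sum_(A in M) ((midbin #|X|)%:R)^-1 <= 1 :> rat)%R.
  apply: H; last by move=> A AM; rewrite sub0set sMX.
  apply: ler_sum => A AM; have leA := subset_leq_card (sMX A AM).
  by rewrite subn0 lef_pV2 ?posrE ?ltr0n ?midbin_gt0 ?bin_gt0 // ler_nat leq_bin_half.
by rewrite sumr_const -[X in (X <= _)%R]mulr_natl ler_pdivrMr // mul1r ler_nat.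
Qed.

Section SmallPoset.
Variables (d : Order.disp_t) (Q : finPOrderType d) (n : nat).
Variables (K : {set {set 'I_n}}) (B : {set {set 'I_n}}).
Hypothesis Q_gt0 : 0 < #|Q|.
Hypothesis rankedK : ranked (height Q) K.
Hypothesis copyB : B \in copies Q K.
Hypothesis coverB : #|cover B| <= 1.

Let sBK : B \subset K. Proof. by move: copyB; rewrite inE => /andP[]. Qed.
Let cB : is_copy Q B. Proof. by move: copyB; rewrite inE => /andP[]. Qed.
Let cardB : #|B| = #|Q|. Proof. exact: card_copy. Qed.

Lemma in_cover_small A : A \in B -> A = set0 \/ A = cover B.
Proof.
move=> AB; have sA : A \subset cover B by apply: bigcup_sup.
have [->|[x xA]] := set_0Vmem A; [by left | right].
apply/eqP; rewrite eqEcard sA; apply: leq_trans coverB _.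
by apply/card_gt0P; exists x.
Qed.

Lemma card_small : #|Q| <= 2.
Proof.
rewrite -cardB; apply: leq_trans (_ : #|[set set0; cover B]| <= 2); last first.
  by rewrite cards2; case: eqP.
by apply/subset_leq_card/subsetP => A /in_cover_small[->|->]; rewrite !inE eqxx ?orbT.
Qed.

(** If Q has two elements, the copy [B] consists of the empty set and a singleton. These need two
    different ranks below [height Q], so Q is a chain. *)
Lemma small_cases : #|Q| = 1 \/
  [/\ #|Q| = 2, height Q = 2, set0 \in K & B = [set set0; cover B]].
Proof.
have := card_small; rewrite leq_eqVlt => /predU1P[c2|]; last by left; lia.
right; have sub : B \subset [set set0; cover B].
  by apply/subsetP => A /in_cover_small[->|->]; rewrite !inE eqxx ?orbT.
have neq0 : set0 != cover B.
  apply/eqP => eq0; have := subset_leq_card sub; rewrite -eq0 setUid cards1 cardB c2.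
  by [].
have eB : B = [set set0; cover B] by apply/eqP; rewrite eqEcard sub cards2 neq0 cardB c2.
have K0 : set0 \in K by apply: (subsetP sBK); rewrite eB !inE eqxx.
have Kc : cover B \in K by apply: (subsetP sBK); rewrite {2}eB !inE eqxx orbT.
split=> //; apply/eqP; rewrite eqn_leq; apply/andP; split.
  have [C _ <-] := height_chain Q; by rewrite -c2 max_card.
have [rho [rho_lt rhoM]] := rankedK.
have := rhoM _ _ K0 Kc; rewrite properEneq neq0 sub0set => /(_ isT).
by have := rho_lt _ Kc; lia.
Qed.

(** A copy is determined by its cover. If #|Q| = 1, [K] is an antichain; if Q is the two-element
    chain, the empty set takes rank 0, the other members form an antichain, and every copy is the
    empty set with one of them. Sperner's theorem bounds both. *)
Lemma below_small X : #|below Q K X| <= midbin #|X|.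
Proof.
pose N := [set C in K | (C \subset X) && ((#|Q| == 1) || (C != set0))].
have [c1|[c2 h2 K0 _]] := small_cases.
  have [rho [rho_lt rhoM]] := rankedK.
  have h1 : height Q <= 1 by have [C _ <-] := height_chain Q; rewrite -c1 max_card.
  have antiN : antichain N.
    move=> A1 A2 /setIdP[A1K _] /setIdP[A2K _] sA; apply/eqP/contraT => neqA.
    have := rhoM A1 A2 A1K A2K; rewrite properEneq neqA sA => /(_ isT).
    by have := rho_lt _ A2K; lia.
  apply: leq_trans (sperner antiN (X := X) _); last first.
    by move=> A /setIdP[_ /andP[]].
  have one G : G \in below Q K X -> G = [set cover G] /\ cover G \in N.
    case/setIdP=> /setIdP[sGK /card_copy cG] sGX.
    have /cards1P[A eG] : #|G| == 1 by rewrite cG c1.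
    have cA : cover G = A by rewrite eG /cover big_set1.
    rewrite cA; split=> //; rewrite inE -{2}cA sGX c1 eqxx /= andbT.
    by apply: (subsetP sGK); rewrite eG inE.
  have fI : {in below Q K X &, injective (fun G => cover G)}.
    by move=> G1 G2 /one[e1 _] /one[e2 _] eqc; rewrite e1 e2 eqc.
  rewrite -(card_in_imset fI); apply: subset_leq_card.
  by apply/subsetP => _ /imsetP[G /one[_ GN] ->].
have [rho [rho_lt rhoM]] := rankedK; rewrite h2 in rho_lt.
have rho1 A : A \in K -> A != set0 -> rho A = 1.
  move=> AK A0; have := rhoM _ _ K0 AK; rewrite properEneq sub0set eq_sym A0 => /(_ isT).
  by have := rho_lt _ AK; lia.
have antiN : antichain N.
  rewrite /N c2 => A1 A2 /setIdP[A1K /andP[_ /= A10]] /setIdP[A2K /andP[_ /= A20]] sA.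
  apply/eqP/contraT => neqA; have := rhoM A1 A2 A1K A2K.
  by rewrite properEneq neqA sA !rho1 // => /(_ isT).
apply: leq_trans (sperner antiN (X := X) _); last first.
  by move=> A /setIdP[_ /andP[]].
have [x [y [neq_xy le_xy allQ]]] : exists x y : Q,
    [/\ x != y, (x <= y)%O & forall z, z = x \/ z = y].
  have [C chC cC] := height_chain Q; rewrite h2 in cC.
  have /cards2P[x [y [neq_xy eC]]] : #|C| == 2 by rewrite cC.
  have CT : C = setT by apply/eqP; rewrite eqEcard subsetT cardsT c2 cC.
  have all z : z = x \/ z = y.
    have : z \in C by rewrite CT inE.
    by rewrite eC !inE => /orP[/eqP->|/eqP->]; [left | right].
  have xC : x \in C by rewrite CT inE.
  have yC : y \in C by rewrite CT inE.
  case/orP: (chC x y xC yC) => le_xy; first by exists x, y.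
  by exists y, x; split=> [|//|z]; [rewrite eq_sym | case: (all z); [right | left]].
have two G : G \in below Q K X -> G = [set set0; cover G] /\ cover G \in N.
  case/setIdP=> /setIdP[/subsetP sGK /is_copyP[phi [phiI phiG phiM]]] sGX.
  have phiK z : phi z \in K by apply: sGK; rewrite -phiG imset_f.
  have sxy := phiM _ _ le_xy.
  have neq : phi x != phi y by rewrite (inj_eq phiI).
  have y0 : phi y != set0.
    by apply: contraNneq neq => y0; move: sxy; rewrite y0 subset0.
  have x0 : phi x = set0.
    apply/eqP/contraT => x0; have := rhoM _ _ (phiK x) (phiK y).
    by rewrite properEneq neq sxy (rho1 _ (phiK x)) // (rho1 _ (phiK y)) // => /(_ isT).
  have eG : G = [set set0; phi y].
    rewrite -phiG; apply/setP => A; apply/imsetP/idP => [[z _ ->]|].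
      by rewrite !inE; case: (allQ z) => ->; rewrite ?x0 eqxx ?orbT.
    by rewrite !inE -x0 => /orP[/eqP->|/eqP->]; [exists x | exists y].
  have cG : cover G = phi y.
    by rewrite eG /cover bigcup_setU !big_set1 set0U.
  by rewrite cG eG; split=> //; rewrite inE phiK y0 -cG sGX orbT.
have fI : {in below Q K X &, injective (fun G => cover G)}.
  by move=> G1 G2 /two[e1 _] /two[e2 _] eqc; rewrite e1 e2 eqc.
rewrite -(card_in_imset fI); apply: subset_leq_card.
by apply/subsetP => _ /imsetP[G /two[_ GN] ->].
Qed.

Lemma avg_small (A : {set 'I_n}) i : i <= #|A| -> (avg Q K A i <= (midbin i)%:R)%R.
Proof.
move=> le_iA; rewrite avgE // ler_pdivrMr ?ltr0n ?bin_gt0 // -natrM ler_nat.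
rewrite -cards_draws mulnC -sum_nat_const.
rewrite [leqRHS](eq_bigl (fun X : {set 'I_n} => (X \subset A) && (#|X| == i))); last first.
  by move=> X; rewrite inE.
by apply: leq_sum => X /andP[_ /eqP <-]; apply: below_small.
Qed.

Lemma La_small j : 0 < j -> midbin j <= La j 'I_(height Q).+1 Q.
Proof.
move=> j_gt0; have [c1|[c2 h2 K0 eB]] := small_cases.
  apply: leq_trans (La_growth _ Q_gt0 (leq0n j)); rewrite subn0 leq_pmulr //.
  have h1 : 0 < height Q.
    have /card_gt0P[x _] := Q_gt0; rewrite -(cards1 x); apply: leq_height.
    by move=> y z; rewrite !inE => /eqP-> /eqP->; apply: comparablexx.
  have rk : ranked (height Q) [set (set0 : {set 'I_0})].
    exists (fun=> 0); split=> // A1 A2; rewrite !inE => /eqP-> /eqP->.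
    by rewrite properxx.
  apply: leq_trans (leq_La _ (ranked_free rk)).
  rewrite ncopiesE; apply/card_gt0P; exists [set set0]; rewrite inE subxx /=.
  have /cards1P[A eB] : #|B| == 1 by rewrite cardB c1.
  have -> : [set (set0 : {set 'I_0})] = (fun=> set0) @: B.
    by rewrite eB imset_set1.
  by apply: copy_imset cB => // A1 A2; rewrite eB !inE => /eqP-> /eqP->.
(* As large as the level j./2, but for j = 1 the latter would consist of the empty set. *)
pose L := level j (j - j./2).
have cL : #|L| = midbin j by rewrite card_level bin_sub //; lia.
have Lne (A : {set 'I_j}) : A \in L -> A != set0.
  by rewrite inE => /eqP cA; rewrite -card_gt0 cA; lia.
pose F := set0 |: L.
have rkF : ranked (height Q) F.
  rewrite h2; exists (fun A : {set 'I_j} => nat_of_bool (A != set0)); split.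
    by move=> A _; case: (_ != _).
  move=> A1 A2; rewrite !inE => /orP[/eqP->|A1L] /orP[/eqP->|A2L].
  - by rewrite properxx.
  - by rewrite eqxx Lne // inE.
  - by move/proper_sub; rewrite subset0 => /eqP A10; have := Lne A1; rewrite inE A1L A10 eqxx => /(_ isT).
  by move/proper_card; rewrite (eqP A1L) (eqP A2L) ltnn.
apply: leq_trans (leq_La _ (ranked_free rkF)); rewrite ncopiesE -cL.
pose g (A : {set 'I_j}) : {set {set 'I_j}} := [set set0; A].
have gI : {in L &, injective g}.
  move=> A1 A2 A1L A2L /setP/(_ A1); rewrite !inE eqxx orbT (negbTE (Lne _ A1L)) /=.
  by move/esym/eqP.
rewrite -(card_in_imset gI); apply: subset_leq_card.
apply/subsetP => _ /imsetP[A AL ->]; rewrite inE; apply/andP; split.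
  by apply/subsetP => _ /set2P[->|->]; [apply: setU11 | apply: setU1r].
have neq0 : set0 != cover B.
  have : #|B| = 2 by rewrite cardB.
  by rewrite {1}eB cards2; case: eqP.
pose f (C : {set 'I_n}) := if C == set0 then set0 else A.
have -> : g A = f @: B.
  by rewrite eB imsetU !imset_set1 /f eqxx eq_sym (negbTE neq0).
apply: copy_imset cB.
  move=> C1 C2; rewrite eB !inE /f => /orP[/eqP->|/eqP->] /orP[/eqP->|/eqP->] //;
  rewrite ?eqxx [cover B == _]eq_sym (negbTE neq0) => // e.
    by have := Lne _ AL; rewrite -e eqxx.
  by have := Lne _ AL; rewrite e eqxx.
move=> C1 C2 _ _ sC; rewrite /f; case: eqP => [|/eqP C10]; first by rewrite sub0set.
by case: eqP => // C20; move: sC; rewrite C20 subset0 (negbTE C10).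
Qed.

End SmallPoset.

(** * Upper bound for [oplus Q r] *)

Section OplusBound.
Variables (d : Order.disp_t) (Q : finPOrderType d) (n r : nat).
Hypothesis Q_gt0 : 0 < #|Q|.

Let w j := La j 'I_(height Q).+1 Q.

Lemma card_set_le (A : {set 'I_n}) : #|A| <= n.
Proof. by rewrite -[leqRHS]card_ord max_card. Qed.

(** The bound by y(i) <= w(i) alone, for the almost statement. *)
Lemma La_oplus_sum V : 0 < r ->
  (forall k, k <= n -> \sum_(i < k.+1) interbeta n r i k * w i <= V) ->
  La n 'I_(height Q).+2 (oplus Q r) <= V.
Proof.
move=> r_gt0 leV; apply/La_leP => F /free_ranked rkF.
have rkK := ranked_nonmaxl rkF; rewrite -(ler_nat rat).
apply: le_trans (ncopies_oplus_le r_gt0 rkF) _; apply: LYM_maxl => // A _.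
apply: le_trans (_ : ((\sum_(i < #|A|.+1) interbeta n r i #|A| * w i)%:R <= _)%R); last first.
  by rewrite ler_nat; apply/leV/card_set_le.
rewrite natr_sum; apply: ler_sum => i _; rewrite natrM; apply: ler_wpM2l => //.
by apply: (avg_le Q rkK); rewrite -ltnS.
Qed.

Lemma La_oplus_max V : 1 < r ->
  (forall i j, i < j -> j <= n -> interbeta n r i j * w j <= V) ->
  La n 'I_(height Q).+2 (oplus Q r) <= V.
Proof.
move=> r_gt1 leV; have r_gt0 := ltnW r_gt1; apply/La_leP => F /free_ranked rkF.
have rkK := ranked_nonmaxl rkF; rewrite -(ler_nat rat).
apply: le_trans (ncopies_oplus_le r_gt0 rkF) _; apply: LYM_maxl => // A _.
rewrite -/(lower F) in rkK *; set K := lower F in rkK *.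
have le_kn := card_set_le A; set k := #|A| in le_kn *.
have W_ge0 : (0 <= (w k)%:R :> rat)%R by [].
have maxV : ((maxinter n r k)%:R * (w k)%:R <= V%:R :> rat)%R.
  rewrite -natrM ler_nat; have [i + ->] := maxinter_witness n r k.
  rewrite leq_eqVlt => /predU1P[->|lt_ik]; last exact: leV.
  by rewrite interbeta_diag.
have y_mid i : i <= k -> (avg Q K A i * (midbin (k - i))%:R <= (w k)%:R)%R.
  move=> le_ik; apply: (@le_trans _ _ ((w i)%:R * (midbin (k - i))%:R)%R).
    by apply: ler_wpM2r => //; apply: (avg_le Q rkK).
  by rewrite -natrM ler_nat mulnC; apply: La_growth.
have [large|] := boolP (~~ ((r == 2) && (n <= 14))).
  exact: le_trans (sum_midbin_weight r_gt1 W_ge0 y_mid large le_kn) maxV.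
rewrite negbK => /andP[/eqP r2 le_n].
have [eq_kn|ne_kn] := eqVneq k n.
  have t0 x : x <= k -> interbeta n r x k = 0 by rewrite eq_kn; apply: interbeta_full.
  by rewrite big1 // => i _; rewrite t0 ?mul0r // -ltnS.
have lt_kn : k < n by rewrite ltn_neqAle ne_kn.
have [big|] := boolP [forall B in below Q K A, 2 <= #|cover B|].
  apply: le_trans maxV; apply: sum_weight2 => // i le_ik.
  apply: (@le_trans _ _ ('C(i, 2)%:R * avg Q K A #|A|)%R).
    by apply: avg_bin => // B BA; apply: (forall_inP big).
  by apply: ler_wpM2l => //; apply: (avg_le Q rkK).
case/forall_inPn => B BA; rewrite -ltnNge ltnS => sB.
have copyB : B \in copies Q K by move: BA; rewrite inE => /andP[].
apply: (@le_trans _ _ (\sum_(i < k.+1) interbeta n 2 i k * midbin i)%:R%R).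
  rewrite natr_sum r2; apply: ler_sum => i _; rewrite natrM; apply: ler_wpM2l => //.
  by apply: (avg_small Q_gt0 rkK copyB sB); rewrite -ltnS.
rewrite ler_nat; apply: sum_weight1 => // i j; rewrite leq_eqVlt => /predU1P[->|lt_ij] lt_jn.
  by rewrite interbeta_diag.
rewrite -r2; apply: leq_trans (leV i j lt_ij (ltnW lt_jn)).
rewrite leq_mul2l; apply/orP; right; apply: (La_small Q_gt0 rkK copyB sB).
exact: leq_trans lt_ij.
Qed.

Lemma La_oplus_ex : 1 < r -> exists2 i : nat, i <= n &
  La n 'I_(height Q).+2 (oplus Q r) <=
    \max_(0 <= j < n.+1) ('C(n, i) * beta0 r (level (n - i) (j - i)) * w j).
Proof.
move=> r_gt1.
pose f (i : 'I_n.+1) := \max_(0 <= j < n.+1) ('C(n, i) * beta0 r (level (n - i) (j - i)) * w j).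
have n0 : 0 < #|'I_n.+1| by rewrite card_ord.
have [i eqi] := bigop.eq_bigmax f n0.
exists i; first by rewrite -ltnS.
rewrite -/(f i) -eqi; apply: La_oplus_max => // i' j lt_ij le_jn.
have lt_i : i' < n.+1 by rewrite ltnS; lia.
apply: leq_trans (bigop.leq_bigmax (F := f) (Ordinal lt_i)); rewrite /f /= big_mkord.
pose g (x : 'I_n.+1) := 'C(n, i') * beta0 r (level (n - i') (x - i')) * w x.
exact: (bigop.leq_bigmax (F := g) (Ordinal (le_jn : j < n.+1))).
Qed.

End OplusBound.

(** * Unions of full levels *)

(** Unlike a subset of ['I_n.+1], a predicate on sizes can be carried from one ground set to
    another. *)
Definition lev (n : nat) (p : pred nat) : {set {set 'I_n}} :=
  [set A : {set 'I_n} | p #|A|].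

Section Levels.
Variables (n h : nat).
Implicit Type p : pred nat.

Lemma full_levelsP (F : {set {set 'I_n}}) :
  full_levels F <-> exists p, F = lev n p.
Proof.
split=> [[K ->]|[p ->]].
  exists (fun k => [exists x in K, (x : nat) == k]); apply/setP => A; rewrite inE.
  apply/bigcupP/existsP => [[k kK]|[k /andP[kK /eqP ek]]].
    by rewrite inE => /eqP ek; exists k; rewrite kK ek eqxx.
  by exists k => //; rewrite inE ek.
exists [set k : 'I_n.+1 | p k]; apply/setP => A; rewrite inE; apply/idP/bigcupP.
  have lt_A : #|A| < n.+1 by rewrite ltnS card_set_le.
  by move=> pA; exists (Ordinal lt_A); rewrite inE.
by case=> k; rewrite !inE => pk /eqP ->.
Qed.

Lemma count_iota_lt p i j : i < j -> p i -> count p (iota 0 i) < count p (iota 0 j).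
Proof.
move=> lt_ij pi; have -> : j = i + (j - i) by lia.
rewrite iotaD count_cat add0n; have -> : j - i = (j - i).-1.+1 by lia.
by rewrite /= pi; lia.
Qed.

Lemma lev_ranked p : count p (iota 0 n.+1) <= h -> ranked h (lev n p).
Proof.
move=> le_h; exists (fun A : {set 'I_n} => count p (iota 0 #|A|)); split=> [A|A B].
  rewrite inE => pA; apply: leq_trans le_h; apply: count_iota_lt => //.
  by rewrite ltnS card_set_le.
by rewrite !inE => pA _ /proper_card lt_AB; apply: count_iota_lt.
Qed.

(** The initial segments whose sizes satisfy [p] form a chain, on which the rank is injective. *)
Lemma ranked_lev p : ranked h (lev n p) -> count p (iota 0 n.+1) <= h.
Proof.
case=> rho [rho_lt rhoM]; pose I k := [set x : 'I_n | x < k].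
have cI k : k <= n -> #|I k| = k.
  move=> le_kn; have fI : injective (widen_ord le_kn) by move=> x y /(congr1 val) /= /val_inj.
  have -> : I k = (widen_ord le_kn) @: setT.
    apply/setP => x; rewrite inE; apply/idP/imsetP => [lt_xk|[y _ ->]]; last first.
      by rewrite /= ltn_ord.
    by exists (Ordinal lt_xk) => //; apply/val_inj.
  by rewrite card_imset // cardsT card_ord.
have inL k : k <= n -> p k -> I k \in lev n p by move=> le_kn pk; rewrite inE cI.
have mono k l : k < l -> l <= n -> p k -> p l -> rho (I k) < rho (I l).
  move=> lt_kl le_ln pk pl; apply: rhoM; [apply: inL => //; lia | exact: inL |].
  rewrite properEcard !cI //; last by lia.
  rewrite lt_kl andbT; apply/subsetP => x; rewrite !inE; lia.
rewrite -size_filter -(size_map (fun k => rho (I k))) -[leqRHS](size_iota 0).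
apply: uniq_leq_size.
  rewrite map_inj_in_uniq ?filter_uniq ?iota_uniq // => k l.
  rewrite !mem_filter !mem_iota => /andP[pk /andP[_ lk]] /andP[pl /andP[_ ll]] e.
  case: (ltngtP k l) => // lt_kl.
    by have := mono k l lt_kl ltac:(lia) pk pl; rewrite e ltnn.
  by have := mono l k lt_kl ltac:(lia) pl pk; rewrite e ltnn.
move=> x /mapP[k]; rewrite mem_filter mem_iota => /andP[pk /andP[_ lk]] ->.
by rewrite mem_iota /= add0n; apply: rho_lt; apply: inL => //; lia.
Qed.

(** On the ground set [m], [p] is controlled up to m only, hence the cut before the level j is
    added. *)
Definition addlev m p j : pred nat := fun k => p k && (k <= m) || (k == j).

Lemma count_addlev m p j : m <= n -> count p (iota 0 m.+1) <= h ->
  count (addlev m p j) (iota 0 n.+1) <= h.+1.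
Proof.
move=> le_mn le_h.
have := count_predUI (fun k => p k && (k <= m)) (pred1 j) (iota 0 n.+1).
have : count (pred1 j) (iota 0 n.+1) <= 1.
  by rewrite count_uniq_mem ?iota_uniq //; case: (_ \in _).
have -> : count (fun k => p k && (k <= m)) (iota 0 n.+1) = count p (iota 0 m.+1).
  have -> : n.+1 = m.+1 + (n - m) by lia.
  rewrite iotaD count_cat [X in _ + X](_ : _ = 0) ?addn0.
    by apply: eq_in_count => k; rewrite mem_iota add0n ltnS => /andP[_ ->]; rewrite andbT.
  apply/eqP; rewrite eqn0Ngt -has_count; apply/hasPn => k; rewrite mem_iota.
  by move=> /andP[lt_mk _]; rewrite negb_and -ltnNge; apply/orP; right; lia.
have -> : count (addlev m p j) (iota 0 n.+1) =
          count (predU (fun k => p k && (k <= m)) (pred1 j)) (iota 0 n.+1).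
  exact: eq_count.
move=> le1 eqU; apply: (@leq_trans (count p (iota 0 m.+1) + count (pred1 j) (iota 0 n.+1))).
  by rewrite -eqU leq_addr.
by rewrite -[h.+1]addn1 leq_add.
Qed.

End Levels.

Section LevelCopies.
Variables (d : Order.disp_t) (Q : finPOrderType d) (n : nat).
Implicit Types (p : pred nat).

Lemma ncopies_below m p (X : {set 'I_n}) : m <= #|X| ->
  ncopies Q (lev m p) <= #|below Q (lev n (fun k => p k && (k <= m))) X|.
Proof.
set K := lev n _ => le_mX.
pose f (i : 'I_m) : 'I_n := enum_val (widen_ord le_mX i).
have fI : injective f by move=> i j /enum_val_inj/(congr1 val)/= /val_inj.
have fX (A : {set 'I_m}) : f @: A \subset X.
  by apply/subsetP => _ /imsetP[i _ ->]; apply: enum_valP.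
pose KX := [set C in K | C \subset X].
have -> : #|below Q K X| = ncopies Q KX.
  rewrite ncopiesE; apply: eq_card => B; rewrite !inE andbAC; congr (_ && _).
  apply/andP/subsetP => [[/subsetP sB /cover_subP sA] C CB|sB].
    by rewrite inE sB // sA.
  split; first by apply/subsetP => C /sB; rewrite inE => /andP[].
  by apply/cover_subP => C /sB; rewrite inE => /andP[].
apply: (leq_ncopies_inj _ fI) => A; rewrite !inE fX andbT card_imset // => ->.
by rewrite -[leqRHS]card_ord max_card.
Qed.

Section Oplus.
Variables (r m j : nat) (p : pred nat).
Hypothesis lt_pj : forall k, k <= m -> p k -> k < j.

Let K := lev n (fun k => p k && (k <= m)).

Lemma oplus_lev_tops :
  \sum_(B in copies Q K) 'C(#|tops (level n j) B|, r) <=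
  ncopies (oplus Q r) (lev n (addlev m p j)).
Proof.
have -> : lev n (addlev m p j) = K :|: level n j.
  by apply/setP => A; rewrite !inE.
apply: copies_oplus_ge; rewrite disjoint_subset; apply/subsetP => A; rewrite !inE.
by move=> /andP[pA le_A]; rewrite neq_ltn lt_pj.
Qed.

(** An r-set of level j whose intersection has i >= m points can be placed on top of every copy of Q
    inside that intersection, and these are at least as many as the copies on [m]. *)
Lemma oplus_lev_inter i : 0 < r -> m <= i -> i <= j ->
  interbeta n r i j * ncopies Q (lev m p) <=
  ncopies (oplus Q r) (lev n (addlev m p j)).
Proof.
move=> r_gt0 le_mi le_ij; apply: leq_trans oplus_lev_tops.
rewrite /interbeta -(card_interE _ r_gt0 le_ij) -sum_nat_const.
apply: (@leq_trans (\sum_(S in tdraws n j r) #|below Q K (inter S)|)).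
  rewrite [leqRHS](bigID (fun S => #|inter S| == i)) /= [leqRHS]addnC.
  apply: leq_trans (leq_addl _ _).
  rewrite [leqRHS](eq_bigl (fun S => S \in [set S in tdraws n j r | #|inter S| == i])).
    by apply: leq_sum => S /setIdP[_ /eqP cS]; apply: ncopies_below; rewrite cS.
  by move=> S; rewrite [RHS]inE.
rewrite (eq_bigr (fun S => \sum_(B in copies Q K | cover B \subset inter S) 1)); last first.
  by move=> S _; rewrite -sum1_card; apply: eq_bigl => B; rewrite [LHS]inE.
rewrite (exchange_big_dep (mem (copies Q K))) /=; last by move=> S B _ /andP[].
apply: leq_sum => B BK; rewrite sum1_card -cards_draws; apply: subset_leq_card.
apply/subsetP => S; rewrite unfold_in /= BK /= => /andP[]; rewrite !inE => /andP[/subsetP sS ->] sB.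
rewrite andbT; apply/subsetP => A AS; rewrite inE sS //=.
exact: subset_trans sB (inter_sub AS).
Qed.

(** One fixed m-set X suffices: any r of the j-sets containing X can be placed on top of any copy
    inside X. *)
Lemma oplus_lev_sup : m <= j -> j <= n ->
  ncopies Q (lev m p) * 'C('C(n - m, j - m), r) <=
  ncopies (oplus Q r) (lev n (addlev m p j)).
Proof.
move=> le_mj le_jn; apply: leq_trans oplus_lev_tops.
have [X cX] : exists X : {set 'I_n}, #|X| = m.
  have : 0 < #|level n m| by rewrite card_level bin_gt0 (leq_trans le_mj).
  by case/card_gt0P => X; rewrite inE => /eqP; exists X.
apply: (@leq_trans (\sum_(B in below Q K X) 'C(#|tops (level n j) B|, r))).
  apply: leq_trans (_ : #|below Q K X| * 'C('C(n - m, j - m), r) <= _).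
    by rewrite leq_mul2r ncopies_below ?orbT // cX.
  rewrite -sum_nat_const; apply: leq_sum => B /setIdP[_ sBX].
  apply: leq_bin2l; rewrite -cX -card_level_sup ?cX //; apply: subset_leq_card.
  by apply/subsetP => A /setIdP[AL sXA]; rewrite inE AL (subset_trans sBX).
rewrite [leqRHS](bigID (fun B => cover B \subset X)) /=.
rewrite [X in _ <= X + _](eq_bigl (fun B => B \in below Q K X)) ?leq_addr // => B.
by rewrite [RHS]inE.
Qed.

End Oplus.

Lemma oplus1_lev m j p : (forall k, k <= m -> p k -> k < j) -> m <= j ->
  'C(n, j) * ncopies Q (lev m p) <= ncopies (oplus Q 1) (lev n (addlev m p j)).
Proof.
move=> lt_pj le_mj; apply: leq_trans (oplus_lev_tops _ lt_pj).
set K := lev n _; rewrite -card_level -sum_nat_const.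
apply: (@leq_trans (\sum_(A in level n j) #|below Q K A|)).
  by apply: leq_sum => A; rewrite inE => /eqP cA; apply: ncopies_below; rewrite cA.
rewrite (eq_bigr (fun A : {set 'I_n} => \sum_(B in copies Q K | cover B \subset A) 1)); last first.
  by move=> A _; rewrite -sum1_card; apply: eq_bigl => B; rewrite [LHS]inE.
rewrite (exchange_big_dep (mem (copies Q K))) /=; last by move=> A B _ /andP[].
apply: leq_sum => B BK; rewrite bin1 sum1_card; apply: subset_leq_card.
by apply/subsetP => A; rewrite unfold_in /= BK /= !inE.
Qed.

End LevelCopies.

(** * The almost statement for r at least 2 *)

Lemma lev0 n : lev n pred0 = set0.
Proof. by apply/setP => A; rewrite !inE. Qed.

(** The definition asks for the families as a function of n; an arg max over the finitely many
    admissible ones yields it without a choice principle. *)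
Lemma almostI (d d' : Order.disp_t) (P : finPOrderType d) (Q : finPOrderType d') :
  0 < #|P| ->
  (exists k C n0, forall n, n0 <= n -> exists2 F : {set {set 'I_n}},
     full_levels F /\ poset_free P F & La n P Q <= C * (n ^ k * ncopies Q F)) ->
  level_conj_almost P Q.
Proof.
move=> P_gt0 [k [C [n0 bound]]].
pose good n := [pred F : {set {set 'I_n}} | poset_free P F &&
  [exists K : {set 'I_n.+1}, F == \bigcup_(k in K) level n k]].
have goodP n (F : {set {set 'I_n}}) :
    reflect (full_levels F /\ poset_free P F) (good n F).
  rewrite /good /=; apply: (iffP andP) => [[freeF /existsP[K /eqP eF]]|[[K eF] freeF]].
    by split; [exists K | exact: freeF].
  by split=> //; apply/existsP; exists K; rewrite eF.
have good0 n : good n (lev n pred0).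
  apply/goodP; split; first by apply/full_levelsP; exists pred0.
  rewrite lev0 /poset_free ncopiesE cards_eq0; apply/eqP/setP => G; rewrite !inE subset0.
  apply/negP => /andP[/eqP-> /card_copy]; rewrite cards0 => P0.
  by rewrite -P0 in P_gt0.
exists k, (fun n => [arg max_(F > lev n pred0 | good n F) ncopies Q F]); split.
  by move=> n; case: (arg_maxnP (fun F : {set {set 'I_n}} => ncopies Q F) (good0 n)) => F /goodP.
exists C, n0 => n le_n; have [F /goodP gF] := bound n le_n.
case: (arg_maxnP (fun F : {set {set 'I_n}} => ncopies Q F) (good0 n)) => F' _ /(_ F gF) maxF' /leq_trans; apply.
by rewrite !leq_mul2l (maxF' : ncopies Q F <= ncopies Q F') !orbT.
Qed.

Lemma almostE (d : Order.disp_t) (Q : finPOrderType d) h :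
  level_conj_almost 'I_h.+1 Q -> exists k C n0, forall n, n0 <= n ->
    exists2 p, count p (iota 0 n.+1) <= h &
    La n 'I_h.+1 Q <= C * (n ^ k * ncopies Q (lev n p)).
Proof.
case=> k [F [goodF [C [n0 bound]]]]; exists k, C, n0 => n le_n.
have [/full_levelsP[p eF] freeF] := goodF n; exists p.
  by apply: ranked_lev; rewrite -eF; apply: free_ranked.
by rewrite -eF; apply: bound.
Qed.

Lemma midbinS_le n : midbin n.+1 <= 2 * midbin n.
Proof.
rewrite {1}/midbin; case: (n.+1./2) => [|m]; first by rewrite bin0 muln_gt0 midbin_gt0.
by rewrite binS mul2n -addnn leq_add ?leq_bin_half.
Qed.

Lemma midbinD_le m n : midbin (m + n) <= 2 ^ m * midbin n.
Proof.
elim: m => [|m IHm]; first by rewrite mul1n.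
by apply: leq_trans (midbinS_le _) _; rewrite expnS -mulnA leq_mul2l IHm.
Qed.

Lemma leq_midbin n : n <= midbin n.
Proof. by rewrite -{1}(bin1 n) leq_bin_half. Qed.

Lemma bin_scale c n r : r <= n -> 'C(c * n, r) <= (c * r) ^ r * 'C(n, r).
Proof.
move=> le_rn; rewrite -(leq_pmul2r (fact_gt0 r)) -mulnA !bin_ffact expnMn.
have expE x : x ^ r = \prod_(i < r) x by rewrite prod_nat_const card_ord.
have le_prod : n ^ r * r`! <= r ^ r * n ^_ r.
  rewrite -ffactnn !ffact_prod !expE -!big_split /=.
  by apply: leq_prod => i _; nia.
apply: (@leq_trans ((c * n) ^ r)).
  by rewrite ffact_prod expE; apply: leq_prod => i _; apply: leq_subr.
rewrite expnMn -mulnA leq_mul2l; apply/orP; right.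
by apply: leq_trans le_prod; rewrite leq_pmulr // fact_gt0.
Qed.

Section Almost.
Variables (d : Order.disp_t) (Q : finPOrderType d).
Hypothesis Q_gt0 : 0 < #|Q|.

Let h := height Q.
Let w j := La j 'I_h.+1 Q.

Lemma addlev_good n m p j : m <= n -> count p (iota 0 m.+1) <= h ->
  full_levels (lev n (addlev m p j)) /\ poset_free 'I_h.+2 (lev n (addlev m p j)).
Proof.
move=> le_mn le_h; split; first by apply/full_levelsP; exists (addlev m p j).
by apply: ranked_free; apply: lev_ranked; apply: count_addlev.
Qed.

Lemma interbeta_le n r i k : 0 < r -> i <= k -> interbeta n r i k <= 'C(midbin n, r).
Proof.
move=> r_gt0 le_ik; have := sum_inter_bin n r_gt0 (leq0n k); rewrite bin0 mul1n !subn0 => E.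
apply: leq_trans (leq_bin2l _ (leq_bin_half n k)); rewrite -E.
rewrite (bigD1 (Ordinal (le_ik : i < k.+1))) //= bin0 muln1; exact: leq_addr.
Qed.

Lemma almost_oplus r : 1 < r -> level_conj_almost 'I_h.+1 Q ->
  level_conj_almost 'I_h.+2 (oplus Q r).
Proof.
move=> r_gt1 /almostE[k0 [C0 [n0 bound]]]; apply: almostI; first by rewrite card_ord.
have r_gt0 := ltnW r_gt1.
pose c1 := C0 + w n0 * (2 ^ n0 * r) ^ r.
exists k0.+1, (2 * c1), (n0 + r + 2) => n le_n.
have n_gt0 : 0 < n by lia.
pose R := oplus Q r.
pose good (F : {set {set 'I_n}}) := full_levels F /\ poset_free 'I_h.+2 F.
have step i j : i < j -> j <= n -> exists2 F, good F &
    interbeta n r i j * w i <= c1 * (n ^ k0 * ncopies R F).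
  move=> lt_ij le_jn; have [le_n0i|lt_in0] := leqP n0 i.
    have [p le_p bp] := bound i le_n0i.
    exists (lev n (addlev i p j)); first by apply: addlev_good => //; lia.
    have le_c := @oplus_lev_inter _ Q n r i j p _ i r_gt0 (leqnn i) (ltnW lt_ij).
    have {}le_c := le_c (fun k le_k _ => leq_ltn_trans le_k lt_ij).
    apply: (@leq_trans (interbeta n r i j * (C0 * (n ^ k0 * ncopies Q (lev i p))))).
      rewrite leq_mul2l; apply/orP; right; apply: leq_trans bp _.
      rewrite leq_mul2l leq_mul2r; apply/orP; right; apply/orP; right.
      by case: (k0) => // k1; rewrite leq_exp2r // (leq_trans (ltnW lt_ij)).
    have -> : interbeta n r i j * (C0 * (n ^ k0 * ncopies Q (lev i p))) =
              C0 * (n ^ k0 * (interbeta n r i j * ncopies Q (lev i p))) by ring.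
    by apply: leq_mul; [apply: leq_addr | rewrite leq_mul2l le_c orbT].
  have [p le_p bp] := bound n0 (leqnn n0).
  pose j' := n0 + (n - n0)./2.
  exists (lev n (addlev n0 p j')); first by apply: addlev_good => //; lia.
  have le_w : w i <= w n0 by apply: La_mono => //; apply: ltnW.
  have [w0|w_gt0] := posnP (w n0); first by move: le_w; rewrite w0 leqn0 => /eqP->; rewrite muln0.
  have c_gt0 : 0 < ncopies Q (lev n0 p).
    rewrite lt0n; apply: contraTneq w_gt0 => c0; rewrite -leqNgt.
    by move: bp; rewrite c0 !muln0.
  have le_c := @oplus_lev_sup _ Q n r n0 j' p.
  have {}le_c : 'C(midbin (n - n0), r) <= ncopies R (lev n (addlev n0 p j')).
    apply: leq_trans (le_c _ _ _); [|by move=> k le_k _; rewrite /j'; lia|by rewrite /j'; lia|by rewrite /j'; lia].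
    by rewrite /j' addKn leq_pmull.
  have le_t : interbeta n r i j <= (2 ^ n0 * r) ^ r * 'C(midbin (n - n0), r).
    apply: leq_trans (interbeta_le n r_gt0 (ltnW lt_ij)) _.
    apply: leq_trans (bin_scale _ (_ : r <= midbin (n - n0))); last first.
      by apply: leq_trans (leq_midbin _); lia.
    apply: leq_bin2l; have {1}-> : n = n0 + (n - n0) by lia.
    exact: midbinD_le.
  apply: leq_trans (leq_mul le_t le_w) _.
  have -> : (2 ^ n0 * r) ^ r * 'C(midbin (n - n0), r) * w n0 =
    (w n0 * (2 ^ n0 * r) ^ r) * (1 * 'C(midbin (n - n0), r)) by ring.
  apply: leq_mul; first exact: leq_addl.
  by apply: leq_mul => //; rewrite expn_gt0 n_gt0.
pose g (x : 'I_n.+1 * 'I_n.+1) := interbeta n r x.1 x.2 * w x.1.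
have n1 : 0 < #|[pred x : 'I_n.+1 * 'I_n.+1 | x.1 < x.2]|.
  by apply/card_gt0P; exists (ord0, ord_max).
have [[i j] /= lt_ij eqg] := bigop.eq_bigmax_cond g n1.
have [F goodF leF] := step i j lt_ij (ltn_ord j : j <= n).
(* At most n + 1 intersection sizes, each bounded through the best pair (i, j), cost one further
   power of n. *)
exists F => //; apply: (@leq_trans (n.+1 * (c1 * (n ^ k0 * ncopies R F)))); last first.
  have : n.+1 <= 2 * n by lia.
  move/leq_mul/(_ (leqnn (c1 * (n ^ k0 * ncopies R F))))/leq_trans; apply.
  by rewrite expnS; apply: eq_leq; ring.
apply: La_oplus_sum => // k le_kn.
apply: (@leq_trans (\sum_(i' < k.+1) c1 * (n ^ k0 * ncopies R F))).
  apply: leq_sum => i' _; have le_ik : i' <= k by rewrite -ltnS.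
  move: le_ik; rewrite leq_eqVlt => /predU1P[->|lt_ik]; first by rewrite interbeta_diag.
  apply: leq_trans leF; rewrite -[leqRHS]/(g (i, j)) -eqg.
  have lt_i : i' < n.+1 by lia.
  exact: (bigop.leq_bigmax_cond (F := g) (Ordinal lt_i, Ordinal (le_kn : k < n.+1)) lt_ik).
by rewrite sum_nat_const card_ord leq_mul2r ltnS le_kn orbT.
Qed.
End Almost.

(** * Compression along a gap *)

Section Compression.
Variables (T : finType) (X : {set T}) (r : T) (P : pred {set T}).
Implicit Types (A B Y : {set T}).
Hypothesis rX : r \in X.
Hypothesis P_mono : forall A B, A \subset B -> P A -> P B.
Hypothesis P_loc : forall A, P (A :&: X) = P A.
Hypothesis P_X : P X.
Hypothesis P_0 : P set0 = false.

Definition firsts m Y := [set x in take m (enum Y)].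

Lemma firsts_sub m Y : firsts m Y \subset Y.
Proof. by apply/subsetP => x; rewrite inE => /mem_take; rewrite mem_enum. Qed.

Lemma card_firsts m Y : m <= #|Y| -> #|firsts m Y| = m.
Proof.
move=> le_m; rewrite cardsE (card_uniqP _) ?take_uniq ?enum_uniq //.
by rewrite size_take -cardE; case: ltngtP le_m.
Qed.

Lemma firsts_mono m p Y : m <= p -> firsts m Y \subset firsts p Y.
Proof.
move=> le_mp; apply/subsetP => x.
by rewrite !inE -(take_takel _ le_mp) => /mem_take.
Qed.

(* Rearranges the elements of A inside X, keeping their number, so that r
   belongs to the result exactly when P holds; monotone because P is. *)
Definition compress A :=
  (A :\: X) :|:
  (if P A then r |: firsts #|A :&: X|.-1 (X :\ r) else firsts #|A :&: X| (X :\ r)).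

Let inner A :=
  if P A then r |: firsts #|A :&: X|.-1 (X :\ r) else firsts #|A :&: X| (X :\ r).

Let innerX A : inner A \subset X.
Proof.
have sub m : firsts m (X :\ r) \subset X := subset_trans (firsts_sub _ _) (subD1set _ _).
by rewrite /inner; case: ifP => _; rewrite ?subUset ?sub1set ?rX sub.
Qed.

Lemma compressD A : compress A :\: X = A :\: X.
Proof.
rewrite /compress -/(inner A) setDUl; have := innerX A; rewrite -setD_eq0 => /eqP->.
by rewrite setU0 setDDl setUid.
Qed.

Lemma compressP A : (r \in compress A) = P A.
Proof.
have notin m : r \notin firsts m (X :\ r).
  by apply/negP => /(subsetP (firsts_sub _ _)); rewrite !inE eqxx.
rewrite /compress !inE rX /=; case: ifP => PA; first by rewrite setU11.
by apply: negbTE.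
Qed.

Lemma cardX1 : #|X| = #|X :\ r|.+1.
Proof. by rewrite (cardsD1 r X) rX. Qed.

(** [P_0] ensures that there is a point to give up when r must enter, and [P_X] that there is room
    besides r when it must stay out. *)
Lemma card_inner A : #|inner A| = #|A :&: X|.
Proof.
have le_c : #|A :&: X| <= #|X :\ r|.+1 by rewrite -cardX1 subset_leq_card ?subsetIr.
rewrite /inner; case: ifP => PA.
  have c_gt0 : 0 < #|A :&: X|.
    by rewrite lt0n cards_eq0; apply: contraTneq PA => e0; rewrite -P_loc e0 P_0.
  have notin m : r \notin firsts m (X :\ r).
    by apply/negP => /(subsetP (firsts_sub _ _)); rewrite !inE eqxx.
  by rewrite cardsU1 notin card_firsts; lia.
rewrite card_firsts //; move: le_c; rewrite leq_eqVlt ltnS => /predU1P[eqc|//].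
have /eqP eX : A :&: X == X by rewrite eqEcard subsetIr eqc cardX1 /=.
by rewrite -P_loc eX P_X in PA.
Qed.

Lemma card_compress A : #|compress A| = #|A|.
Proof.
have dX : (A :\: X) :&: inner A = set0.
  apply/setP => x; rewrite !inE; apply/negP => /andP[/andP[xX _]].
  by move/(subsetP (innerX A)); rewrite (negbTE xX).
by rewrite /compress -/(inner A) cardsU card_inner dX cards0 subn0 addnC cardsID.
Qed.

Lemma compress_mono A B : A \subset B -> compress A \subset compress B.
Proof.
move=> sAB; rewrite /compress setUSS ?setSD //.
have le_c : #|A :&: X| <= #|B :&: X| by rewrite subset_leq_card ?setSI.
case: ifP => PA; first by rewrite (P_mono sAB PA) setUS ?firsts_mono //; lia.
case: ifP => PB; last exact: firsts_mono.
(* P holds for B but not for A, so by [P_loc] their traces on X differ; the larger trace of B has a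
   point to spare for r. *)
apply: subset_trans (subsetUr _ _); apply: firsts_mono.
suff: #|A :&: X| != #|B :&: X| by lia.
apply: contraFneq PA => eqc; rewrite -P_loc.
have /eqP -> : A :&: X == B :&: X by rewrite eqEcard setSI ?eqc /=.
by rewrite P_loc.
Qed.

(** Compression acts only inside X, so A is recovered from its image and its trace on X. *)
Lemma card_compress_preim (G : {set {set T}}) :
  #|[set A | compress A \in G]| <= #|G| * 2 ^ #|X|.
Proof.
rewrite -card_powerset -cardsX.
have fI : {in [set A | compress A \in G] &, injective (fun A => (compress A, A :&: X))}.
  move=> A B _ _ [eqc eqi].
  by rewrite -(setID A X) -(setID B X) eqi -compressD eqc compressD.
rewrite -(card_in_imset fI); apply: subset_leq_card.
apply/subsetP => _ /imsetP[A + ->]; rewrite !inE => -> /=; exact: subsetIr.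
Qed.

End Compression.

Section Gap.
Variables (n h : nat) (p : pred nat).
Hypothesis le_h : count p (iota 0 n.+1) <= h.

(** Pigeonhole: of h + 1 disjoint windows of length n / (h + 1), one contains none of the at most h
    sizes. *)
Lemma gap_ex : exists2 kap, kap + n %/ h.+1 <= n &
  forall k, k <= n -> p k -> k <= kap \/ kap + n %/ h.+1 < k.
Proof.
set g := n %/ h.+1.
have le_g : h.+1 * g <= n by rewrite mulnC leq_divM.
have [/hasP[t]|noT] := boolP (has (fun t => ~~ has p (iota (t * g).+1 g)) (iota 0 h.+1)).
  rewrite mem_iota add0n => /andP[_ lt_t] nop; exists (t * g).
    by apply: leq_trans le_g; rewrite -mulSnr leq_mul2r lt_t orbT.
  move=> k le_kn pk; have [|lt_k] := leqP k (t * g); [by left | right].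
  rewrite ltnNge; apply: contra nop => le_k; apply/hasP; exists k => //.
  by rewrite mem_iota; lia.
have le_cnt m : m <= h.+1 -> m <= count p (iota 1 (m * g)).
  elim: m => [//|m IHm] lt_m; rewrite mulSnr iotaD count_cat add1n -addn1.
  apply: leq_add; first by apply: IHm; apply: ltnW.
  rewrite -has_count; move/hasPn: noT => /(_ m); rewrite mem_iota add0n => /(_ lt_m).
  by rewrite negbK.
have := le_cnt h.+1 (leqnn _); rewrite leqNgt => /negP[]; rewrite ltnS; apply: leq_trans le_h.
have -> : n.+1 = 1 + (h.+1 * g + (n - h.+1 * g)) by lia.
by rewrite iotaD count_cat iotaD count_cat addnCA leq_addr.
Qed.

End Gap.

Lemma leq_card_family (I J : finType) (Z : I -> {set J}) c :
  (forall i, c <= #|Z i|) -> c ^ #|I| <= #|family (fun i => mem (Z i))|.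
Proof.
move=> le_c; rewrite card_family [X in _ ^ X]cardE.
rewrite -[[seq _ | x : I]]/(map (fun i => #|mem (Z i)|) (enum I)).
elim: (enum I) => [|i s IHs]; first by rewrite expn0.
rewrite [size _]/= expnS /=; apply: leq_mul IHs; exact: le_c.
Qed.

Lemma card_ffun_at (I J : finType) (i0 : I) (S : {set J}) :
  #|[set f : {ffun I -> J} | f i0 \in S]| * #|J| <= #|S| * #|J| ^ #|I|.
Proof.
rewrite -card_ffun -!cardsT -!cardsX.
pose g (u : {ffun I -> J} * J) : J * {ffun I -> J} :=
  (u.1 i0, [ffun i => if i == i0 then u.2 else u.1 i]).
have gI : injective g.
  move=> [f1 x1] [f2 x2] /= [e1 /ffunP e2]; congr (_, _).
    apply/ffunP => i; have := e2 i; rewrite !ffunE.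
    by have [->|] := eqVneq i i0.
  by have := e2 i0; rewrite !ffunE eqxx.
rewrite -(card_imset _ gI); apply: subset_leq_card.
by apply/subsetP => _ /imsetP[[f x] + ->]; rewrite !inE /= => /andP[-> _].
Qed.

Lemma leq_card_fibres (I J : finType) (X : {set I}) (Y : {set J}) (f : I -> J) m :
  (forall x, x \in X -> f x \in Y) ->
  (forall y, y \in Y -> #|[set x in X | f x == y]| <= m) -> #|X| <= #|Y| * m.
Proof.
move=> fXY fib; rewrite -sum1_card (partition_big f (mem Y)) //= -sum_nat_const.
apply: leq_sum => y yY; apply: leq_trans (fib y yY).
by rewrite -sum1_card; apply: eq_leq; apply: eq_bigl => x; rewrite [RHS]inE.
Qed.

(* Let kap, kap + g be the ends of a gap of p.  A copy G of Q splits into the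
   members larger than kap and the others, and at least g points lie in a given
   large member but not in a given small one.  Compressing G at one such point
   for each pair gives a copy in which some x belongs to the large members only;
   removing x leaves a ranked family on n' points. *)
Section Ratio.
Variables (d : Order.disp_t) (Q : finPOrderType d) (n' h : nat) (p : pred nat) (kap g : nat).
Let n := n'.+1.
Let q := #|Q|.
Hypothesis Q_gt0 : 0 < #|Q|.
Hypothesis le_h : count p (iota 0 n.+1) <= h.
Hypothesis le_kg : kap + g <= n.
Hypothesis g_gt0 : 0 < g.
Hypothesis gap : forall k, k <= n -> p k -> k <= kap \/ kap + g < k.

Let F := lev n p.
Implicit Types (G : {set {set 'I_n}}) (A B : {set 'I_n}) (H : {set 'I_q}).

Definition member G (i : 'I_q) : {set 'I_n} := nth set0 (enum G) i.

Lemma member_in G i : #|G| = q -> member G i \in G.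
Proof. by move=> cG; rewrite -mem_enum mem_nth // -cardE cG. Qed.

Lemma member_surj G A : #|G| = q -> A \in G -> exists i, A = member G i.
Proof.
move=> cG AG; have lt_i : index A (enum G) < q by rewrite -cG cardE index_mem mem_enum.
by exists (Ordinal lt_i); rewrite /member nth_index // mem_enum.
Qed.

Definition idx : finType := (option 'I_q * option 'I_q)%type.
Implicit Types (t : {ffun idx -> 'I_n}) (x : 'I_n).

Definition highs G : {set 'I_q} := [set i | kap < #|member G i|].

(* [None] stands for the ground set among the high members, and for the empty set
   among the low ones. *)
Definition okH H (o : option 'I_q) := if o is Some i then i \in H else true.
Definition okL H (o : option 'I_q) := if o is Some i then i \notin H else true.
Definition himember G (o : option 'I_q) := if o is Some i then member G i else setT.
Definition lomember G (o : option 'I_q) := if o is Some i then member G i else set0.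

(** One point from each nonempty difference of two members. Kept out of the block, these points are
    not moved, so different members stay different. Where the difference is empty, the default
    merely excludes one more point. *)
Definition witnesses G : {set 'I_n} :=
  [set odflt ord0 [pick x in member G ij.1 :\: member G ij.2] | ij : 'I_q * 'I_q].

(** A pair of a high and a low member chooses a point of their difference. The remaining pairs
    choose freely, so that the index type does not depend on G and every coordinate has many
    choices. *)
Definition choices G (o : idx) : {set 'I_n} :=
  (if okH (highs G) o.1 && okL (highs G) o.2
   then himember G o.1 :\: lomember G o.2 else setT) :\: witnesses G.

(** A monotone test for high members: A contains a whole row of the matrix t. A high member contains
    its own row, while a low one misses its own column in every row of a high index. The row [None]
    makes the block pass the test, the column [None] makes the empty set fail. *)
Definition selects H (t : {ffun idx -> 'I_n}) : pred {set 'I_n} :=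
  fun A => [exists o', okH H o' && [forall o, okL H o ==> (t (o', o) \in A)]].

Definition block (t : {ffun idx -> 'I_n}) : {set 'I_n} := [set t o | o : idx].
Definition pivot (t : {ffun idx -> 'I_n}) : 'I_n := t (None, None).
Definition rearrange H t := compress (block t) (pivot t) (selects H t).

Lemma block_in t o : t o \in block t. Proof. exact: imset_f. Qed.

Lemma selects_mono H t A B : A \subset B -> selects H t A -> selects H t B.
Proof.
move=> /subsetP sAB /existsP[o' /andP[o'H /forallP sA]]; apply/existsP; exists o'.
rewrite o'H; apply/forallP => o; apply/implyP => oL; apply: sAB.
exact: (implyP (sA o)).
Qed.

Lemma selects_loc H t A : selects H t (A :&: block t) = selects H t A.
Proof.
apply: eq_existsb => o'; congr (_ && _); apply: eq_forallb => o.
by rewrite inE block_in andbT.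
Qed.

Lemma selects_block H t : selects H t (block t).
Proof.
apply/existsP; exists None; apply/forallP => o; apply/implyP => _; exact: block_in.
Qed.

Lemma selects0 H t : selects H t set0 = false.
Proof.
apply/existsP => -[o' /andP[_ /forallP/(_ None)]]; by rewrite /= inE.
Qed.

Lemma pivot_block t : pivot t \in block t. Proof. exact: block_in. Qed.

Lemma card_rearrange H t A : #|rearrange H t A| = #|A|.
Proof.
exact: (card_compress (pivot_block t) (selects_loc H t) (selects_block H t) (selects0 H t)).
Qed.

Definition separated G x := [forall A in G, (x \in A) == (kap < #|A|)].

Lemma lev_gap A : A \in F -> #|A| <= kap \/ kap + g < #|A|.
Proof. by rewrite inE => pA; apply: gap => //; apply: card_set_le. Qed.

Lemma rearrange_copy G t : G \in copies Q F -> t \in family (fun o => mem (choices G o)) ->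
  rearrange (highs G) t @: G \in copies Q F /\
  separated (rearrange (highs G) t @: G) (pivot t).
Proof.
move=> GF /familyP tG; have := GF; rewrite inE => /andP[sGF cpG].
have cG : #|G| = q := card_copy cpG.
have tnotW o : t o \notin witnesses G by have := tG o; rewrite inE => /andP[].
have tin o' o : okH (highs G) o' -> okL (highs G) o -> t (o', o) \in himember G o' :\: lomember G o.
  by move=> o'H oL; have := tG (o', o); rewrite inE /= o'H oL => /andP[].
have rI : {in G &, injective (rearrange (highs G) t)}.
  move=> A B AG BG eqr; apply/eqP/contraT => neqAB.
  have eqc : #|A| = #|B| by rewrite -(card_rearrange (highs G) t A) eqr card_rearrange.
  have [i eA] := member_surj cG AG; have [j eB] := member_surj cG BG.
  have : odflt ord0 [pick x in member G i :\: member G j] \in witnesses G.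
    by apply/imsetP; exists (i, j).
  case: pickP => [x|noX]; last first.
    have : A \subset B by rewrite -setD_eq0; apply/eqP/setP => x; rewrite eA eB noX inE.
    by move=> sAB; move: neqAB; rewrite eqEcard sAB eqc leqnn.
  rewrite -eA -eB => /setDP[xA xB] /= xW.
  have xX : x \notin block t by apply/imsetP => -[o _ ex]; have := tnotW o; rewrite -ex xW.
  have : x \in rearrange (highs G) t A :\: block t.
    by rewrite (compressD _ (pivot_block t)) inE xX.
  by rewrite eqr (compressD _ (pivot_block t)) inE (negbTE xB) andbF.
split.
  rewrite inE; apply/andP; split.
    apply/subsetP => _ /imsetP[A AG ->]; have := subsetP sGF A AG.
    by rewrite !inE card_rearrange.
  apply: copy_imset cpG => // A B _ _; apply: compress_mono => //.
  - exact: pivot_block.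
  - exact: selects_mono.
  - exact: selects_loc.
  - exact: selects_block.
  - exact: selects0.
apply/forall_inP => _ /imsetP[A AG ->]; rewrite card_rearrange.
rewrite (compressP _ (pivot_block t)); apply/eqP.
have [i eA] := member_surj cG AG; have [iH|iL] := boolP (i \in highs G).
  rewrite eA; have := iH; rewrite inE => ->; apply/existsP; exists (Some i).
  rewrite /= iH; apply/forallP => o; apply/implyP => oL.
  by have := tin (Some i) o iH oL; rewrite inE => /andP[].
have := iL; rewrite inE -eA => /negbTE->; apply/negbTE/existsP => -[o' /andP[o'H /forallP]].
move/(_ (Some i)); rewrite /= iL implyTb => tA.
by have := tin o' (Some i) o'H iL; rewrite inE /= -eA tA.
Qed.

Lemma card_choices G o : G \in copies Q F -> g - q ^ 2 <= #|choices G o|.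
Proof.
rewrite inE => /andP[/subsetP sGF /card_copy cG].
have cW : #|witnesses G| <= q ^ 2.
  by apply: leq_trans (leq_imset_card _ _) _; rewrite card_prod card_ord expnS expn1.
rewrite /choices cardsD.
set Y := (if _ then _ else _); suff cY : g <= #|Y|.
  by apply: leq_sub => //; apply: leq_trans cW; rewrite subset_leq_card ?subsetIr.
rewrite /Y; case: ifP => [/andP[oH oL]|_]; last first.
  by rewrite cardsT card_ord; apply: leq_trans le_kg; apply: leq_addl.
have hi : kap + g <= #|himember G o.1|.
  case: (o.1) oH => [i /=|_]; last by rewrite cardsT card_ord.
  rewrite inE => lt_i; have := lev_gap (sGF _ (member_in i cG)).
  by case; [rewrite leqNgt lt_i | apply: ltnW].
have lo : #|lomember G o.2| <= kap.
  by case: (o.2) oL => [i /=|_]; [rewrite inE -leqNgt | rewrite cards0].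
rewrite cardsD; apply: leq_trans (_ : kap + g - kap <= _); first by rewrite addKn.
by apply: leq_sub => //; apply: leq_trans lo; rewrite subset_leq_card ?subsetIr.
Qed.

Lemma card_separated x :
  #|[set G in copies Q F | separated G x]| <= La n' 'I_h.+1 Q.
Proof.
pose Fx := [set A in F | (x \in A) == (kap < #|A|)].
have -> : #|[set G in copies Q F | separated G x]| = ncopies Q Fx.
  rewrite ncopiesE; apply: eq_card => G; rewrite !inE andbAC; congr (_ && _).
  apply/andP/subsetP => [[/subsetP sG /forall_inP sep] A AG|sG].
    by rewrite inE sG // sep.
  split; first by apply/subsetP => A /sG /setIdP[].
  by apply/forall_inP => A /sG /setIdP[].
pose D := [set~ x].
have cD : #|D| = n' by rewrite cardsC1 card_ord.
(* Deleting x lowers exactly the sizes above kap, and [size] undoes this: since g > 0, a lowered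
   size still exceeds kap. *)
pose size c := if c <= kap then c else c.+1.
have sizeE A : A \in Fx -> size #|A :\ x| = #|A|.
  case/setIdP=> AF /eqP xA; have gapA := lev_gap AF; have eA := cardsD1 x A.
  rewrite xA in eA; rewrite /size; case: (ltnP kap #|A|) eA gapA => [lt_A|le_A] /= eA.
    case=> [//|lt_gA]; have {}eA : #|A| = #|A :\ x|.+1 by [].
    have [le_x|_] := leqP #|A :\ x| kap; last by rewrite eA.
    have : kap + g < kap.+1 by apply: leq_trans lt_gA _; rewrite eA ltnS.
    by rewrite -[kap.+1]addn1 ltn_add2l ltnNge g_gt0.
  by move=> _; rewrite -[in X in X <= _](add0n #|A :\ x|) -eA le_A eA.
have sizeM : {homo size : a b / a < b}.
  by move=> a b lt_ab; rewrite /size; case: (leqP a kap); case: (leqP b kap); lia.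
have fI : {in Fx &, injective (fun A => A :\ x)}.
  move=> A B AF BF eqx; have eqc : #|A| = #|B| by rewrite -sizeE // eqx sizeE.
  move: AF BF => /setIdP[_ /eqP xA] /setIdP[_ /eqP xB].
  apply/setP => y; have [->|neq] := eqVneq y x; first by rewrite xA xB eqc.
  by move/setP/(_ y): eqx; rewrite !inE neq.
apply: leq_trans (_ : ncopies Q [set A :\ x | A in Fx] <= _).
  apply: (@leq_ncopies_imset _ _ _ _ (fun A => A :\ x)) => //.
    by move=> A B _ _ sAB; apply: setSD.
  by move=> A AF; apply: imset_f.
rewrite -cD; apply: ncopies_le_La.
  by move=> _ /imsetP[A _ ->]; apply/subsetP => y; rewrite !inE => /andP[].
exists (fun C : {set 'I_n} => count p (iota 0 (size #|C|))); split.
  move=> _ /imsetP[A AF ->]; rewrite sizeE //; apply: leq_trans le_h.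
  move: AF => /setIdP[]; rewrite inE => pA _; apply: count_iota_lt => //.
  by rewrite ltnS card_set_le.
move=> _ _ /imsetP[A AF ->] /imsetP[B BF ->] /proper_card lt_AB; apply: count_iota_lt.
  exact: sizeM.
by rewrite sizeE //; move: AF => /setIdP[]; rewrite inE.
Qed.

(** Given the compressed copy, t and the high indices, G is a subset of a preimage with at most q
    2^#|idx| members. *)
Let fib := 2 ^ (q * 2 ^ #|idx|).

(** Double counting of the pairs of a copy G and a tuple t of its choices. A pair is sent to the
    compressed copy, t and [highs G], the last with 2 ^ q values. For each point x at most La(n',
    ...) copies are separated by x; prescribing the pivot saves a factor n among the tuples, which
    cancels the n values of x. *)
Lemma lev_ratio :
  ncopies Q F * (g - q ^ 2) ^ #|idx| <=
  fib * 2 ^ q * n ^ #|idx| * La n' 'I_h.+1 Q.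
Proof.
pose tups := {ffun idx -> 'I_n}.
pose X1 := [set u : {set {set 'I_n}} * tups |
  (u.1 \in copies Q F) && (u.2 \in [set t in family (fun o => mem (choices u.1 o))])].
pose X2 := [set u : {set {set 'I_n}} * (tups * {set 'I_q}) |
  (u.1 \in copies Q F) && (u.2 \in setX [set t : tups | t (None, None) \in
     [set x | separated u.1 x]] setT)].
pose f (u : {set {set 'I_n}} * tups) :=
  (rearrange (highs u.1) u.2 @: u.1, (u.2, highs u.1)).
have le1 : ncopies Q F * (g - q ^ 2) ^ #|idx| <= #|X1|.
  rewrite /X1 (card_dep (copies Q F) (fun G => [set t in family (fun o => mem (choices G o))])).
  rewrite ncopiesE -sum_nat_const; apply: leq_sum => G GF; rewrite cardsE.
  by apply: leq_card_family => o; apply: card_choices.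
have le2 : #|X1| <= #|X2| * fib.
  apply: (leq_card_fibres (f := f)).
    move=> [G t] /setIdP[/= GF]; rewrite inE => tG.
    have [c1 c2] := rearrange_copy GF tG.
    by rewrite inE /= c1 /= inE /= inE inE in_setT andbT c2.
  move=> [G' [t H]] /setIdP[/= G'F _].
  pose pre := [set A | rearrange H t A \in G'].
  have cpre : #|pre| <= q * 2 ^ #|idx|.
    apply: leq_trans (card_compress_preim (selects H t) (pivot_block t) G') _.
    rewrite (card_copy (_ : is_copy Q G')); last by move: G'F; rewrite inE => /andP[].
    by rewrite leq_mul2l leq_pexp2l ?orbT // (leq_trans (leq_imset_card _ _)).
  apply: leq_trans (_ : #|powerset pre| <= _); last first.
    by rewrite card_powerset leq_pexp2l.
  have fI : {in [set u in X1 | f u == (G', (t, H))] &, injective fst}.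
    move=> [G1 t1] [G2 t2] /setIdP[_ /eqP[_ -> _]] /setIdP[_ /eqP[_ -> _]] /= ->; by [].
  rewrite -(card_in_imset fI); apply: subset_leq_card.
  apply/subsetP => _ /imsetP[[G1 t1] /setIdP[_ /eqP[eG et eH]] ->] /=.
  rewrite inE; apply/subsetP => A AG; rewrite inE -eG -et -eH; exact: imset_f.
have le3 : #|X2| * n <= 2 ^ q * n ^ #|idx| * (n * La n' 'I_h.+1 Q).
  rewrite /X2 (card_dep (copies Q F) (fun G => setX [set t : tups | t (None, None) \in
     [set x | separated G x]] setT)) big_distrl /=.
  apply: (@leq_trans (\sum_(G in copies Q F) 2 ^ q * n ^ #|idx| * #|[set x | separated G x]|)).
    apply: leq_sum => G _; rewrite cardsX -powersetT card_powerset cardsT card_ord.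
    have := @card_ffun_at idx 'I_n (None, None) [set x | separated G x].
    rewrite card_ord; set a := #|_|; set b := #|_|; set e := 2 ^ q; set c := n ^ _ => le.
    by rewrite mulnAC mulnC -mulnA leq_mul2l [c * b]mulnC le orbT.
  rewrite -big_distrr /= leq_mul2l; apply/orP; right.
  rewrite (eq_bigr (fun G => \sum_(x | separated G x) 1)); last first.
    by move=> G _; rewrite sum1_card cardsE.
  rewrite (exchange_big_dep predT) //=.
  apply: leq_trans (_ : \sum_(x : 'I_n) La n' 'I_h.+1 Q <= _); last first.
    by rewrite sum_nat_const card_ord.
  apply: leq_sum => x _; rewrite sum1_card; apply: leq_trans (card_separated x).
  by apply: eq_leq; apply: eq_card => G; rewrite unfold_in [RHS]inE.
have n_gt0 : 0 < n by [].
rewrite -(leq_pmul2r n_gt0); apply: leq_trans (_ : #|X2| * fib * n <= _).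
  by rewrite leq_mul2r (leq_trans le1 le2) orbT.
set e := 2 ^ q in le3 *; set c := n ^ _ in le3 *; set l := La _ _ _ in le3 *.
rewrite mulnAC -[leqRHS]mulnA [l * n]mulnC -2![leqRHS]mulnA [leqRHS]mulnC mulnA.
by rewrite leq_mul2r le3 orbT.
Qed.

End Ratio.

(** The gap is so long that g - q ^ 2 is at least a fixed fraction of n, and the powers of n in
    [lev_ratio] cancel. *)
Lemma lev_ratio_le d (Q : finPOrderType d) h : 0 < #|Q| ->
  exists c n0, forall n p, n0 <= n -> count p (iota 0 n.+2) <= h ->
    ncopies Q (lev n.+1 p) <= c * La n 'I_h.+1 Q.
Proof.
move=> Q_gt0; pose q := #|Q|; pose D := #|idx Q|.
exists (2 ^ (q * 2 ^ D) * 2 ^ q * (2 * h.+1) ^ D), (2 * h + 2 * h.+1 * q ^ 2 + 2 * h.+1).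
move=> n p le_n le_h; have [kap le_kg gap] := gap_ex le_h.
set g := n.+1 %/ h.+1 in le_kg gap.
have g_gt : n.+1 - h <= h.+1 * g.
  have := divn_eq n.+1 h.+1; have := ltn_pmod n.+1 (ltn0Sn h); rewrite -/g; lia.
have n_le : n.+1 <= 2 * h.+1 * (g - q ^ 2) by nia.
have gq_gt0 : 0 < g - q ^ 2 by rewrite lt0n; apply: contraTneq n_le => ->; rewrite muln0.
have g_gt0 : 0 < g by apply: leq_trans gq_gt0 (leq_subr _ _).
have := lev_ratio Q_gt0 le_h le_kg g_gt0 gap; rewrite -/q -/D => le_r.
have pos : 0 < (g - q ^ 2) ^ D by rewrite expn_gt0 gq_gt0.
rewrite -(leq_pmul2r pos); apply: leq_trans le_r _.
have le_pow : n.+1 ^ D <= (2 * h.+1) ^ D * (g - q ^ 2) ^ D.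
  by rewrite -expnMn; case: (D) => // D'; rewrite leq_exp2r.
rewrite [leqRHS]mulnAC leq_mul2r -[leqRHS]mulnA leq_mul2l le_pow !orbT //.
Qed.

(** * Adding a single top element *)

Lemma height_copy d (Q : finPOrderType d) (T : finType) k (F B : {set {set T}}) :
  ranked k F -> B \in copies Q F -> height Q <= k.
Proof.
case=> rho [rho_lt rhoM]; rewrite inE => /andP[sBF /is_copyP[phi [phiI phiB phiM]]].
have phiF x : phi x \in F by apply: (subsetP sBF); rewrite -phiB imset_f.
have [C chC <-] := height_chain Q; rewrite -[leqRHS]card_ord.
have fI : {in C &, injective (fun x => Ordinal (rho_lt _ (phiF x)))}.
  move=> x y xC yC /(congr1 val) /= eqxy; apply/eqP/contraT => neq_xy.
  case/orP: (chC x y xC yC) => /phiM sxy.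
    by have := rhoM _ _ (phiF x) (phiF y); rewrite properEneq sxy (inj_eq phiI) neq_xy eqxy ltnn => /(_ isT).
  by have := rhoM _ _ (phiF y) (phiF x); rewrite properEneq sxy (inj_eq phiI) eq_sym neq_xy eqxy ltnn => /(_ isT).
by rewrite -(card_in_imset fI) max_card.
Qed.

Section TopLevel.
Variables (d : Order.disp_t) (Q : finPOrderType d).
Hypothesis Q_gt0 : 0 < #|Q|.

Let h := height Q.
Let w j := La j 'I_h.+1 Q.

Lemma copy_level n p j (B : {set {set 'I_n}}) :
  count p (iota 0 n.+1) <= h -> p j -> j <= n -> B \in copies Q (lev n p) ->
  exists2 A, A \in B & #|A| = j.
Proof.
move=> le_h pj le_jn BF; have [/exists_inP[A AB /eqP cA]|] := boolP [exists A in B, #|A| == j].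
  by exists A.
rewrite negb_exists => /forallP noA.
pose p' k := p k && (k != j).
have BF' : B \in copies Q (lev n p').
  move: BF; rewrite !inE => /andP[/subsetP sBF ->]; rewrite andbT.
  apply/subsetP => A AB; have := sBF A AB; rewrite !inE => pA.
  by rewrite /p' pA; have := noA A; rewrite AB.
have lt_h : count p' (iota 0 n.+1) < h.
  apply: leq_trans le_h; have -> : n.+1 = j + (n - j).+1 by lia.
  rewrite !iotaD !count_cat add0n /= pj /p' eqxx andbF add0n.
  have le s : count p' s <= count p s by apply: sub_count => k /andP[].
  by rewrite -addnS leq_add ?le // add1n ltnS le.
have := @lev_ranked n h.-1 p' ltac:(lia) => /height_copy/(_ BF').
by rewrite -/h; lia.
Qed.

(* If an extremal family contains the whole ground set [j], every copy uses it,
   and the copies under the j-subsets of [j + 1] are all distinct. *)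
Lemma La_top p j : count p (iota 0 j.+1) <= h -> p j ->
  j.+1 * ncopies Q (lev j p) <= w j.+1.
Proof.
move=> le_h pj; pose p' k := p k && (k <= j).
have le_h' : count p' (iota 0 j.+2) <= h.
  rewrite -[j.+2]addn1 iotaD count_cat /= add0n /p' ltnn andbF !addn0.
  by apply: leq_trans le_h; apply: sub_count => k /andP[].
apply: leq_trans (leq_La _ (ranked_free (lev_ranked le_h'))).
rewrite ncopiesE -{1}(binSn j) -card_level -sum_nat_const.
apply: (@leq_trans (\sum_(X in level j.+1 j) #|below Q (lev j.+1 p') X|)).
  by apply: leq_sum => X; rewrite inE => /eqP cX; apply: ncopies_below; rewrite cX.
rewrite (eq_bigr (fun X : {set 'I_j.+1} =>
    \sum_(B in copies Q (lev j.+1 p') | cover B \subset X) 1)); last first.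
  by move=> X _; rewrite -sum1_card; apply: eq_bigl => B; rewrite [LHS]inE.
rewrite (exchange_big_dep (mem (copies Q (lev j.+1 p')))) /=; last by move=> X B _ /andP[].
rewrite ncopiesE -[leqRHS]sum1_card; apply: leq_sum => B BK; rewrite sum1_card.
have [A AB cA] := @copy_level j.+1 p' j B le_h' ltac:(by rewrite /p' pj leqnn) (leqnSn j) BK.
apply: leq_trans (_ : #|[set A]| <= _); last by rewrite cards1.
apply: subset_leq_card; apply/subsetP => X; rewrite unfold_in /= BK /= !inE.
case/andP=> /eqP cX sX; rewrite eq_sym eqEcard cX cA leqnn andbT.
exact: subset_trans (bigcup_sup A AB) sX.
Qed.

Lemma strong_oplus1 : level_conj_strongly 'I_h.+1 Q ->
  level_conj_strongly 'I_h.+2 (oplus Q 1).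
Proof.
case=> n0 strong.
have opt n : n0 <= n -> exists2 p, count p (iota 0 n.+1) <= h & w n = ncopies Q (lev n p).
  move=> le_n; have [F [/full_levelsP[p eF] freeF eqF]] := strong n le_n.
  exists p; last by rewrite -eF.
  by apply: ranked_lev; rewrite -eF; apply: free_ranked.
have [c1 [n1 ratio]] := lev_ratio_le h Q_gt0.
(* From n0 on there are optimal levels, from n1 on the ratio is bounded by c1, and j >= c1 makes the
   factor j + 1 of [La_top] exceed that bound. *)
pose J := n0 + n1 + c1.
have notop j p : J <= j -> 0 < w j -> count p (iota 0 j.+1) <= h ->
    w j = ncopies Q (lev j p) -> ~~ p j.
  move=> le_J w_gt0 le_h eqw; apply/negP => pj.
  have := La_top le_h pj; rewrite -eqw leqNgt => /negP; apply.
  have [p' le_h' ->] := opt j.+1 ltac:(rewrite /J in le_J; lia).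
  apply: leq_ltn_trans (ratio _ _ _ le_h') _; first by rewrite /J in le_J; lia.
  by rewrite -/(w j) ltn_pmul2r // ltnS; rewrite /J in le_J; lia.
(* Since J <= n / 2, a maximising j below J can be replaced by J: neither the binomial coefficient
   nor w decreases. *)
exists (2 * J) => n le_n; have le_Jn : J <= n by lia.
pose g (j : 'I_n.+1) := 'C(n, j) * w j.
have n_gt0 : 0 < #|'I_n.+1| by rewrite card_ord.
have [j0 eqj0] := bigop.eq_bigmax g n_gt0.
have [j le_j maxj] : exists2 j, J <= j <= n & forall k, k <= n -> 'C(n, k) * w k <= 'C(n, j) * w j.
  have max0 k : k <= n -> 'C(n, k) * w k <= 'C(n, j0) * w j0.
    move=> le_k; rewrite -/(g j0) -eqj0.
    exact: (bigop.leq_bigmax (F := g) (Ordinal (le_k : k < n.+1))).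
  have [le_J|lt_J] := leqP J j0.
    by exists j0 => //; rewrite le_J -ltnS ltn_ord.
  exists J => [|k le_k]; first by rewrite leqnn.
  apply: leq_trans (max0 k le_k) _; apply: leq_mul; last exact/La_mono/ltnW.
  by apply: leq_bin_mono; lia.
have le_La := La_oplus1 (m := 'C(n, j) * w j) maxj.
have [w0|w_gt0] := posnP (w j).
  exists (lev n pred0); rewrite w0 muln0 leqn0 in le_La.
  have free0 : poset_free 'I_h.+2 (lev n pred0).
    by apply: ranked_free; apply: lev_ranked; rewrite count_pred0.
  split=> //; first by apply/full_levelsP; exists pred0.
  apply/eqP; rewrite eqn_leq leq_La // andbT; move/eqP: le_La => ->; exact: leq0n.
have /andP[le_Jj le_jn] := le_j.
have [p le_h eqw] := opt j ltac:(rewrite /J in le_Jj; lia).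
have np := notop j p le_Jj w_gt0 le_h eqw.
have [fullF freeF] := @addlev_good _ Q n j p j le_jn le_h.
exists (lev n (addlev j p j)); split=> //.
apply/eqP; rewrite eqn_leq leq_La // andbT; apply: leq_trans le_La _; rewrite eqw.
apply: oplus1_lev => // k; rewrite leq_eqVlt => /predU1P[->|//] pj.
by rewrite pj in np.
Qed.

(** Placing the tops at level j + 1 avoids any clash with the levels on [j] and costs a factor n, as
    C(n, j) <= n C(n, j + 1). This needs j < n. *)
Lemma almost_oplus1 : level_conj_almost 'I_h.+1 Q ->
  level_conj_almost 'I_h.+2 (oplus Q 1).
Proof.
move=> /almostE[k0 [C0 [n0 bound]]]; apply: almostI; first by rewrite card_ord.
have [c1 [n1 ratio]] := lev_ratio_le h Q_gt0.
pose c2 := C0 * c1 + 1.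
exists (k0 + k0.+1), (c2 * C0), (2 * n0 + n1 + 1) => n le_n.
have n_gt0 : 0 < n by lia.
have pow_gt0 k : 0 < n ^ k by rewrite expn_gt0 n_gt0.
have step j : n0 <= j -> j < n -> exists2 F : {set {set 'I_n}},
    full_levels F /\ poset_free 'I_h.+2 F &
    'C(n, j) * w j <= C0 * (n ^ k0.+1 * ncopies (oplus Q 1) F).
  move=> le_j lt_jn; have [p le_h bp] := bound j le_j.
  exists (lev n (addlev j p j.+1)); first exact: (addlev_good j.+1 (ltnW lt_jn) le_h).
  have le_c := @oplus1_lev _ Q n j j.+1 p (fun k le_k _ => le_k) (leqnSn j).
  have le_C : 'C(n, j) <= n * 'C(n, j.+1).
    apply: (@leq_trans (j.+1 * 'C(n, j.+1))); last by rewrite leq_mul2r lt_jn orbT.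
    by rewrite mul_bin_left leq_pmull // subn_gt0.
  apply: leq_trans (leq_mul le_C bp) _.
  have le_p : j ^ k0 <= n ^ k0 by case: (k0) => // k1; rewrite leq_exp2r // ltnW.
  apply: (@leq_trans (n * 'C(n, j.+1) * (C0 * (n ^ k0 * ncopies Q (lev j p))))).
    by rewrite !leq_mul2l leq_mul2r le_p !orbT.
  apply: (@leq_trans (C0 * (n ^ k0.+1 * ('C(n, j.+1) * ncopies Q (lev j p))))).
    by rewrite expnS; apply: eq_leq; ring.
  by rewrite !leq_mul2l le_c !orbT.
have [j [le_n0j lt_jn maxj]] : exists j, [/\ n0 <= j, j < n &
    forall k, k <= n -> 'C(n, k) * w k <= c2 * n ^ k0 * ('C(n, j) * w j)].
  pose g (j : 'I_n) := 'C(n, j) * w j.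
  have n1' : 0 < #|'I_n| by rewrite card_ord.
  have [j0 eqj0] := bigop.eq_bigmax g n1'.
  have max0 k : k < n -> 'C(n, k) * w k <= 'C(n, j0) * w j0.
    move=> lt_k; rewrite -/(g j0) -eqj0.
    exact: (bigop.leq_bigmax (F := g) (Ordinal lt_k)).
  have [j [le_j lt_j maxj]] : exists j, [/\ n0 <= j, j < n &
      forall k, k < n -> 'C(n, k) * w k <= 'C(n, j) * w j].
    have [le_j|lt_j] := leqP n0 j0; first by exists j0; split.
    exists n0; split=> [//||k lt_k]; first by lia.
    apply: leq_trans (max0 k lt_k) _; apply: leq_mul; last exact/La_mono/ltnW.
    by apply: leq_bin_mono; lia.
  exists j; split=> // k; rewrite leq_eqVlt => /predU1P[->|lt_k]; last first.
    apply: leq_trans (maxj k lt_k) _; rewrite leq_pmull // muln_gt0 pow_gt0.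
    by rewrite /c2 addn1.
  (* The remaining index k = n is reduced to n - 1 by the ratio bound, applied to the good levels on
     [n]. *)
  rewrite binn mul1n; have [p le_h bp] := bound n ltac:(lia).
  have en : n = n.-1.+1 by lia.
  have le_r : ncopies Q (lev n p) <= c1 * w n.-1.
    by rewrite en in le_h *; apply: ratio => //; lia.
  have le_w : w n.-1 <= 'C(n, j) * w j.
    apply: leq_trans (maxj n.-1 _); last by lia.
    by rewrite leq_pmull // bin_gt0 leq_pred.
  apply: leq_trans bp _.
  apply: (@leq_trans (C0 * (n ^ k0 * (c1 * ('C(n, j) * w j))))).
    rewrite !leq_mul2l; apply/orP; right; apply/orP; right.
    by apply: leq_trans le_r _; rewrite leq_mul2l le_w orbT.
  apply: (@leq_trans (C0 * c1 * n ^ k0 * ('C(n, j) * w j))).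
    by apply: eq_leq; ring.
  by rewrite leq_mul2r leq_mul2r leq_addr !orbT.
have [F goodF leF] := step j le_n0j lt_jn; exists F => //.
apply: leq_trans (La_oplus1 maxj) _.
apply: (@leq_trans (c2 * n ^ k0 * (C0 * (n ^ k0.+1 * ncopies (oplus Q 1) F)))).
  by rewrite leq_mul2l leF orbT.
by rewrite expnD; apply: eq_leq; ring.
Qed.

End TopLevel.

Theorem theorem1p10 (d : Order.disp_t) (Q : finPOrderType d) (hQ : 0 < #|Q|) :
  (forall r : nat, 2 <= r ->
     (forall n : nat, exists2 i : nat, i <= n &
        La n 'I_(height Q).+2 (oplus Q r) <=
          \max_(0 <= j < n.+1)
            ('C(n, i) * beta0 r (level (n - i) (j - i)) *
               La j 'I_(height Q).+1 Q))
     /\ (level_conj_almost 'I_(height Q).+1 Q ->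
         level_conj_almost 'I_(height Q).+2 (oplus Q r)))
  /\
  [/\ forall n : nat,
        La n 'I_(height Q).+2 (oplus Q 1) <=
          \max_(0 <= j < n.+1) ('C(n, j) * La j 'I_(height Q).+1 Q),
      level_conj_strongly 'I_(height Q).+1 Q ->
        level_conj_strongly 'I_(height Q).+2 (oplus Q 1)
    & level_conj_almost 'I_(height Q).+1 Q ->
        level_conj_almost 'I_(height Q).+2 (oplus Q 1)].
Proof.
split=> [r r_gt1|]; [split|split].
- by move=> n; apply: La_oplus_ex.
- exact: almost_oplus.
- move=> n; apply: La_oplus1 => k le_k; rewrite big_mkord.
  pose g (j : 'I_n.+1) := 'C(n, j) * La j 'I_(height Q).+1 Q.
  exact: (bigop.leq_bigmax (F := g) (Ordinal (le_k : k < n.+1))).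
- exact: strong_oplus1.
- exact: almost_oplus1.
Qed.
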